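(* Let $K$ be a field, $A = K[[X_1,\ldots,X_n]]$, $\mathfrak{m} = (X_1,\ldots,X_n)$, and $R = G_{\mathfrak{m}}(A) \cong K[X_1,\ldots,X_n]$. Let $M$ be a (finitely generated) Cohen-Macaulay $A$-module, let $p = \operatorname{projdim} M$ and let $\beta_i = \beta_i(M)$ be the $i$-th Betti number of $M$. Let $\mathbb{F}$ be a minimal free resolution of $M$ with differentials $\phi_i\colon F_i\to F_{i-1}$ for $1\le i\le p$, and let $d_i = \sum_{j=1}^{i} v(\phi_j)$ for $1\le i\le p$. The following conditions are equivalent: (i) $G_{\mathfrak{m}}(M)$ has a pure resolution over $R$. (ii) The following hold: (a) the complex $\operatorname{in}(\mathbb{F})$ is acyclic; (b) for $1\le i\le p$, $$\beta_i = (-1)^{i+1}\beta_0\prod_{\substack{1\le j\le p\\ j\ne i}}\frac{d_j}{d_j-d_i};$$ (c) the multiplicity of $M$ is $$e_0(M) = \frac{\beta_0}{p!}\prod_{i=1}^p d_i.$$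
   Context: $G_{\mathfrak{m}}(A) = \bigoplus_{i\ge 0} \mathfrak{m}^i/\mathfrak{m}^{i+1}$, which is identified with $R=K[X_1,\ldots,X_n]$ with its standard grading, and $G_{\mathfrak{m}}(M) = \bigoplus_{i\ge 0}\mathfrak{m}^iM/\mathfrak{m}^{i+1}M$, a finitely generated graded $R$-module. $E(-d)$ denotes the graded shift $E(-d)_i = E_{i-d}$. $e_0(M)$ is the multiplicity of $M$ with respect to $\mathfrak{m}$. A complex of the form $0\to C_p\to\cdots\to C_0\to 0$ is acyclic if its homology vanishes in all degrees $i\ge 1$. Pure resolution: a finitely generated graded $R$-module $E$ of projective dimension $q$ has a pure resolution of type $(e_0,e_1,\ldots,e_q)$ if its minimal graded free resolution has the form $0 \to R(-e_q)^{b_q} \to \cdots \to R(-e_1)^{b_1} \to R(-e_0)^{b_0} \to 0$ (each free module is generated in a single degree). $E$ has a pure resolution if this holds for some type. Initial forms: let $\phi = (a_{ij}) \colon A^r \to A^m$ be a nonzero $A$-linear map, and let $s\ge 0$ be such that $\operatorname{image}\phi \subseteq \mathfrak{m}^sA^m$ but $\operatorname{image}\phi\nsubseteq \mathfrak{m}^{s+1}A^m$. Write $\phi = \sum_{j\ge s}\phi_j$ with $\phi_j$ a matrix whose entries are homogeneous forms of degree $j$. Then $v(\phi) = s$ is the order of $\phi$, and $\operatorname{in}(\phi) = \phi_s$ (regarded as a matrix over $R$) is the initial form of $\phi$. The complex $\operatorname{in}(\mathbb{F})$: for the minimal free resolution $\mathbb{F}\colon 0\to F_p \xrightarrow{\phi_p}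 F_{p-1}\to\cdots\to F_1\xrightarrow{\phi_1}F_0\to 0$ of $M$, with $\beta_i = \operatorname{rank}F_i$ and $d_i = \sum_{j=1}^i v(\phi_j)$, $\operatorname{in}(\mathbb{F})$ is the complex of graded $R$-modules $$0\to R(-d_p)^{\beta_p}\xrightarrow{\operatorname{in}(\phi_p)}R(-d_{p-1})^{\beta_{p-1}}\to\cdots\to R(-d_1)^{\beta_1}\xrightarrow{\operatorname{in}(\phi_1)}R^{\beta_0}\to 0.$$ *)

(* Defs.v *)
From HB Require Import structures.
From mathcomp Require Import all_boot all_order all_algebra.
From mathcomp Require Import boolp classical_sets.
From mathcomp Require Import mpoly.

Set Implicit Arguments.
Unset Strict Implicit.
Unset Printing Implicit Defensive.

Import GRing.Theory.
Local Open Scope ring_scope.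
Local Open Scope classical_set_scope.
Local Open Scope quotient_scope.

Definition is_max (P : nat -> Prop) (d : nat) : Prop :=
  P d /\ forall k, P k -> (k <= d)%N.

Definition is_min (P : nat -> Prop) (d : nat) : Prop :=
  P d /\ forall k, P k -> (d <= k)%N.

Section Modules.
Variable R : comNzRingType.
Implicit Types V : lmodType R.

Definition span V (S : set V) : set V :=
  [set x | exists k (c : 'I_k -> R) (s : 'I_k -> V),
     (forall i, S (s i)) /\ x = \sum_(i < k) c i *: s i].

Definition ideal_gen (S : set R) : set R := @span R^o S.

Fixpoint ideal_pow (I : set R) (s : nat) : set R :=
  if s is s'.+1 then
    ideal_gen [set x | exists a b, [/\ I a, ideal_pow I s' b & x = a * b]]
  else setT.

Definition ideal_mul (I : set R) V : set V :=
  span [set x | exists a y, I a /\ x = a *: y].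

Arguments ideal_mul I V _ : clear implicits.

Definition finitely_generated V : Prop :=
  exists k (g : 'I_k -> V), span (range g) = setT.

Definition submodule V (N : set V) : Prop := GRing.submod_closed (mem N).

(* ell(V / N) = l : the longest strict chains of submodules of V containing N
   consist of l inclusions *)
Definition length_quot V (N : set V) : nat -> Prop := is_max (fun l =>
  exists c : nat -> set V,
    (forall i, (i <= l)%N -> submodule (c i) /\ N `<=` c i) /\
    (forall i, (i < l)%N -> c i `<` c i.+1)).

Definition annihilator V : set R := [set a | forall x : V, a *: x = 0].

Definition prime_ideal (P : set R) : Prop :=
  idealr_closed (mem P) /\ prime_idealr_closed (mem P).

(* Krull dimension, for finitely generated V: the support of V is the set of
   primes containing the annihilator *)
Definition krull_dim V : nat -> Prop := is_max (fun d =>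
  exists c : nat -> set R,
    (forall i, (i <= d)%N -> prime_ideal (c i) /\ annihilator V `<=` c i) /\
    (forall i, (i < d)%N -> c i `<` c i.+1)).

(* The submodule (x_0, ..., x_(r-1)) V *)
Definition seq_mul V (x : nat -> R) (r : nat) : set V :=
  ideal_mul (ideal_gen [set a | exists2 j, (j < r)%N & a = x j]) V.

Arguments seq_mul V x r _ : clear implicits.

Definition regular_seq V (I : set R) (x : nat -> R) (r : nat) : Prop :=
  [/\ forall i, (i < r)%N -> I (x i),
      forall i, (i < r)%N -> forall y : V,
        seq_mul V x i (x i *: y) -> seq_mul V x i y
    & seq_mul V x r <> setT].

Definition depth (I : set R) V : nat -> Prop := is_max (fun r =>
  exists x : nat -> R, regular_seq V I x r).

(* For R Noetherian local with maximal ideal I and V finitely generated *)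
Definition cohen_macaulay (I : set R) V : Prop :=
  (exists x : V, x <> 0) /\ exists d, krull_dim V d /\ depth I V d.

Definition projective V : Prop :=
  forall (U W : lmodType R) (f : {linear U -> W}) (g : {linear V -> W}),
    (forall w, exists u, f u = w) ->
    exists h : {linear V -> U}, forall x, f (h x) = g x.

Definition has_projective_resolution V (q : nat) : Prop :=
  exists (P : nat -> lmodType R) (d : forall i, {linear P i.+1 -> P i})
         (e : {linear P 0%N -> V}),
    [/\ forall i, projective (P i),
        forall i (x : P i), (q < i)%N -> x = 0,
        forall y, exists x, e x = y,
        forall x, e x = 0 <-> exists z, x = d 0%N z
      & forall i x, d i x = 0 <-> exists z, x = d i.+1 z].

Definition projdim V : nat -> Prop := is_min (has_projective_resolution V).

(* ... -> R^(b 1) -> R^(b 0) -> V -> 0; the matrix D i maps R^(b i.+1) to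
   R^(b i), acting on column vectors *)
Definition free_resolution V (b : nat -> nat)
    (D : forall i, 'M[R]_(b i, b i.+1)) (e : {linear 'cV[R]_(b 0%N) -> V}) : Prop :=
  [/\ forall y, exists x, e x = y,
      forall x, e x = 0 <-> exists z, x = D 0%N *m z
    & forall i (x : 'cV_(b i.+1)), D i *m x = 0 <-> exists z, x = D i.+1 *m z].

End Modules.

Arguments ideal_mul {R} I V _.
Arguments seq_mul {R} V x r _.

Record mseries (n : nat) (K : Type) := MSeries { scoef : 'X_{1..n} -> K }.

Notation "{ 'mseries' K [ n ] }" := (mseries n K)
  (at level 0, K at level 2, n at level 2, format "{ 'mseries'  K [ n ] }")
  : type_scope.

HB.instance Definition _ n K := gen_eqMixin (mseries n K).
HB.instance Definition _ n K := gen_choiceMixin (mseries n K).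

Section MSeries.
Variables (n : nat) (K : fieldType).
Implicit Types f g h : {mseries K[n]}.

Lemma mseriesP f g : (forall m, scoef f m = scoef g m) -> f = g.
Proof. by case: f g => [f] [g] /= /funext ->. Qed.

Definition ms_zero : {mseries K[n]} := MSeries (fun=> 0).
Definition ms_one : {mseries K[n]} := MSeries (fun m => (m == 0%MM)%:R).
Definition ms_opp f : {mseries K[n]} := MSeries (fun m => - scoef f m).
Definition ms_add f g : {mseries K[n]} :=
  MSeries (fun m => scoef f m + scoef g m).
Definition ms_mul f g : {mseries K[n]} := MSeries (fun m =>
  \sum_(k : 'X_{1..n < (mdeg m).+1, (mdeg m).+1} | m == (k.1 + k.2)%MM)
     scoef f k.1 * scoef g k.2).

Definition mtrunc (N : nat) f : {mpoly K[n]} :=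
  \sum_(m : 'X_{1..n < N}) scoef f m *: 'X_[m].

Lemma mtruncE N f m : (mdeg m < N)%N -> (mtrunc N f)@_m = scoef f m.
Proof.
move=> hm; rewrite /mtrunc raddf_sum /= (bigD1 (BMultinom hm)) //=.
rewrite mcoeffZ mcoeffX eqxx mulr1 big1 ?addr0 // => k nk.
rewrite mcoeffZ mcoeffX; case: eqP => [e|]; last by rewrite mulr0.
by case/eqP: nk; apply: val_inj.
Qed.

Lemma mdeg_split (m a b : 'X_{1..n}) : m = (a + b)%MM ->
  (mdeg a <= mdeg m)%N /\ (mdeg b <= mdeg m)%N.
Proof. by move=> ->; rewrite mdegD leq_addr leq_addl. Qed.

Lemma ms_mulE N f g m : (mdeg m < N)%N ->
  scoef (ms_mul f g) m = (mtrunc N f * mtrunc N g)@_m.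
Proof.
move=> hm; rewrite mcoeffM /=; apply: eq_bigr => k /eqP /mdeg_split [h1 h2].
by rewrite !mtruncE // (leq_ltn_trans _ hm).
Qed.

Lemma mcoeffM_congr (p p' q q' : {mpoly K[n]}) m :
  (forall k, (mdeg k <= mdeg m)%N -> p@_k = p'@_k) ->
  (forall k, (mdeg k <= mdeg m)%N -> q@_k = q'@_k) ->
  (p * q)@_m = (p' * q')@_m.
Proof.
move=> hp hq; rewrite !mcoeffM; apply: eq_bigr => k /eqP /mdeg_split [h1 h2].
by rewrite hp ?hq.
Qed.

Lemma ms_addA : associative ms_add.
Proof. by move=> f g h; apply: mseriesP => m /=; rewrite addrA. Qed.
Lemma ms_addC : commutative ms_add.
Proof. by move=> f g; apply: mseriesP => m /=; rewrite addrC. Qed.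
Lemma ms_add0 : left_id ms_zero ms_add.
Proof. by move=> f; apply: mseriesP => m /=; rewrite add0r. Qed.
Lemma ms_addN : left_inverse ms_zero ms_opp ms_add.
Proof. by move=> f; apply: mseriesP => m /=; rewrite addNr. Qed.

HB.instance Definition _ :=
  GRing.isZmodule.Build (mseries n K) ms_addA ms_addC ms_add0 ms_addN.

Lemma ms_mulA : associative ms_mul.
Proof.
move=> f g h; apply: mseriesP => m.
rewrite !(ms_mulE _ _ (ltnSn (mdeg m))).
transitivity ((mtrunc (mdeg m).+1 f *
               (mtrunc (mdeg m).+1 g * mtrunc (mdeg m).+1 h))@_m).
  by apply: mcoeffM_congr => // k hk; rewrite mtruncE // -ms_mulE.
rewrite mulrA.
by apply: mcoeffM_congr => // k hk; rewrite mtruncE // -ms_mulE.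
Qed.

Lemma ms_mulC : commutative ms_mul.
Proof.
move=> f g; apply: mseriesP => m.
by rewrite !(ms_mulE _ _ (ltnSn (mdeg m))) mulrC.
Qed.

Lemma ms_mul1 : left_id ms_one ms_mul.
Proof.
move=> f; apply: mseriesP => m; rewrite (ms_mulE _ _ (ltnSn (mdeg m))).
rewrite -[RHS](mtruncE f (ltnSn (mdeg m))) -[in RHS](mul1r (mtrunc _ _)).
by apply: mcoeffM_congr => // k hk; rewrite mtruncE // mcoeff1.
Qed.

Lemma ms_mulDl : left_distributive ms_mul ms_add.
Proof.
move=> f g h; apply: mseriesP => m /=; rewrite -big_split /=.
by apply: eq_bigr => k _; rewrite mulrDl.
Qed.

Lemma ms_1neq0 : ms_one != ms_zero.
Proof.
apply/eqP => /(congr1 (fun f => scoef f 0%MM)) /= /eqP.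
by rewrite eqxx oner_eq0.
Qed.

HB.instance Definition _ := GRing.Zmodule_isComNzRing.Build (mseries n K)
  ms_mulA ms_mulC ms_mul1 ms_mulDl ms_1neq0.

Definition ms_of_mpoly (p : {mpoly K[n]}) : {mseries K[n]} :=
  MSeries (fun m => p@_m).

Lemma ms_of_mpolyD p q : ms_of_mpoly (p + q) = ms_of_mpoly p + ms_of_mpoly q.
Proof. by apply: mseriesP => m /=; rewrite mcoeffD. Qed.
Lemma ms_of_mpolyM p q : ms_of_mpoly (p * q) = ms_of_mpoly p * ms_of_mpoly q.
Proof. by apply: mseriesP => m /=; rewrite mcoeffM. Qed.
Lemma ms_of_mpoly1 : ms_of_mpoly 1 = 1.
Proof. by apply: mseriesP => m /=; rewrite mcoeff1. Qed.
Lemma ms_of_mpoly0 : ms_of_mpoly 0 = 0.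
Proof. by apply: mseriesP => m /=; rewrite mcoeff0. Qed.

(* The maximal ideal (X_1, ..., X_n) of K[[X_1, ..., X_n]] *)
Definition ms_max : set {mseries K[n]} :=
  ideal_gen [set f | exists i : 'I_n, f = ms_of_mpoly 'X_i].

Definition ms_homog (s : nat) f : {mpoly K[n]} :=
  \sum_(m : 'X_{1..n < s.+1} | mdeg m == s) scoef f m *: 'X_[m].

(* v(phi), with junk value 0 when no s qualifies (that is, when phi = 0) *)
Definition mx_order (a b : nat) (phi : 'M[{mseries K[n]}]_(a, b)) : nat :=
  xget 0%N [set s |
    range (mulmx phi : 'cV_b -> 'cV_a) `<=` ideal_mul (ideal_pow ms_max s) 'cV_a
    /\ ~ (range (mulmx phi : 'cV_b -> 'cV_a)
            `<=` ideal_mul (ideal_pow ms_max s.+1) 'cV_a)].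

Definition mx_in (a b : nat) (phi : 'M[{mseries K[n]}]_(a, b)) :
    'M[{mpoly K[n]}]_(a, b) :=
  map_mx (ms_homog (mx_order phi)) phi.

(* x = e_0(M): the Hilbert-Samuel function of M is eventually a polynomial, and
   x / d! is its coefficient of degree d = dim M *)
Definition is_multiplicity (M : lmodType {mseries K[n]}) (x : rat) : Prop :=
  exists (d : nat) (P : {poly rat}),
    [/\ krull_dim M d,
        exists s0, forall s, (s0 <= s)%N ->
          exists l, length_quot (ideal_mul (ideal_pow ms_max s.+1) M) l /\
                    l%:R = P.[s%:R]
      & x = d`!%:R * P`_d].

Definition multiplicity (M : lmodType {mseries K[n]}) : rat :=
  xget 0 (is_multiplicity M).

Definition minimal_free_resolution (M : lmodType {mseries K[n]}) (p : nat)
    (beta : nat -> nat) (phi : forall i, 'M[{mseries K[n]}]_(beta i, beta i.+1))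
    (eps : {linear 'cV[{mseries K[n]}]_(beta 0%N) -> M}) : Prop :=
  [/\ free_resolution phi eps,
      forall i k l, ms_max (phi i k l)
    & forall i, (p < i)%N -> beta i = 0%N].

End MSeries.

Section Graded.
Variables (n : nat) (K : fieldType).
Local Notation R := {mpoly K[n]}.

(* Homogeneous of degree d in Z; only 0 is homogeneous of negative degree *)
Definition homogz (d : int) (f : R) : Prop :=
  match d with Posz d => f \is d.-homog | Negz _ => f = 0 end.

Record gradedModule := GradedModule {
  gmod :> lmodType R;
  gcomp : int -> set gmod;
  gcomp0 : forall i, gcomp i 0;
  gcompB : forall i x y, gcomp i x -> gcomp i y -> gcomp i (x - y);
  gcompZ : forall (d : nat) i (f : R) x,
    f \is d.-homog -> gcomp i x -> gcomp (d%:Z + i) (f *: x);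
  gcomp_sum : forall x, exists (s : seq int) (c : int -> gmod),
    (forall i, gcomp i (c i)) /\ x = \sum_(i <- s) c i;
  gcomp_direct : forall (s : seq int) (c : int -> gmod), uniq s ->
    (forall i, gcomp i (c i)) -> \sum_(i <- s) c i = 0 ->
    forall i, i \in s -> c i = 0
}.

(* The degree d component of the direct sum of the R(-g k), k < b *)
Definition free_comp (b : nat) (g : 'I_b -> int) (d : int) : set 'cV[R]_b :=
  [set v | forall k, homogz (d - g k) (v k 0)].

(* A sequence of homogeneous maps (of degree 0)
     ... -> (+)_k R(- gdeg 1 k) -> (+)_k R(- gdeg 0 k) *)
Record gradedFreeSeq := GradedFreeSeq {
  grank : nat -> nat;
  gdeg : forall i, 'I_(grank i) -> int;
  gdiff : forall i, 'M[R]_(grank i, grank i.+1);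
  gdiff_homog : forall i d v,
    free_comp (@gdeg i.+1) d v -> free_comp (@gdeg i) d (gdiff i *m v)
}.

(* Position i.+1 is exact; the condition includes gdiff i *m gdiff i.+1 = 0 *)
Definition acyclic (C : gradedFreeSeq) : Prop :=
  forall i (x : 'cV_(grank C i.+1)), gdiff C i *m x = 0 <-> exists z, x = gdiff C i.+1 *m z.

Definition mpoly_max : set R := ideal_gen [set f | exists i : 'I_n, f = 'X_i].

Definition minimal_graded_free_resolution
    (E : gradedModule) (C : gradedFreeSeq) : Prop :=
  exists eps : {linear 'cV[R]_(grank C 0) -> E},
    [/\ forall d v, free_comp (@gdeg C 0) d v -> gcomp d (eps v),
        free_resolution (gdiff C) eps
      & forall i k l, mpoly_max (gdiff C i k l)].

Definition pure_resolution_of_type (E : gradedModule) (q : nat)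
    (e : nat -> int) : Prop :=
  projdim E q /\
  exists C, [/\ minimal_graded_free_resolution E C,
                forall i, (q < i)%N -> grank C i = 0%N
              & forall i, (i <= q)%N -> forall k, @gdeg C i k = e i].

Definition has_pure_resolution (E : gradedModule) : Prop :=
  exists q e, pure_resolution_of_type E q e.

End Graded.

Section QuotientModule.
Variables (R : pzRingType) (V : lmodType R) (N : {pred V}).
Hypothesis subN : GRing.submod_closed N.

Definition qpred of GRing.submod_closed N : {pred V} := N.
HB.instance Definition _ (h : GRing.submod_closed N) :=
  GRing.isSubmodClosed.Build R V (qpred h) h.

Definition qmod := Quotient.quot (qpred subN).
HB.instance Definition _ := GRing.Zmodule.on qmod.

Definition qproj (x : V) : qmod := \pi_(Quotient.quot (qpred subN)) x.
Definition qscale (a : R) (x : qmod) : qmod := qproj (a *: repr x).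

Lemma qproj_eq (x y : V) : qproj x = qproj y <-> x - y \in N.
Proof.
rewrite -/(x - y \in qpred subN) (Quotient.idealrBE (qpred subN) x y); split; first by move=> h; apply/eqP.
by move/eqP.
Qed.

Lemma qproj_repr (x : qmod) : qproj (repr x) = x.
Proof. by rewrite /qproj; exact: reprK. Qed.

Lemma qprojB : {morph qproj : x y / x - y}.
Proof. by move=> x y; rewrite /qproj !piE. Qed.
Lemma qprojD : {morph qproj : x y / x + y}.
Proof. by move=> x y; rewrite /qproj !piE. Qed.
Lemma qproj0 : qproj 0 = 0.
Proof. by rewrite -(subrr 0) qprojB subrr. Qed.

Lemma qprojZ a x : qproj (a *: x) = qscale a (qproj x).
Proof.
apply/qproj_eq; rewrite -scalerBr; apply: (GRing.subsemimod_closedZ subN).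
by apply/qproj_eq; rewrite qproj_repr.
Qed.

Lemma qscaleA a b (x : qmod) : qscale a (qscale b x) = qscale (a * b) x.
Proof. by rewrite -[x]qproj_repr -!qprojZ scalerA. Qed.
Lemma qscale1 : left_id 1 qscale.
Proof. by move=> x; rewrite -[x]qproj_repr -!qprojZ scale1r. Qed.
Lemma qscaleDr : right_distributive qscale +%R.
Proof.
move=> a x y; rewrite -[x]qproj_repr -[y]qproj_repr.
by rewrite -qprojD -!qprojZ -qprojD scalerDr.
Qed.
Lemma qscaleDl (x : qmod) : {morph qscale^~ x : a b / a + b}.
Proof.
by move=> a b; rewrite -[x]qproj_repr -!qprojZ scalerDl qprojD.
Qed.

HB.instance Definition _ :=
  GRing.Zmodule_isLmodule.Build R qmod qscaleA qscale1 qscaleDr qscaleDl.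

End QuotientModule.

(* G_m(M) is built as (+)_i m^i M / (+)_i m^(i+1) M, where m^i M is placed in
   degree i of the sequences in M. A sequence x stands for the formal sum of the
   x_i t^i, and a form f of degree d in K[X_1, ..., X_n] acts as f t^d; this is
   the action of G_m(A) on G_m(M) under the identification of the class of f in
   m^d / m^(d+1) with the form f. *)
Record tseq (n : nat) (K : fieldType) (M : lmodType {mseries K[n]}) :=
  TSeq { tcoef : nat -> M }.

HB.instance Definition _ n K M := gen_eqMixin (@tseq n K M).
HB.instance Definition _ n K M := gen_choiceMixin (@tseq n K M).

Section AssocGraded.
Variables (n : nat) (K : fieldType) (M : lmodType {mseries K[n]}).
Local Notation A := {mseries K[n]}.
Local Notation R := {mpoly K[n]}.
Local Notation T := (tseq M).
Implicit Types (x y : T) (f g : R).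

Lemma tseqP x y : (forall i, tcoef x i = tcoef y i) -> x = y.
Proof. by case: x y => [x] [y] /= /funext ->. Qed.

Definition t_zero : T := TSeq (fun=> 0).
Definition t_opp x : T := TSeq (fun i => - tcoef x i).
Definition t_add x y : T := TSeq (fun i => tcoef x i + tcoef y i).
Definition t_scale f x : T := TSeq (fun i =>
  \sum_(j < i.+1) ms_of_mpoly (pihomog mdeg j f) *: tcoef x (i - j)).

Lemma t_addA : associative t_add.
Proof. by move=> x y z; apply: tseqP => i /=; rewrite addrA. Qed.
Lemma t_addC : commutative t_add.
Proof. by move=> x y; apply: tseqP => i /=; rewrite addrC. Qed.
Lemma t_add0 : left_id t_zero t_add.
Proof. by move=> x; apply: tseqP => i /=; rewrite add0r. Qed.
Lemma t_addN : left_inverse t_zero t_opp t_add.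
Proof. by move=> x; apply: tseqP => i /=; rewrite addNr. Qed.

HB.instance Definition _ :=
  GRing.isZmodule.Build (tseq M) t_addA t_addC t_add0 t_addN.

Lemma tcoef_sum I (r : seq I) (F : I -> T) i :
  tcoef (\sum_(j <- r) F j) i = \sum_(j <- r) tcoef (F j) i.
Proof. by elim/big_rec2: _ => // j a b _ <-. Qed.

Lemma pihomogM l f g : pihomog mdeg l (f * g) =
  \sum_(j < l.+1) pihomog mdeg j f * pihomog mdeg (l - j) g.
Proof.
pose k := (l + msize f + msize g).+1.
have hf : f = \sum_(d < k) pihomog mdeg d f.
  apply: pihomog_partitionE.
  by rewrite /k (leq_trans (leq_addl l _)) // ltnW // ltnS leq_addr.
have hg : g = \sum_(d < k) pihomog mdeg d g.
  by apply: pihomog_partitionE; rewrite /k ltnW // ltnS leq_addl.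
have lk : (l.+1 <= k)%N by rewrite ltnS -addnA leq_addr.
rewrite {1}hf {1}hg mulr_suml raddf_sum /=.
rewrite [RHS](big_ord_widen k
  (fun j => pihomog mdeg j f * pihomog mdeg (l - j) g) lk) [RHS]big_mkcond /=.
apply: eq_bigr => j _; rewrite mulr_sumr raddf_sum /=.
have hom d e : pihomog mdeg d f * pihomog mdeg e g \is (d + e).-homog.
  by apply: dhomogM; apply: pihomogP.
case: ltnP => hj.
  have hlj : (l - j < k)%N by rewrite (leq_ltn_trans (leq_subr _ _)).
  rewrite (bigD1 (Ordinal hlj)) //= big1 ?addr0 => [|e ne].
    by apply: pihomog_dE; have := hom j (l - j)%N; rewrite subnKC // -ltnS.
  apply: (@pihomog_ne0 _ _ _ (j + e)%N l) => //; apply/eqP => h.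
  by case/eqP: ne; apply: val_inj; rewrite /= -h addKn.
rewrite big1 // => e _; apply: (@pihomog_ne0 _ _ _ (j + e)%N l) => //.
by apply/eqP => h; move: hj; rewrite -h ltnNge leq_addr.
Qed.

Lemma t_scaleA f g x : t_scale f (t_scale g x) = t_scale (f * g) x.
Proof.
apply: tseqP => i /=.
pose F a b := (ms_of_mpoly (pihomog mdeg a f) *
  ms_of_mpoly (pihomog mdeg b g)) *: tcoef x (i - (a + b)).
transitivity (\sum_(l < i.+1) \sum_(j < i.+1 | (j <= l)%N) F j (l - j)%N).
  rewrite (exchange_big_dep xpredT) //=; apply: eq_bigr => j _.
  rewrite scaler_sumr.
  rewrite -(big_mkord (fun l => (j <= l)%N) (fun l => F j (l - j)%N)).
  have hj : (j <= i.+1)%N by rewrite ltnW.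
  rewrite [RHS](@big_cat_nat _ _ _ j) //=.
  rewrite [X in _ = X + _]big_nat_cond [X in _ = X + _]big1 ?add0r; last first.
    by move=> l /andP [/andP [_ h1] h2]; move: h1; rewrite ltnNge h2.
  rewrite -[X in \sum_(X <= _ < _ | _) _]add0n big_addn big_mkord.
  rewrite subSn -1?ltnS // [RHS](eq_bigl xpredT); last by move=> l; rewrite leq_addl.
  apply: eq_bigr => l _; rewrite /F addnK scalerA subnDA //.
apply: eq_bigr => l _.
rewrite pihomogM.
have -> : ms_of_mpoly (\sum_(j < l.+1) pihomog mdeg j f * pihomog mdeg (l - j) g)
  = \sum_(j < l.+1) ms_of_mpoly (pihomog mdeg j f) *
                    ms_of_mpoly (pihomog mdeg (l - j) g).
  elim/big_rec2: _ => [|j a b _ <-]; first exact: ms_of_mpoly0.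
  by rewrite ms_of_mpolyD ms_of_mpolyM.
rewrite scaler_suml.
rewrite (big_ord_widen i.+1 (fun j => (ms_of_mpoly (pihomog mdeg j f) *
  ms_of_mpoly (pihomog mdeg (l - j) g)) *: tcoef x (i - l))) //.
by apply: eq_bigr => j hj; rewrite /F subnKC.
Qed.

Lemma t_scale1 : left_id 1 t_scale.
Proof.
move=> x; apply: tseqP => i /=; rewrite big_ord_recl /= subn0 big1 ?addr0.
  by rewrite pihomog_dE ?dhomog1 // ms_of_mpoly1 scale1r.
move=> j _; rewrite (@pihomog_ne0 _ _ _ 0%N) ?dhomog1 //.
by rewrite ms_of_mpoly0 scale0r.
Qed.

Lemma t_scaleDr : right_distributive t_scale +%R.
Proof.
move=> f x y; apply: tseqP => i /=; rewrite -big_split /=.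
by apply: eq_bigr => j _; rewrite scalerDr.
Qed.

Lemma t_scaleDl x : {morph t_scale^~ x : f g / f + g}.
Proof.
move=> f g; apply: tseqP => i /=; rewrite -big_split /=.
by apply: eq_bigr => j _; rewrite pihomogD ms_of_mpolyD scalerDl.
Qed.

HB.instance Definition _ := GRing.Zmodule_isLmodule.Build R (tseq M)
  t_scaleA t_scale1 t_scaleDr t_scaleDl.

End AssocGraded.

Section Filtration.
Variable R : comNzRingType.
Implicit Types (V : lmodType R) (I : set R).

Lemma span_sub V (S : set V) x : S x -> span S x.
Proof.
move=> Sx; exists 1%N, (fun=> 1), (fun=> x); split=> //.
by rewrite big_ord1 scale1r.
Qed.

Lemma span0 V (S : set V) : span S 0.
Proof. by exists 0%N, (fun=> 0), (fun=> 0); split=> [[]|]; rewrite ?big_ord0. Qed.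

Lemma spanZ V (S : set V) a x : span S x -> span S (a *: x).
Proof.
move=> [k [c [s [Ss ->]]]]; exists k, (fun i => a * c i), s; split=> //.
by rewrite scaler_sumr; apply: eq_bigr => i _; rewrite scalerA.
Qed.

Lemma spanD V (S : set V) x y : span S x -> span S y -> span S (x + y).
Proof.
move=> [k [c [s [Ss ->]]]] [l [d [t [St ->]]]].
exists (k + l)%N,
  (fun i => match split i with inl i => c i | inr i => d i end),
  (fun i => match split i with inl i => s i | inr i => t i end).
split=> [i|]; first by case: (split i).
rewrite big_split_ord /=; congr (_ + _); apply: eq_bigr => i _.
  by rewrite -/(unsplit (inl i)) unsplitK.
by rewrite -/(unsplit (inr i)) unsplitK.
Qed.

Lemma span_sum V (S : set V) J (r : seq J) (P : pred J) (F : J -> V) :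
  (forall j, P j -> span S (F j)) -> span S (\sum_(j <- r | P j) F j).
Proof.
move=> h; elim/big_rec: _ => [|j x Pj]; first exact: span0.
by move=> /(spanD (h j Pj)).
Qed.

Lemma span_min V (S T : set V) : T 0 -> (forall x y, T x -> T y -> T (x + y)) ->
  (forall a x, T x -> T (a *: x)) -> S `<=` T -> span S `<=` T.
Proof.
move=> T0 TD TZ ST x [k [c [s [Ss ->]]]].
by elim/big_rec: _ => // i y _ Ty; apply/TD/Ty/TZ/ST/Ss.
Qed.

Lemma ideal_powD I s a b :
  ideal_pow I s a -> ideal_pow I s b -> ideal_pow I s (a + b).
Proof. by case: s => // s; exact: (@spanD R^o). Qed.

Lemma ideal_pow0 I s : ideal_pow I s 0.
Proof. by case: s => // s; exact: (@span0 R^o). Qed.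

Lemma ideal_powZ I s a b : ideal_pow I s b -> ideal_pow I s (a * b).
Proof. by case: s => // s; exact: (@spanZ R^o). Qed.

Lemma ideal_powM I s t a b :
  ideal_pow I s a -> ideal_pow I t b -> ideal_pow I (s + t) (a * b).
Proof.
elim: s a b => [|s IHs] a b; first by move=> _; apply: ideal_powZ.
move=> ha hb; rewrite addSn.
apply: (@span_min R^o _ [set a | ideal_pow I (s + t).+1 (a * b)] _ _ _ _ a ha)
  => [|x y|c x|_ [c [d [Ic Id ->]]]] /=.
- by rewrite mul0r; apply: (ideal_pow0 I (s + t).+1).
- by rewrite mulrDl; apply: (@ideal_powD I (s + t).+1).
- by move=> /(@ideal_powZ I (s + t).+1 c); rewrite mulrA.
- apply: (@span_sub R^o); exists c, (d * b); rewrite mulrA; split=> //.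
  exact: IHs.
Qed.

Lemma ideal_mul_pow I V s t a (x : V) : ideal_pow I s a ->
  ideal_mul (ideal_pow I t) V x -> ideal_mul (ideal_pow I (s + t)) V (a *: x).
Proof.
move=> ha; apply: (@span_min _ _
  [set x | ideal_mul (ideal_pow I (s + t)) V (a *: x)]) => [|y z|c y|_ [c [y [hc ->]]]] /=.
- by rewrite scaler0; apply: span0.
- by rewrite scalerDr; apply: spanD.
- by rewrite scalerA mulrC -scalerA; apply: spanZ.
- apply: span_sub; exists (a * c), y; rewrite scalerA; split=> //.
  exact: ideal_powM.
Qed.

End Filtration.

Section MaxPowers.
Variables (n : nat) (K : fieldType).
Local Notation mm := (@ms_max n K).

Lemma ms_of_mpoly_monom (m : 'X_{1..n}) :
  ideal_pow mm (mdeg m) (ms_of_mpoly 'X_[m]).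
Proof.
elim: {m}_.+1 {-2}m (ltnSn (mdeg m)) => // N IH m hm.
have [->|[i hi]] : m = 0%MM \/ exists i, (0 < m i)%N.
- case: (pselect (exists i, (0 < m i)%N)) => [|h]; [by right|left].
  apply/mnmP => i; rewrite mnm0E; apply/eqP; rewrite -leqn0 leqNgt.
  by apply/negP => hi; apply: h; exists i.
- by rewrite mdeg0.
have em : m = (U_(i) + (m - U_(i)))%MM.
  rewrite addmC submK //; apply/mnm_lepP => j; rewrite mnm1E.
  by case: eqP => // <-.
move: hm; rewrite em mdegD mdeg1 mpolyXD ms_of_mpolyM add1n ltnS => hm.
apply: (@span_sub _ (_ ^o)); eexists; eexists; split; [| |reflexivity].
  by apply: (@span_sub _ (_ ^o)); exists i.
exact: IH.
Qed.

Lemma ms_of_mpoly_homog d (f : {mpoly K[n]}) :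
  f \is d.-homog -> ideal_pow mm d (ms_of_mpoly f).
Proof.
move=> /dhomogP hf; rewrite (mpolyE f) big_seq.
elim/big_rec: _ => [|m p hm IH].
  by rewrite ms_of_mpoly0; apply: ideal_pow0.
rewrite ms_of_mpolyD; apply: ideal_powD => //.
rewrite -mul_mpolyC ms_of_mpolyM; apply: ideal_powZ.
by rewrite -(hf _ hm); apply: ms_of_mpoly_monom.
Qed.

End MaxPowers.

Section GradedPieces.
Variables (n : nat) (K : fieldType) (M : lmodType {mseries K[n]}).
Local Notation R := {mpoly K[n]}.
Local Notation T := (tseq M).

(* m^i M *)
Definition mfilt (i : nat) : set M := ideal_mul (ideal_pow (@ms_max n K) i) M.

Lemma mfilt_scale (f : R) (x : nat -> M) s i :
  (forall j, mfilt (j + s) (x j)) ->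
  mfilt (i + s) (\sum_(j < i.+1) ms_of_mpoly (pihomog mdeg j f) *: x (i - j)%N).
Proof.
move=> hx; apply: span_sum => j _.
have -> : (i + s = j + (i - j + s))%N by rewrite addnA subnKC // -ltnS.
by apply: ideal_mul_pow; [apply/ms_of_mpoly_homog/pihomogP | apply: hx].
Qed.

(* The direct sum of the m^i M, and in it that of the m^(i+1) M *)
Definition rees_pred : {pred T} := [pred x | `[<
  (forall i, mfilt i (tcoef x i)) /\
  exists N, forall i, (N <= i)%N -> tcoef x i = 0 >]].

Lemma pihomog_big (f : R) j : (msize f <= j)%N -> pihomog mdeg j f = 0.
Proof.
move=> hj; rewrite pihomogE big_seq_cond big1 // => m /andP [hm /eqP e].
by have := msize_mdeg_lt hm; rewrite e ltnNge hj.
Qed.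

Lemma rees_submod : GRing.submod_closed rees_pred.
Proof.
split.
  apply/asboolP; split=> [i|]; first exact: span0.
  by exists 0%N.
move=> f x y /asboolP [hx [N xN]] /asboolP [hy [N' yN]].
apply/asboolP; split=> [i|] /=.
  apply: spanD; last exact: hy.
  have := @mfilt_scale f (tcoef x) 0%N i; rewrite addn0; apply=> j.
  by rewrite addn0; apply: hx.
exists (maxn N' (N + msize f)) => i; rewrite geq_max => /andP [h1 h2].
rewrite yN // addr0 big1 // => j _.
case: (leqP (msize f) j) => hj.
  by rewrite pihomog_big // ms_of_mpoly0 scale0r.
rewrite xN ?scaler0 // leq_subRL; last by rewrite -ltnS.
by rewrite addnC (leq_trans _ h2) // leq_add2l ltnW.
Qed.

Definition rees_closed : {pred T} := qpred rees_submod.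
HB.instance Definition _ := GRing.isSubmodClosed.Build R T rees_closed rees_submod.

Record rees := Rees { rees_val : T; _ : rees_val \in rees_closed }.
HB.instance Definition _ := [isSub for rees_val].
HB.instance Definition _ := [Choice of rees by <:].
HB.instance Definition _ := [SubChoice_isSubLmodule of rees by <:].

Lemma rees_valP (x : rees) i : mfilt i (tcoef (rees_val x) i).
Proof. by case: x => x /= /asboolP []. Qed.

Lemma rees_valD (x y : rees) i :
  tcoef (rees_val (x + y)) i = tcoef (rees_val x) i + tcoef (rees_val y) i.
Proof. by []. Qed.

Definition rees1_pred : {pred rees} :=
  [pred x | `[< forall i, mfilt i.+1 (tcoef (rees_val x) i) >]].

Lemma rees1_submod : GRing.submod_closed rees1_pred.
Proof.
split; first by apply/asboolP => i; apply: span0.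
move=> f x y /asboolP hx /asboolP hy; apply/asboolP => i /=.
apply: spanD; last exact: hy.
have := @mfilt_scale f (tcoef (rees_val x)) 1%N i; rewrite addn1; apply=> j.
by rewrite addn1; apply: hx.
Qed.

Definition gr : Type := qmod rees1_submod.
HB.instance Definition _ := GRing.Lmodule.on gr.
Definition gr_class (x : rees) : gr := qproj rees1_submod x.

Lemma gr_classB : {morph gr_class : x y / x - y}.
Proof. exact: qprojB. Qed.
Lemma gr_classD : {morph gr_class : x y / x + y}.
Proof. exact: qprojD. Qed.
Lemma gr_classZ f x : gr_class (f *: x) = f *: gr_class x.
Proof. exact: qprojZ. Qed.
Lemma gr_class0 : gr_class 0 = 0.
Proof. exact: qproj0. Qed.
Lemma gr_class_sum J (r : seq J) (F : J -> rees) :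
  gr_class (\sum_(j <- r) F j) = \sum_(j <- r) gr_class (F j).
Proof.
by elim/big_rec2: _ => [|j x y _ <-]; [exact: gr_class0 | rewrite gr_classD].
Qed.

Lemma gr_class_eq0 x :
  gr_class x = 0 <-> forall i, mfilt i.+1 (tcoef (rees_val x) i).
Proof.
rewrite -gr_class0 /gr_class qproj_eq subr0.
by split=> [/asboolP|h]; [|apply/asboolP].
Qed.

Lemma gr_class_surj (g : gr) : exists x, g = gr_class x.
Proof. by exists (repr g); rewrite /gr_class qproj_repr. Qed.

(* m^i M / m^(i+1) M for i >= 0, and 0 for i < 0 *)
Definition gr_comp (i : int) : set gr :=
  [set g | exists x : rees,
     g = gr_class x /\ forall j : nat, j%:Z != i -> tcoef (rees_val x) j = 0].

Lemma gr_comp0 i : gr_comp i 0.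
Proof. by exists 0; rewrite gr_class0. Qed.

Lemma gr_compB i x y : gr_comp i x -> gr_comp i y -> gr_comp i (x - y).
Proof.
move=> [a [-> ha]] [b [-> hb]]; exists (a - b); rewrite gr_classB; split=> //.
by move=> j hj /=; rewrite ha // hb // subr0.
Qed.

Lemma gr_compZ (d : nat) i (f : R) x :
  f \is d.-homog -> gr_comp i x -> gr_comp (d%:Z + i) (f *: x).
Proof.
move=> hf [a [-> ha]]; exists (f *: a); rewrite gr_classZ; split=> //.
move=> j hj /=; rewrite big1 // => k _.
case: (eqVneq (nat_of_ord k) d) => [kd|kd]; last first.
  by rewrite (@pihomog_ne0 _ _ _ d) // 1?eq_sym // ms_of_mpoly0 scale0r.
rewrite ha ?scaler0 //; apply: contra hj => /eqP <-.
have hk : (k <= j)%N by rewrite -ltnS.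
by rewrite -kd -PoszD subnKC.
Qed.

Lemma tdelta_subproof (k : nat) (x : rees) :
  TSeq (fun j => if j == k then tcoef (rees_val x) j else 0) \in rees_closed.
Proof.
apply/asboolP; split=> [j|] /=.
  by case: eqP => _; [apply: rees_valP | apply: span0].
exists k.+1 => j; case: eqP => // ->; by rewrite ltnn.
Qed.
Definition tdelta k x : rees := Rees (tdelta_subproof k x).

Lemma tcoef_rees_sum J (r : seq J) (F : J -> rees) i :
  tcoef (rees_val (\sum_(j <- r) F j)) i =
  \sum_(j <- r) tcoef (rees_val (F j)) i.
Proof. by elim/big_rec2: _ => // j a b _ <-. Qed.

Lemma gr_comp_sum x : exists (s : seq int) (c : int -> gr),
  (forall i, gr_comp i (c i)) /\ x = \sum_(i <- s) c i.
Proof.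
have [y ->] := gr_class_surj x.
have [N hN] : exists N, forall i, (N <= i)%N -> tcoef (rees_val y) i = 0.
  by case: y => y /= /asboolP [].
exists [seq Posz i | i <- iota 0 N],
  (fun i => if i is Posz k then gr_class (tdelta k y) else 0).
split=> [[k|k]|]; last 1 first.
- rewrite big_map -gr_class_sum; congr gr_class; apply: val_inj; apply: tseqP.
  move=> i; rewrite tcoef_rees_sum /= -big_mkcond /=.
  case: (ltnP i N) => hi; last first.
    by rewrite hN // big1.
  rewrite (eq_bigl (pred1 i)) => [|j /=]; last exact: eq_sym.
  by rewrite -big_filter filter_pred1_uniq ?iota_uniq ?mem_iota // big_seq1.
- by exists (tdelta k y); split=> // j; rewrite /= eqz_nat; case: eqP.
- exact: gr_comp0.
Qed.

Lemma gr_comp_direct (s : seq int) (c : int -> gr) : uniq s ->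
  (forall i, gr_comp i (c i)) -> \sum_(i <- s) c i = 0 ->
  forall i, i \in s -> c i = 0.
Proof.
move=> us /choice [y hy].
have -> : \sum_(i <- s) c i = gr_class (\sum_(i <- s) y i).
  by rewrite gr_class_sum; apply: eq_bigr => i _; case: (hy i).
move/gr_class_eq0 => h i si; rewrite (hy i).1; apply/gr_class_eq0 => k.
case: (eqVneq k%:Z i) => [ki|ki]; last by rewrite (hy i).2 //; apply: span0.
have := h k; rewrite tcoef_rees_sum (bigD1_seq i) //= big1 ?addr0 // => j ji.
by rewrite (hy j).2 // ki eq_sym.
Qed.

Definition assoc_graded : gradedModule n K :=
  GradedModule gr_comp0 gr_compB gr_compZ gr_comp_sum gr_comp_direct.

End GradedPieces.

Section InitialComplex.
Variables (n : nat) (K : fieldType) (beta : nat -> nat).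
Variable phi : forall i, 'M[{mseries K[n]}]_(beta i, beta i.+1).

(* d_i = v(phi_1) + ... + v(phi_i), where phi_(j+1) is phi j *)
Definition in_deg (i : nat) : nat := \sum_(j < i) mx_order (phi j).

Lemma homogz0 z : homogz z (0 : {mpoly K[n]}).
Proof. by case: z => d /=; rewrite ?dhomog0. Qed.

Lemma homogzD z (f g : {mpoly K[n]}) : homogz z f -> homogz z g -> homogz z (f + g).
Proof. by case: z => d /=; [exact: dhomogD | move=> -> ->; rewrite addr0]. Qed.

Lemma homogzM (d : nat) z (f g : {mpoly K[n]}) :
  f \is d.-homog -> homogz z g -> homogz (d%:Z + z) (f * g).
Proof.
move=> hf; case: z => e /= hg; first exact: dhomogM.
by rewrite hg mulr0; apply: homogz0.
Qed.

Lemma ms_homogP s (f : {mseries K[n]}) : ms_homog s f \is s.-homog.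
Proof.
apply: rpred_sum => m /eqP hm; apply: dhomogZ.
by rewrite dhomogX; apply/eqP.
Qed.

Lemma in_diff_homog i z (v : 'cV[{mpoly K[n]}]_(beta i.+1)) :
  free_comp (fun=> (in_deg i.+1)%:Z) z v ->
  free_comp (fun=> (in_deg i)%:Z) z (mx_in (phi i) *m v).
Proof.
move=> hv k; rewrite mxE; elim/big_rec: _ => [|l x _]; first exact: homogz0.
apply: homogzD; have := homogzM (ms_homogP (mx_order (phi i)) (phi i k l)) (hv l).
rewrite !mxE (_ : _ + _ = z - (in_deg i)%:Z) // {1}/in_deg big_ord_recr /=.
by rewrite PoszD opprD [LHS]addrC -!addrA addNr addr0.
Qed.

Definition in_complex : gradedFreeSeq n K :=
  @GradedFreeSeq n K beta (fun i _ => (in_deg i)%:Z) (fun i => mx_in (phi i))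
    in_diff_homog.

End InitialComplex.

(* Main.v *)
Require Import Defs.
From HB Require Import structures.
From mathcomp Require Import all_boot all_order all_algebra.
From mathcomp Require Import boolp classical_sets.
From mathcomp Require Import mpoly ring.

Set Implicit Arguments.
Unset Strict Implicit.
Unset Printing Implicit Defensive.

Import Order.TTheory GRing.Theory Num.Theory.
Local Open Scope ring_scope.

(** The proof goes through the filtered complex behind the initial forms.

  Suppose that the complex of initial forms is acyclic.  Then every differential
  [phi i] is strict for the filtrations of the free modules by the powers of the
  maximal ideal, shifted by the degrees [d_i] ([strictness]): the leading form of an
  element whose image has too large an order is a cycle, hence a boundary, and can
  be removed.  Strictness identifies the cokernel of the first initial form with the
  associated graded module ([in_coker]), so the complex of initial forms is a
  minimal graded free resolution of it, visibly pure ([in_pure]).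

  Conversely, a pure resolution of the associated graded module lifts to the given
  resolution.  By induction on [i] there is an invertible matrix [W] of power series
  that carries the image of the graded differential [D i] to the leading forms of
  the image of [phi i] ([matched]).  Since the image of [D i] is generated in one
  degree, completeness of the power series ring turns lifts of the columns of [D i]
  into generators of the image of [phi i], with control of the orders ([psi_lift]);
  these generators form the next invertible matrix because both resolutions are
  minimal.  Up to a change of basis, the initial form of [phi i] is then [D i], so
  the complex of initial forms is acyclic ([pure_acyclic]).

  Strictness also makes lengths additive along the shifted filtrations
  ([len_cokernel]), so the Hilbert-Samuel function of the module is eventually the
  alternating sum of the polynomials [beta_j * binomial (X - d_j + n) n].  Its degree
  is at most the dimension [d] of the module: a regular sequence of length [d] cuts
  the Krull dimension down to zero, and the length of the quotient by the [s]-th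
  power of the maximal ideal grows at most like [s ^ d] ([cm_growth]).  On the other
  hand [p + d <= n], because multiplication by each regular element lengthens a
  minimal resolution by one ([regular_resolution]), and no minimal resolution is
  longer than [n] ([syzygy_bound]).  Hence the alternating moments
  [sum_j (-1)^j beta_j d_j^k] vanish for [k < p].  Lagrange interpolation at the
  distinct shifts [d_j] solves these linear equations for the Betti numbers
  ([herzog_kuhl_betti]) and computes the next moment, which gives the leading
  coefficient of the Hilbert-Samuel polynomial ([herzog_kuhl_multiplicity]). *)

(** * Orders and leading forms of power series *)

Section SeriesOrder.
Variables (n : nat) (K : fieldType).
Local Notation A := {mseries K[n]}.
Local Notation R := {mpoly K[n]}.
Local Notation mm := (@ms_max n K).
Implicit Types (f g : A) (p q : R) (m : 'X_{1..n}).

Definition ord (s : nat) : set A :=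
  fun f => forall m, (mdeg m < s)%N -> scoef f m = 0.

Lemma scoef1 m : scoef (1 : A) m = (m == 0%MM)%:R. Proof. by []. Qed.
Lemma scoefD f g m : scoef (f + g) m = scoef f m + scoef g m. Proof. by []. Qed.
Lemma scoefN f m : scoef (- f) m = - scoef f m. Proof. by []. Qed.
Lemma scoefB f g m : scoef (f - g) m = scoef f m - scoef g m. Proof. by []. Qed.
Lemma scoefM f g m : scoef (f * g) m =
  \sum_(k : 'X_{1..n < (mdeg m).+1, (mdeg m).+1} | m == (k.1 + k.2)%MM)
     scoef f k.1 * scoef g k.2.
Proof. by []. Qed.
Lemma scoef_sum I (r : seq I) (P : pred I) (F : I -> A) m :
  scoef (\sum_(i <- r | P i) F i) m = \sum_(i <- r | P i) scoef (F i) m.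
Proof. by elim/big_rec2: _ => // i a b _ <-. Qed.
Lemma scoef_poly p m : scoef (ms_of_mpoly p) m = p@_m. Proof. by []. Qed.

Arguments ms_of_mpoly : simpl never.
Lemma ms_of_mpolyB : {morph (@ms_of_mpoly n K) : p q / p - q}.
Proof. by move=> p q; apply: mseriesP => m /=; rewrite mcoeffB. Qed.
HB.instance Definition _ :=
  GRing.isZmodMorphism.Build R A (@ms_of_mpoly n K) ms_of_mpolyB.
HB.instance Definition _ :=
  GRing.isMonoidMorphism.Build R A (@ms_of_mpoly n K)
    (conj (ms_of_mpoly1 n K) (@ms_of_mpolyM n K)).

Lemma mcoeff_ms_homog s f m :
  (ms_homog s f)@_m = if mdeg m == s then scoef f m else 0.
Proof.
rewrite /ms_homog raddf_sum /=; case: eqP => [e|ne].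
  have hm : (mdeg m < s.+1)%N by rewrite e.
  rewrite (bigD1 (BMultinom hm)) /= ?e // mcoeffZ mcoeffX eqxx mulr1.
  rewrite big1 ?addr0 // => k /andP [_ nk]; rewrite mcoeffZ mcoeffX.
  by case: eqP => [h|]; [case/eqP: nk; apply: val_inj | rewrite mulr0].
rewrite big1 // => k /eqP hk; rewrite mcoeffZ mcoeffX.
by case: eqP => [h|]; [case: ne; rewrite -h | rewrite mulr0].
Qed.

Lemma ms_homogB s : {morph (@ms_homog n K s) : f g / f - g}.
Proof.
move=> f g; apply/mpolyP => m; rewrite mcoeffB !mcoeff_ms_homog.
by case: eqP; rewrite ?subrr.
Qed.
HB.instance Definition _ s :=
  GRing.isZmodMorphism.Build A R (@ms_homog n K s) (ms_homogB s).

Lemma dhomog_coef s p m : p \is s.-homog -> mdeg m != s -> p@_m = 0.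
Proof.
by move=> /dhomogP h hm; apply: contraNeq hm; rewrite -mcoeff_msupp => /h /eqP.
Qed.

Lemma ms_homogK s p : p \is s.-homog -> ms_homog s (ms_of_mpoly p) = p.
Proof.
move=> hp; apply/mpolyP => m; rewrite mcoeff_ms_homog /=.
by case: eqP => // /eqP /(dhomog_coef hp) ->.
Qed.

Lemma ord_poly s p : p \is s.-homog -> ord s (ms_of_mpoly p).
Proof. by move=> hp m hm; apply: (dhomog_coef hp); rewrite neq_ltn hm. Qed.

Lemma ord0 s : ord s 0. Proof. by []. Qed.
Lemma ord_any f : ord 0 f. Proof. by []. Qed.
Lemma ordD s f g : ord s f -> ord s g -> ord s (f + g).
Proof. by move=> hf hg m hm; rewrite scoefD hf // hg // addr0. Qed.
Lemma ordN s f : ord s f -> ord s (- f).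
Proof. by move=> hf m hm; rewrite scoefN hf // oppr0. Qed.
Lemma ordB s f g : ord s f -> ord s g -> ord s (f - g).
Proof. by move=> hf hg; apply: ordD => //; apply: ordN. Qed.
Lemma ord_sum s I (r : seq I) (P : pred I) (F : I -> A) :
  (forall i, P i -> ord s (F i)) -> ord s (\sum_(i <- r | P i) F i).
Proof. by move=> h m hm; rewrite scoef_sum big1 // => i /h ->. Qed.
Lemma ord_le s t f : (s <= t)%N -> ord t f -> ord s f.
Proof. by move=> st hf m hm; apply: hf; apply: leq_trans st. Qed.

Lemma ordM s t f g : ord s f -> ord t g -> ord (s + t) (f * g).
Proof.
move=> hf hg m hm; rewrite scoefM big1 // => k /eqP.
move: (val k.1) (val k.2) => a b /(congr1 (@mdeg n)); rewrite mdegD => e.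
case: (ltnP (mdeg a) s) => h1; first by rewrite hf ?mul0r.
rewrite hg ?mulr0 // -(ltn_add2l s); apply: leq_ltn_trans hm.
by rewrite e leq_add2r.
Qed.

Lemma ordMl s f g : ord s g -> ord s (f * g).
Proof. by move=> hg; have := ordM (ord_any f) hg. Qed.

(** Leading forms multiply: all other products of coefficients have larger degree. *)
Lemma ms_homogM s t f g : ord s f -> ord t g ->
  ms_homog (s + t) (f * g) = ms_homog s f * ms_homog t g.
Proof.
move=> hf hg; apply/mpolyP => m; rewrite mcoeff_ms_homog scoefM mcoeffM.
case: eqP => [e|ne]; last first.
  rewrite big1 // => k /eqP; rewrite !mcoeff_ms_homog.
  move: (val k.1) (val k.2) => a b em.
  case: eqP => [h1|_]; last by rewrite mul0r.
  case: eqP => [h2|_]; last by rewrite mulr0.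
  by case: ne; rewrite em mdegD h1 h2.
apply: eq_bigr => k /eqP; rewrite !mcoeff_ms_homog.
move: (val k.1) (val k.2) => a b em.
have hd : (mdeg a + mdeg b = s + t)%N by rewrite -mdegD -em.
case: (ltngtP (mdeg a) s) => h1; first by rewrite hf ?mul0r.
  by rewrite (hg b) ?mulr0 ?mul0r // -(ltn_add2l s) -hd ltn_add2r.
by move/eqP: hd; rewrite h1 eqn_add2l => ->.
Qed.

Lemma ordS s f : ord s.+1 f <-> ord s f /\ ms_homog s f = 0.
Proof.
split=> [h|[h h0] m].
  split; first exact: ord_le h.
  apply/mpolyP => m; rewrite mcoeff_ms_homog mcoeff0; case: eqP => // e.
  by apply: h; rewrite e.
rewrite ltnS leq_eqVlt => /orP [e|]; last exact: h.
by have := mcoeff_ms_homog s f m; rewrite h0 mcoeff0 e => <-.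
Qed.

Lemma ord_eq0 f : (forall s, ord s f) -> f = 0.
Proof. by move=> h; apply: mseriesP => m; apply: (h (mdeg m).+1). Qed.

Lemma scoef_mulX i g m : scoef (ms_of_mpoly 'X_i * g) m =
    if (0 < m i)%N then scoef g (m - U_(i))%MM else 0.
Proof.
rewrite (ms_mulE _ _ (ltnSn (mdeg m))).
have -> : (mtrunc (mdeg m).+1 (ms_of_mpoly 'X_i) * mtrunc (mdeg m).+1 g)@_m =
          ('X_i * mtrunc (mdeg m).+1 g)@_m.
  by apply: mcoeffM_congr => // k hk; rewrite mtruncE.
rewrite mulrC; have [hi|hi] := boolP (0 < m i)%N.
  have em : m = ((m - U_(i)) + U_(i))%MM.
    rewrite submK //; apply/mnm_lepP => j; rewrite mnm1E.
    by case: eqP => // <-.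
  rewrite -(@mtruncE _ _ (mdeg m).+1 g) ?ltnS ?mdegB //.
  by rewrite -(mcoeffMX _ U_(i) (m - U_(i))%MM) addmC -em.
have [N hN] : exists N, N = mtrunc (mdeg m).+1 g by eexists.
rewrite -hN mcoeffM big1 // => k /eqP; rewrite mcoeffX.
move: (val k.1) (val k.2) => a b em.
case: eqP => [h|]; last by rewrite mulr0.
by move: hi; rewrite em -h mnmDE mnm1E eqxx addn1.
Qed.

(** Splitting the monomials of positive degree according to the first variable
  that occurs in them gives [f = \sum_i X_i f_i] with [f_i] of order one less;
  a finite sum, so no limit enters. *)
Lemma ord_decomp s f : ord s.+1 f ->
  exists F : 'I_n -> A, (forall i, ord s (F i)) /\
    f = \sum_i ms_of_mpoly 'X_i * F i.
Proof.
move=> hf.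
pose fst m := [pick i : 'I_n | (0 < m i)%N].
pose F i : A := MSeries (fun m : 'X_{1..n} =>
  if fst (m + U_(i))%MM == Some i then scoef f (m + U_(i))%MM else 0).
exists F; split=> [i m hm /=|].
  by case: eqP => // _; apply: hf; rewrite mdegD mdeg1 addn1 ltnS.
apply: mseriesP => m; rewrite scoef_sum.
under eq_bigr => i _ do rewrite scoef_mulX /=.
case: (pickP (fun i : 'I_n => (0 < m i)%N)) => [i hi|h0]; last first.
  rewrite big1 => [|i _]; last by rewrite h0.
  apply: hf; rewrite (_ : m = 0%MM) ?mdeg0 //.
  apply/mnmP => i; rewrite mnm0E; apply/eqP; rewrite -leqn0 leqNgt.
  by rewrite h0.
have sK j : (0 < m j)%N -> ((m - U_(j)) + U_(j))%MM = m.
  move=> hj; rewrite submK //; apply/mnm_lepP => l; rewrite mnm1E.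
  by case: eqP => // <-.
have [j fj] : exists j, fst m = Some j.
  rewrite /fst; case: pickP => [j _|/(_ i)]; first by exists j.
  by rewrite hi.
have hj : (0 < m j)%N.
  by move: fj; rewrite /fst; case: pickP => // l hl [<-].
rewrite (bigD1 j) //= hj sK // fj eqxx big1 ?addr0 // => l lj.
case: ifP => // hl; rewrite sK // fj; case: eqP => // - [e].
by rewrite e eqxx in lj.
Qed.

Lemma ord_max f : mm f -> ord 1 f.
Proof.
move=> [k [c [g [hg ->]]]]; apply: ord_sum => i _; apply: ordMl.
by have [j ->] := hg i; apply: ord_poly; rewrite dhomogX; apply/eqP; exact: mdeg1.
Qed.

Lemma ideal_pow_ord s : ideal_pow mm s = ord s.
Proof.
apply/predeqP => f; split.
  elim: s f => [|s IH] f //=.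
  move=> [k [c [g [hg ->]]]]; apply: ord_sum => i _; apply: ordMl.
  have [a [b [ha hb ->]]] := hg i; rewrite -add1n; apply: ordM (IH _ hb).
  exact: ord_max.
elim: s f => [|s IH] f // /ord_decomp [F [hF ->]].
apply: (@span_sum _ A^o) => i _; apply: (@span_sub _ A^o).
exists (ms_of_mpoly 'X_i), (F i); split=> //; last exact: IH.
by apply: (@span_sub _ A^o); exists i.
Qed.

Lemma ms_max_ord : mm = ord 1.
Proof.
apply/predeqP => f; split; first exact: ord_max.
move=> /ord_decomp [F [_ ->]].
apply: (@span_sum _ A^o) => i _; rewrite mulrC.
by apply: (@spanZ _ A^o); apply: (@span_sub _ A^o); exists i.
Qed.

Lemma scoef_const f g : scoef (f * g) 0%MM = scoef f 0%MM * scoef g 0%MM.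
Proof.
have := ms_homogM (ord_any f) (ord_any g).
move/(congr1 (fun p => p@_0%MM)); rewrite mcoeff_ms_homog mdeg0 addn0 eqxx => ->.
by rewrite (rmorphM (mcoeff 0%MM)) /= !mcoeff_ms_homog mdeg0 eqxx.
Qed.

Definition sconst (f : A) : K := scoef f 0%MM.
Arguments sconst : simpl never.
Lemma sconst_zmod : zmod_morphism sconst. Proof. by []. Qed.
HB.instance Definition _ := GRing.isZmodMorphism.Build A K sconst sconst_zmod.
Lemma sconst_monoid : monoid_morphism sconst.
Proof. by split; [rewrite /sconst scoef1 eqxx | exact: scoef_const]. Qed.
HB.instance Definition _ := GRing.isMonoidMorphism.Build A K sconst sconst_monoid.

Lemma ord1_sconst f : ord 1 f <-> sconst f = 0.
Proof.
split=> [h|h m]; first by apply: h; rewrite mdeg0.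
by rewrite ltnS leqn0 mdeg_eq0 => /eqP ->.
Qed.

Lemma sconstC c : sconst (ms_of_mpoly c%:MP) = c.
Proof. by rewrite /sconst /= mcoeffC eqxx mulr1. Qed.

(** The geometric series inverts [1 - h]: its coefficient at [m] is already that
  of a partial sum, since [h ^ k] has order at least [k]. *)
Lemma series_unit f : sconst f != 0 -> exists g, f * g = 1.
Proof.
move=> f0; pose c := sconst f; pose h := 1 - ms_of_mpoly (c^-1)%:MP * f.
have h1 : ord 1 h.
  by apply/ord1_sconst; rewrite rmorphB rmorph1 rmorphM /= sconstC mulVf ?subrr.
have hk k : ord k (h ^+ k).
  elim: k => [|k IH]; first exact: ord_any.
  by rewrite exprS -add1n; apply: ordM.
pose g : A := MSeries (fun m => \sum_(k < (mdeg m).+1) scoef (h ^+ k) m).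
have hg N : ord N (g - \sum_(k < N) h ^+ k).
  move=> m hm; rewrite scoefB scoef_sum /= (big_ord_widen N (fun k => scoef (h ^+ k) m)) //.
  rewrite [X in _ - X](bigID (fun k : 'I_N => (k < (mdeg m).+1)%N)) /=.
  rewrite opprD addrA subrr add0r big1 ?oppr0 // => k.
  by rewrite -leqNgt => /hk.
exists (ms_of_mpoly (c^-1)%:MP * g); rewrite mulrCA mulrA.
have -> : ms_of_mpoly c^-1%:MP * f = 1 - h by rewrite /h opprB addrC subrK.
apply/eqP; rewrite -subr_eq0; apply/eqP; apply: ord_eq0 => N.
have -> : (1 - h) * g - 1 = (1 - h) * (g - \sum_(k < N) h ^+ k) - h ^+ N.
  rewrite mulrBr -addrA; congr (_ + _).
  by rewrite -mulNr opprB -subrX1 addrAC subrr add0r.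
by apply: ordB => //; apply: ordMl.
Qed.

Lemma ord1_or_unit f : ord 1 f \/ exists g, f * g = 1.
Proof.
case: (eqVneq (sconst f) 0) => [/ord1_sconst|/series_unit]; by [left|right].
Qed.

End SeriesOrder.

Lemma col_sum_delta (R : pzRingType) b (x : 'cV[R]_b) :
  x = \sum_j x j 0 *: delta_mx j 0.
Proof.
apply/colP => j; rewrite summxE (bigD1 j) //= !mxE !eqxx mulr1.
by rewrite big1 ?addr0 // => i ij; rewrite !mxE eq_sym (negbTE ij) mulr0.
Qed.

Section MatrixOrder.
Variables (n : nat) (K : fieldType).
Local Notation A := {mseries K[n]}.
Local Notation R := {mpoly K[n]}.
Local Notation mm := (@ms_max n K).

Definition mord (s a b : nat) (X : 'M[A]_(a, b)) := forall i j, ord s (X i j).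
Definition mhom (s a b : nat) (X : 'M[A]_(a, b)) : 'M[R]_(a, b) :=
  map_mx (ms_homog s) X.
Definition mser (a b : nat) (P : 'M[R]_(a, b)) : 'M[A]_(a, b) :=
  map_mx (@ms_of_mpoly n K) P.
Definition mdhomog (s a b : nat) (P : 'M[R]_(a, b)) :=
  forall i j, P i j \is s.-homog.
Definition mpih (s a b : nat) (P : 'M[R]_(a, b)) : 'M[R]_(a, b) :=
  map_mx (pihomog mdeg s) P.

Lemma mordD s a b (X Y : 'M_(a, b)) : mord s X -> mord s Y -> mord s (X + Y).
Proof. by move=> hX hY i j; rewrite mxE; apply: ordD. Qed.
Lemma mordB s a b (X Y : 'M_(a, b)) : mord s X -> mord s Y -> mord s (X - Y).
Proof. by move=> hX hY i j; rewrite !mxE; apply: ordB. Qed.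
Lemma mordN s a b (X : 'M_(a, b)) : mord s X -> mord s (- X).
Proof. by move=> hX i j; rewrite !mxE; apply: ordN. Qed.
Lemma mord0 s a b : mord s (0 : 'M_(a, b)).
Proof. by move=> i j; rewrite mxE; apply: ord0. Qed.
Lemma mord_any a b (X : 'M_(a, b)) : mord 0 X. Proof. by []. Qed.
Lemma mord_le s t a b (X : 'M_(a, b)) : (s <= t)%N -> mord t X -> mord s X.
Proof. by move=> st hX i j; apply: ord_le (hX i j). Qed.
Lemma mordZ s t c a b (X : 'M_(a, b)) : ord s c -> mord t X -> mord (s + t) (c *: X).
Proof. by move=> hc hX i j; rewrite mxE; apply: ordM. Qed.
Lemma mord_sum s a b I (r : seq I) (P : pred I) (F : I -> 'M_(a, b)) :
  (forall i, P i -> mord s (F i)) -> mord s (\sum_(i <- r | P i) F i).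
Proof. by move=> h i j; rewrite summxE; apply: ord_sum => k /h. Qed.

Lemma mord_mul s t a b c (X : 'M_(a, b)) (Y : 'M_(b, c)) :
  mord s X -> mord t Y -> mord (s + t) (X *m Y).
Proof. by move=> hX hY i j; rewrite mxE; apply: ord_sum => k _; apply: ordM. Qed.

Lemma mord_mulr t a b c (X : 'M_(a, b)) (Y : 'M_(b, c)) :
  mord t Y -> mord t (X *m Y).
Proof. by move=> hY; have := mord_mul (mord_any X) hY. Qed.

Lemma mord_mull s a b c (X : 'M_(a, b)) (Y : 'M_(b, c)) :
  mord s X -> mord s (X *m Y).
Proof. by move=> hX; have := mord_mul hX (mord_any Y); rewrite addn0. Qed.

Lemma mhom_mul s t a b c (X : 'M_(a, b)) (Y : 'M_(b, c)) :
  mord s X -> mord t Y -> mhom (s + t) (X *m Y) = mhom s X *m mhom t Y.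
Proof.
move=> hX hY; apply/matrixP => i j; rewrite !mxE raddf_sum.
by apply: eq_bigr => k _; rewrite !mxE -ms_homogM.
Qed.

Lemma mordS s a b (X : 'M_(a, b)) : mord s.+1 X <-> mord s X /\ mhom s X = 0.
Proof.
split=> [h|[h h0] i j].
  split=> [i j|]; first by case/ordS: (h i j).
  by apply/matrixP => i j; rewrite !mxE; case/ordS: (h i j).
by apply/ordS; split=> //; move/matrixP/(_ i j): h0; rewrite !mxE.
Qed.

Lemma mord_eq0 a b (X : 'M_(a, b)) : (forall s, mord s X) -> X = 0.
Proof. by move=> h; apply/matrixP => i j; rewrite mxE; apply: ord_eq0 => s; apply: h. Qed.

Lemma mhomog_homog s a b (X : 'M_(a, b)) : mdhomog s (mhom s X).
Proof. by move=> i j; rewrite mxE; apply: ms_homogP. Qed.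

Lemma mord_ser s a b (P : 'M_(a, b)) : mdhomog s P -> mord s (mser P).
Proof. by move=> h i j; rewrite mxE; apply: ord_poly. Qed.

Lemma mhomK s a b (P : 'M_(a, b)) : mdhomog s P -> mhom s (mser P) = P.
Proof. by move=> h; apply/matrixP => i j; rewrite !mxE; apply: ms_homogK. Qed.

Lemma mhomB s a b (X Y : 'M_(a, b)) : mhom s (X - Y) = mhom s X - mhom s Y.
Proof. by apply/matrixP => i j; rewrite !mxE ms_homogB. Qed.
Lemma mhom0 s a b : mhom s (0 : 'M_(a, b)) = 0.
Proof. by apply/matrixP => i j; rewrite !mxE raddf0. Qed.
Lemma mserM a b c (X : 'M_(a, b)) (Y : 'M_(b, c)) : mser (X *m Y) = mser X *m mser Y.
Proof. exact: map_mxM. Qed.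
Lemma mser0 a b : mser (0 : 'M_(a, b)) = 0.
Proof. exact: map_mx0. Qed.

Lemma mord_lead s a b (X : 'M_(a, b)) : mord s X ->
  mord s.+1 (X - mser (mhom s X)).
Proof.
move=> h; apply/mordS; split; first by apply: mordB => //; apply/mord_ser/mhomog_homog.
by rewrite mhomB mhomK ?subrr //; apply: mhomog_homog.
Qed.

Lemma mhom_eq s a b (X Y : 'M_(a, b)) : mord s.+1 (X - Y) -> mhom s X = mhom s Y.
Proof. by move=> /mordS [_] /eqP; rewrite mhomB subr_eq0 => /eqP. Qed.

Lemma mdhomog_delta b (k : 'I_b) : mdhomog 0 (delta_mx k 0 : 'cV[R]_b).
Proof. by move=> i j; rewrite mxE; case: (_ && _); rewrite ?dhomog1 ?dhomog0. Qed.
Lemma mdhomog0 s a b : mdhomog s (0 : 'M_(a, b)).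
Proof. by move=> i j; rewrite mxE; apply: dhomog0. Qed.
Lemma mpihP s a b (X : 'M_(a, b)) : mdhomog s (mpih s X).
Proof. by move=> i j; rewrite mxE; apply: pihomogP. Qed.
Lemma mpihK s a b (X : 'M_(a, b)) : mdhomog s X -> mpih s X = X.
Proof. by move=> h; apply/matrixP => i j; rewrite mxE; apply: pihomog_dE. Qed.
Lemma mpih_ne s t a b (X : 'M_(a, b)) : mdhomog s X -> t != s -> mpih t X = 0.
Proof.
move=> hX ts; apply/matrixP => i j; rewrite !mxE.
by rewrite (@pihomog_ne0 _ _ _ s) // eq_sym.
Qed.
Lemma mpih_sum a b (X : 'M_(a, b)) : exists N, X = \sum_(s < N) mpih s X.
Proof.
exists (\max_(i : 'I_a) \max_(j : 'I_b) msize (X i j)).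
apply/matrixP => i j; rewrite summxE.
under eq_bigr => s _ do rewrite mxE.
apply: pihomog_partitionE; apply: (leq_trans _ (leq_bigmax i)).
exact: (leq_bigmax j).
Qed.

Lemma pihomog_mull v s (q p : R) : q \is v.-homog ->
  pihomog mdeg (v + s) (q * p) = q * pihomog mdeg s p.
Proof.
move=> hq; pose N := maxn (msize p) s.+1.
rewrite {1}(@pihomog_partitionE _ _ mdeg N p) ?leq_maxl //.
have hs : (s < N)%N by rewrite /N leq_maxr.
rewrite mulr_sumr raddf_sum /= (bigD1 (Ordinal hs)) //= big1 ?addr0.
  by rewrite pihomog_dE //; apply: dhomogM => //; apply: pihomogP.
move=> k nk; apply: (@pihomog_ne0 _ _ mdeg (v + k)); last first.
  by apply: dhomogM => //; apply: pihomogP.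
by rewrite eqn_add2l; apply: contra nk => /eqP e; apply/eqP/val_inj.
Qed.

Lemma pihomog_mull_lt v s (q p : R) : q \is v.-homog -> (s < v)%N ->
  pihomog mdeg s (q * p) = 0.
Proof.
move=> hq hs; rewrite {1}(@pihomog_partitionE _ _ mdeg (msize p) p) //.
rewrite mulr_sumr raddf_sum /= big1 // => k _.
apply: (@pihomog_ne0 _ _ mdeg (v + k)); last first.
  by apply: dhomogM => //; apply: pihomogP.
by rewrite neq_ltn (leq_trans hs) ?leq_addr ?orbT.
Qed.

Lemma mpih_mul v s a b c (Q : 'M_(a, b)) (X : 'M_(b, c)) : mdhomog v Q ->
  mpih (v + s) (Q *m X) = Q *m mpih s X.
Proof.
move=> hQ; apply/matrixP => i j; rewrite !mxE raddf_sum.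
by apply: eq_bigr => k _; rewrite !mxE /= pihomog_mull.
Qed.

Lemma mpih_mul_lt v s a b c (Q : 'M_(a, b)) (X : 'M_(b, c)) : mdhomog v Q ->
  (s < v)%N -> mpih s (Q *m X) = 0.
Proof.
move=> hQ hs; apply/matrixP => i j; rewrite !mxE raddf_sum.
by rewrite big1 // => k _; rewrite /= (pihomog_mull_lt _ (hQ i k)).
Qed.

Lemma exact_homogE v w a b c (P : 'M[R]_(a, b)) (Q : 'M[R]_(b, c)) :
  mdhomog v P -> mdhomog w Q ->
  (forall x : 'cV_b, P *m x = 0 <-> exists z, x = Q *m z) ->
  forall s (x : 'cV_b), mdhomog s x -> P *m x = 0 ->
     ((s < w)%N -> x = 0) /\
     ((w <= s)%N -> exists2 z, mdhomog (s - w) z & x = Q *m z).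
Proof.
move=> hP hQ h s x hx /h [z ez]; split=> hs.
  by rewrite -(mpihK hx) ez (mpih_mul_lt _ hQ hs).
exists (mpih (s - w) z); first exact: mpihP.
by rewrite -(mpih_mul _ _ hQ) subnKC // -ez mpihK.
Qed.

Lemma ideal_mul_ord s b : ideal_mul (ideal_pow mm s) 'cV[A]_b = @mord s b 1.
Proof.
rewrite ideal_pow_ord; apply/predeqP => x; split.
  move=> [k [c [g [hg ->]]]]; apply: mord_sum => i _ j l; rewrite mxE; apply: ordMl.
  by have [a [y [ha ->]]] := hg i; rewrite mxE mulrC; apply: ordMl.
move=> hx; rewrite [x]col_sum_delta.
by apply: span_sum => j _; apply: span_sub; exists (x j 0), (delta_mx j 0).
Qed.

Lemma mfilt_image (M : lmodType A) b (e : {linear 'cV[A]_b -> M}) s (v : 'cV[A]_b) :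
  mord s v -> @mfilt n K M s (e v).
Proof.
rewrite -ideal_mul_ord => - [k [c [g [hg ->]]]].
rewrite linear_sum; apply: span_sum => i _; rewrite linearZ; apply: spanZ.
have [a [y [ha ->]]] := hg i; rewrite linearZ; apply: span_sub.
by exists a, (e y).
Qed.

Lemma mfilt_surj (M : lmodType A) b (e : {linear 'cV[A]_b -> M}) :
  (forall y, exists x, e x = y) ->
  forall s x, @mfilt n K M s x <-> exists2 v, mord s v & x = e v.
Proof.
move=> es s x; split.
  move=> [k [c [g [hg ->]]]].
  have /choice [v hv] : forall i, exists v, mord s v /\ g i = e v.
    move=> i; have [a [y [ha ->]]] := hg i; have [z <-] := es y.
    exists (a *: z); rewrite linearZ; split=> //.
    by move: ha; rewrite ideal_pow_ord => ha; rewrite -[s]addn0; apply: mordZ.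
  exists (\sum_i c i *: v i).
    by apply: mord_sum => i _; apply: (@mordZ 0) => //; case: (hv i).
  by rewrite linear_sum; apply: eq_bigr => i _; rewrite linearZ; case: (hv i) => _ ->.
by move=> [v hv ->]; apply: mfilt_image.
Qed.

Lemma range_ord s a b (X : 'M[A]_(a, b)) :
  (range (mulmx X : 'cV_b -> 'cV_a) `<=` ideal_mul (ideal_pow mm s) 'cV_a)%classic
  <-> mord s X.
Proof.
rewrite ideal_mul_ord; split=> [h i j|h _ [v _ <-]]; last first.
  by rewrite -[s]addn0; apply: mord_mul.
have := h (X *m delta_mx j 0); rewrite -colE => /(_ _ i 0); rewrite mxE; apply.
by exists (delta_mx j 0); rewrite // -colE.
Qed.

Lemma mx_orderE s a b (X : 'M[A]_(a, b)) : mord s X -> ~ mord s.+1 X ->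
  mx_order X = s.
Proof.
move=> h1 h2; apply: xget_unique => [|t [/range_ord t1 t2]].
  by split; [apply/range_ord | move/range_ord].
apply/eqP; rewrite eqn_leq leqNgt [(s <= t)%N]leqNgt; apply/andP; split; apply/negP.
  by move=> h; apply: h2; apply: mord_le t1.
by move=> h; apply: t2; apply/range_ord; apply: mord_le h1.
Qed.

Lemma mx_orderP a b (X : 'M[A]_(a, b)) : mord (mx_order X) X.
Proof.
rewrite /mx_order; case: xgetP => [s _ [/range_ord //]|_]; exact: mord_any.
Qed.

Lemma mord_ex a b (X : 'M[A]_(a, b)) : X <> 0 ->
  exists2 s, mord s X & ~ mord s.+1 X.
Proof.
move=> X0.
have [s hs] : exists s, ~ mord s X.
  by apply: contrapT => h; apply: X0; apply: mord_eq0 => s; apply: contrapT => hs; apply: h; exists s.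
elim: s hs => [/(_ (mord_any _)) []|s IH hs].
by case: (pselect (mord s X)) => [h|/IH]; [exists s|].
Qed.

Lemma mx_orderNS a b (X : 'M[A]_(a, b)) : X <> 0 -> ~ mord (mx_order X).+1 X.
Proof. by move=> /mord_ex [s h1 h2]; rewrite (mx_orderE h1 h2). Qed.

Lemma mx_in_homog a b (X : 'M[A]_(a, b)) : mdhomog (mx_order X) (mx_in X).
Proof. exact: mhomog_homog. Qed.

End MatrixOrder.

Arguments mx_orderP {n K a b} X.
Arguments mx_in_homog {n K a b} X.
Arguments mpihP {n K} s {a b} X.
Arguments mhomog_homog {n K} s {a b} X.
Arguments mord_any {n K a b} X.

(** * Chains of submodules and lengths *)

Section LinearFunctions.
Variables (R : pzRingType) (U V : lmodType R) (f : U -> V).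
Definition lin_fun of linear f := f.
HB.instance Definition _ (lf : linear f) :=
  GRing.isLinear.Build R U V *:%R (lin_fun lf) lf.
End LinearFunctions.

Section Chains.
Variables (R : comNzRingType) (V : lmodType R).
Implicit Types N X Y : set V.
Local Open Scope classical_set_scope.

Lemma submoduleP N : submodule N <->
  N 0 /\ forall a x y, N x -> N y -> N (a *: x + y).
Proof.
split=> [[N0 Nl]|[N0 Nl]].
  split; first by rewrite -in_setE.
  by move=> a x y hx hy; rewrite -in_setE; apply: Nl; rewrite in_setE.
split; first exact: mem_set.
by move=> a x y /set_mem hx /set_mem hy; apply/mem_set/Nl.
Qed.

Section Submodule.
Variables (N : set V) (sN : submodule N).
Lemma sub_0 : N 0. Proof. by case/submoduleP: sN. Qed.
Lemma sub_lin a x y : N x -> N y -> N (a *: x + y).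
Proof. by case/submoduleP: sN => _; apply. Qed.
Lemma sub_Z a x : N x -> N (a *: x).
Proof. by move=> hx; rewrite -[_ *: _]addr0; apply: sub_lin sub_0. Qed.
Lemma sub_D x y : N x -> N y -> N (x + y).
Proof. by move=> hx hy; rewrite -[x]scale1r; apply: sub_lin. Qed.
Lemma sub_N x : N x -> N (- x).
Proof. by move=> hx; rewrite -scaleN1r; apply: sub_Z. Qed.
Lemma sub_B x y : N x -> N y -> N (x - y).
Proof. by move=> hx hy; apply/sub_D/sub_N. Qed.
Lemma sub_sum I (r : seq I) (P : pred I) (F : I -> V) :
  (forall i, P i -> N (F i)) -> N (\sum_(i <- r | P i) F i).
Proof. by move=> h; elim/big_rec: _ => [|i x /h]; [apply: sub_0 | apply: sub_D]. Qed.
End Submodule.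

Definition addset X Y : set V := [set z | exists x y, [/\ X x, Y y & z = x + y]].

Lemma submodule_add X Y : submodule X -> submodule Y -> submodule (addset X Y).
Proof.
move=> sX sY; apply/submoduleP; split.
  by exists 0, 0; rewrite addr0; split=> //; apply: sub_0.
move=> a _ _ [x [y [hx hy ->]]] [x' [y' [hx' hy' ->]]].
exists (a *: x + x'), (a *: y + y'); split; [exact: sub_lin|exact: sub_lin|].
by rewrite scalerDr addrACA.
Qed.

Lemma submodule_setI X Y : submodule X -> submodule Y -> submodule (X `&` Y).
Proof.
move=> sX sY; apply/submoduleP; split; first by split; apply: sub_0.
by move=> a x y [? ?] [? ?]; split; apply: sub_lin.
Qed.

Lemma submodule_setT : submodule [set: V].
Proof. by apply/submoduleP. Qed.

Lemma addset_l X Y : submodule Y -> X `<=` addset X Y.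
Proof. by move=> sY x hx; exists x, 0; rewrite addr0; split=> //; apply: sub_0. Qed.
Lemma addset_r X Y : submodule X -> Y `<=` addset X Y.
Proof. by move=> sX x hx; exists 0, x; rewrite add0r; split=> //; apply: sub_0. Qed.
Lemma addset_min X Y N : submodule N -> X `<=` N -> Y `<=` N -> addset X Y `<=` N.
Proof. by move=> sN h1 h2 _ [x [y [/h1 hx /h2 hy ->]]]; apply: sub_D. Qed.

(** Keeping the last term as an index lets chains be extended, concatenated and
  transported along linear maps by induction. *)
Inductive chain N : set V -> nat -> Prop :=
| chain0 X : submodule X -> N `<=` X -> chain N X 0
| chainS X Y l : chain N X l -> submodule Y -> X `<` Y -> chain N Y l.+1.

Definition lenle N N' l := forall k, chain N N' k -> (k <= l)%N.
Definition len N N' l := chain N N' l /\ lenle N N' l.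

Lemma chain_submodule N X l : chain N X l -> submodule X.
Proof. by case. Qed.

Lemma chain_sub N X l : chain N X l -> N `<=` X.
Proof. by elim=> // {}X Y k _ h _ [XY _]; apply: subset_trans XY. Qed.

Lemma chain_top N X Y l : submodule Y -> X `<=` Y -> chain N X l -> chain N Y l.
Proof.
move=> sY XY h; case: h XY => [X' sX' NX' XY|X0 X' k h sX' [h1 h2] XY].
  by apply: chain0 => //; apply: subset_trans XY.
apply: chainS h sY _; split; first exact: subset_trans XY.
by move=> h; apply: h2; apply: subset_trans h.
Qed.

Lemma chain_bot N N' X l : N `<=` N' -> chain N' X l -> chain N X l.
Proof.
move=> h; elim=> [Y sY hY|Y Z k _ IH sZ YZ]; last exact: chainS IH sZ YZ.
by apply: chain0 => //; apply: subset_trans hY.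
Qed.

Lemma chain_cat N N' X k l : chain N N' k -> chain N' X l -> chain N X (k + l).
Proof.
move=> h; elim=> [Y sY hY|Y Z m _ IH sZ YZ]; first by rewrite addn0; apply: chain_top h.
by rewrite addnS; apply: chainS IH sZ YZ.
Qed.

Lemma lenle_mono N N1 X k l : N `<=` N1 -> (k <= l)%N -> lenle N X k -> lenle N1 X l.
Proof. by move=> h kl hk m /(chain_bot h) /hk hm; apply: leq_trans kl. Qed.

(** By the modular law a strict inclusion of submodules stays strict after
  intersecting with [N'] or after adding [N']. *)
Lemma lenle_add N N' X a b : submodule N' -> submodule X -> N `<=` N' -> N' `<=` X ->
  lenle N N' a -> lenle N' X b -> lenle N X (a + b).
Proof.
move=> sN' sX NN' NX ha hb l hl.
suff [k [m [kml ck cm]]] : exists k m, [/\ (l <= k + m)%N,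
    chain N (X `&` N') k & chain N' (addset X N') m].
  apply: (leq_trans kml); apply: leq_add.
    by apply: ha; apply: chain_top ck => // x [].
  by apply: hb; apply: chain_top cm => //; apply: addset_min.
move: hl => {NX hb}; elim=> {X l sX} [X sX NX|X Y l hl [k [m [klm ck cm]]] sY [XY YX]].
  exists 0%N, 0%N; split=> //; apply: chain0.
  - exact: submodule_setI.
  - by move=> x hx; split; [apply: NX|apply: NN'].
  - exact: submodule_add.
  - exact: addset_r.
have sX := chain_submodule hl.
have XY1 : X `&` N' `<=` Y `&` N' by move=> x [/XY].
have XY2 : addset X N' `<=` addset Y N'.
  by move=> _ [x [y [/XY hx hy ->]]]; exists x, y.
case: (pselect (Y `&` N' `<=` X `&` N')) => h1; last first.
  exists k.+1, m; split; first by rewrite ltnS.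
    by apply: chainS ck _ _ => //; apply: submodule_setI.
  by apply: chain_top cm => //; apply: submodule_add.
exists k, m.+1; split; first by rewrite addnS ltnS.
  by apply: chain_top ck => //; apply: submodule_setI.
apply: chainS cm _ _; first exact: submodule_add.
split=> // h2; apply: YX => y hy.
have [x [z [hx hz e]]] := h2 y (addset_l sN' hy).
have [] : (X `&` N') z; last by move=> Xz _; rewrite e; apply: sub_D.
apply: h1; split=> //; rewrite (_ : z = y - x); last by rewrite e addrAC subrr add0r.
by apply: sub_B => //; apply: XY.
Qed.

Lemma len_add N N' X a b : submodule N' -> submodule X -> N `<=` N' -> N' `<=` X ->
  len N N' a -> len N' X b -> len N X (a + b).
Proof.
move=> sN' sX h1 h2 [ca la] [cb lb]; split; first exact: chain_cat ca cb.
exact: lenle_add la lb.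
Qed.

Lemma len_uniq N X a b : len N X a -> len N X b -> a = b.
Proof.
move=> [ca la] [cb lb]; apply/eqP; rewrite eqn_leq.
by rewrite (la _ cb) (lb _ ca).
Qed.

Lemma len_refl N : submodule N -> len N N 0.
Proof.
move=> sN; split; first exact: chain0.
move=> [|k] // h; inversion h as [|X Y l h0 sY [XY YX] e1 e2].
by case: YX; apply: chain_sub h0.
Qed.

Lemma length_quotE N l : length_quot N l <-> len N setT l.
Proof.
have key k : (exists c : nat -> set V,
    (forall i, (i <= k)%N -> submodule (c i) /\ N `<=` c i) /\
    (forall i, (i < k)%N -> c i `<` c i.+1)) <-> chain N setT k.
  split=> [[c [h1 h2]]|].
    apply: (@chain_top _ (c k)) => //; first exact: submodule_setT.
    elim: k h1 h2 => [|k IH] h1 h2.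
      by have [sc Nc] := h1 0%N isT; apply: chain0.
    apply: chainS (h2 k _) => //; last by have [] := h1 k.+1 (leqnn _).
    apply: IH => i hi; first by apply: h1; apply: leqW.
    by apply: h2; apply: leqW.
  move: setT => T hT; have [c [h1 h2 _]] : exists c : nat -> set V,
      [/\ forall i, (i <= k)%N -> submodule (c i) /\ N `<=` c i,
          forall i, (i < k)%N -> c i `<` c i.+1 & c k = T].
    elim: hT => [X sX NX|X Y m hX [c [h1 h2 e]] sY XY].
      by exists (fun=> X).
    exists (fun i => if (i <= m)%N then c i else Y); split=> [i|i|].
    - move=> him; have [->|hi] : i = m.+1 \/ (i <= m)%N.
        by move: him; rewrite leq_eqVlt => /orP [/eqP|]; [left|right].
      + rewrite ltnn; split=> //; apply: (subset_trans (chain_sub hX)).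
        by case: XY.
      + by rewrite hi; apply: h1.
    - move=> him; have [->|hi] : i = m \/ (i < m)%N.
        by move: him; rewrite ltnS leq_eqVlt => /orP [/eqP|]; [left|right].
      + by rewrite leqnn ltnn e.
      + by rewrite hi (ltnW hi); apply: h2.
    - by rewrite ltnn.
  by exists c.
split=> [[/key h1 h2]|[/key h1 h2]]; split=> //.
  by move=> k /key /h2.
by move=> k /key /h2.
Qed.

End Chains.

Section Correspondence.
Variables (R : comNzRingType) (U V : lmodType R) (f : {linear U -> V}).
Local Open Scope classical_set_scope.

Lemma submodule_preimage N : submodule N -> submodule (f @^-1` N).
Proof.
move=> sN; apply/submoduleP; split; first by rewrite /preimage /= linear0; apply: sub_0.
by move=> a x y hx hy; rewrite /preimage /= linearP; apply: sub_lin.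
Qed.

Lemma submodule_image X : submodule X -> submodule (f @` X).
Proof.
move=> sX; apply/submoduleP; split.
  by exists 0; [exact: sub_0 | rewrite linear0].
move=> a _ _ [x hx <-] [y hy <-]; exists (a *: x + y); last by rewrite linearP.
exact: sub_lin.
Qed.

Lemma submodule_range : submodule (range f).
Proof. exact: submodule_image (@submodule_setT _ _). Qed.

Lemma chain_preimage N X l : submodule N -> X `<=` addset N (range f) ->
  chain N X l -> chain (f @^-1` N) (f @^-1` X) l.
Proof.
move=> sN hX h; elim: h hX => [Y sY NY _|Y Z m hY IH sZ [YZ ZY] ZN].
  apply: chain0; first exact: submodule_preimage.
  by move=> x; apply: NY.
have h0 := IH (subset_trans YZ ZN).
apply: chainS h0 (submodule_preimage sZ) _; split; first by move=> x; apply: YZ.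
move=> h; apply: ZY => z hz; have [a [_ [ha [u _ <-] e]]] := ZN z hz.
have hYa : Y a := chain_sub hY ha.
rewrite e; apply: (sub_D (chain_submodule hY)) => //; apply: h.
rewrite /preimage /= (_ : f u = z - a); last by rewrite e addrAC subrr add0r.
by apply: (sub_B sZ) => //; apply: YZ.
Qed.

Lemma chain_image N X l : submodule N -> chain (f @^-1` N) X l ->
  chain N (addset N (f @` X)) l.
Proof.
move=> sN; elim=> [Y sY NY|Y Z m hY IH sZ [YZ ZY]].
  apply: chain0; first exact/submodule_add/submodule_image.
  exact/addset_l/submodule_image.
have sY := chain_submodule hY.
apply: chainS IH _ _; first exact/submodule_add/submodule_image.
split; first by move=> _ [a [_ [ha [y hy <-] ->]]]; exists a, (f y); split=> //; exists y => //; apply: YZ.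
move=> h; apply: ZY => z hz.
have [|a [_ [ha [y hy <-] e]]] := h (f z).
  by apply: (addset_r sN); exists z.
rewrite -[z](subrK y); apply: (sub_D sY) => //; apply: (chain_sub hY).
by rewrite /preimage /= linearB e addrK.
Qed.

(** [f] induces an isomorphism from [U / f^-1 N] onto [(N + f U) / N]. *)
Lemma len_preimage N l : submodule N ->
  len N (addset N (range f)) l <-> len (f @^-1` N) setT l.
Proof.
move=> sN.
have eT : f @^-1` (addset N (range f)) = setT.
  by apply/seteqP; split=> // x _; apply: (addset_r sN); exists x.
have h1 k : chain N (addset N (range f)) k -> chain (f @^-1` N) setT k.
  by move=> hk; have := chain_preimage sN (@subset_refl _ _) hk; rewrite eT.
have h2 k := @chain_image N setT k sN.
split=> [[c b]|[c b]]; split.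
- exact: h1.
- by move=> k /h2 /b.
- exact: h2.
- by move=> k /h1 /b.
Qed.

Lemma lenle_preimage N l : submodule N ->
  lenle (f @^-1` N) setT l -> lenle N (addset N (range f)) l.
Proof.
move=> sN h k hk; apply: h; have := chain_preimage sN (@subset_refl _ _) hk.
rewrite (_ : f @^-1` (addset N (range f)) = setT) //.
by apply/seteqP; split=> // x _; apply: (addset_r sN); exists x.
Qed.

End Correspondence.

Section Coordinates.
Variables (R : comNzRingType) (V : lmodType R) (K : fieldType) (ev : R -> K).
Variables (I : eqType) (lam : I -> V -> K) (e : I -> V) (N : set V).
Hypothesis ev_surj : forall c, exists a, ev a = c.
Hypothesis sN : submodule N.
Hypothesis lam_lin : forall i a x y, N x -> N y ->
  lam i (a *: x + y) = ev a * lam i x + lam i y.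
Local Open Scope classical_set_scope.

Definition coord0 (s : seq I) : set V :=
  [set x | N x /\ forall i, i \in s -> lam i x = 0].

Lemma submodule_coord0 s : submodule (coord0 s).
Proof.
have l0 i : lam i 0 = 0.
  have [b hb] := ev_surj 1.
  have := @lam_lin i b 0 0 (sub_0 sN) (sub_0 sN); rewrite hb mul1r scaler0 add0r => /eqP.
  by rewrite addrC -subr_eq subrr eq_sym => /eqP.
apply/submoduleP; split; first by split=> //; exact: sub_0.
move=> a x y [hx h0] [hy h1]; split; first exact: sub_lin.
by move=> i hi; rewrite lam_lin // h0 // h1 // mulr0 addr0.
Qed.

(** Imposing one more coordinate condition gives a submodule of colength one,
  because the scalars act through the residue field. *)
Lemma len_coord0 s : uniq s -> (forall i, i \in s -> N (e i)) ->
  (forall i j, i \in s -> j \in s -> lam i (e j) = (i == j)%:R) ->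
  len (coord0 s) N (size s).
Proof.
elim: s => [_ _ _|i s IH /andP [nis us] hN he].
  by rewrite (_ : coord0 [::] = N); [exact: len_refl | apply/seteqP; split=> [x []|]].
have {}IH : len (coord0 s) N (size s).
  apply: IH => // [j hj|j k hj hk]; first by apply: hN; rewrite inE hj orbT.
  by apply: he; rewrite inE ?hj ?hk orbT.
have sub : coord0 (i :: s) `<=` coord0 s.
  by move=> x [hx h]; split=> // j hj; apply: h; rewrite inE hj orbT.
rewrite /= -add1n; apply: (len_add _ _ sub _ _ IH); [exact: submodule_coord0|exact: sN|by move=> x []|].
have ii : i \in i :: s by rewrite inE eqxx.
split.
  apply: chainS (chain0 (@submodule_coord0 (i :: s)) (fun x h => h)) (submodule_coord0 s) _.
  split; first exact: sub.
  move=> /(_ (e i)) [].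
    split; first exact: hN.
    move=> j hj; rewrite he // ?inE ?hj ?orbT //; case: eqP => // ji.
    by rewrite -ji hj in nis.
  by move=> _ /(_ i ii) /eqP; rewrite he // eqxx oner_eq0.
have big X k : chain (coord0 (i :: s)) X k.+1 -> X `<=` coord0 s -> coord0 s `<=` X.
  move=> h Xs; have sX := chain_submodule h.
  have NX := chain_sub h.
  have [x [hx lx]] : exists x, X x /\ lam i x <> 0.
    apply: contrapT => hn; inversion h as [|X0 Y l h0 sY [_ nXX] e1 e2]; apply: nXX.
    apply: (subset_trans _ (chain_sub h0)) => x hx.
    have [Nx hs] := Xs _ hx; split=> // j; rewrite inE => /orP [/eqP ->|/hs //].
    by apply: contrapT => lx; apply: hn; exists x.
  move=> y [Ny hy]; have [a ha] := ev_surj (- (lam i y / lam i x)).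
  have [Nx hsx] := Xs _ hx.
  have h1 : X (a *: x + y).
    apply: NX; split=> [|j]; first exact: sub_lin.
    rewrite lam_lin // inE => /orP [/eqP ->|hj]; last by rewrite hsx // hy // mulr0 addr0.
    by rewrite ha mulNr divfK ?addNr //; apply/eqP.
  rewrite (_ : y = (a *: x + y) - a *: x); last by rewrite addrC addKr.
  by apply: (sub_B sX) => //; apply: sub_Z.
move=> [|[|k]] // h; inversion h as [|X0 Y l h0 sY [XX nXX] e1 e2]; case: nXX.
exact: big h0 XX.
Qed.

End Coordinates.

Section SeriesLength.
Variables (n : nat) (K : fieldType).
Local Notation A := {mseries K[n]}.

(** Counts the monomials of degree less than [k] in [n] variables; without variables
  the binomial formula would count 1 as a monomial of degree less than 0. *)
Definition nmon_lt (k : nat) : nat := if n is m.+1 then 'C(k + m, n) else (0 < k)%N.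

Lemma nmon_ltS t : nmon_lt t.+1 = 'C(t + n, n).
Proof. by rewrite /nmon_lt; case: n => [|m]; rewrite ?bin0 // addSnnS. Qed.

Lemma monomials k : exists s : seq 'X_{1..n},
  [/\ uniq s, forall m, (m \in s) = (mdeg m == k) &
      (nmon_lt k + size s)%N = nmon_lt k.+1].
Proof.
rewrite /nmon_lt; case: n => [|m].
  case: k => [|k]; [exists [:: 0%MM] | exists [::]]; split=> // x.
    rewrite inE (_ : x = 0%MM) ?eqxx ?mdeg0 //.
    by apply/mnmP => -[].
  rewrite (_ : x = 0%MM) ?mdeg0 //.
  by apply/mnmP => -[].
exists [seq s2m t | t : k.-tuple 'I_m.+1 <- enum (basis m.+1 k)]; split.
- exact: uniq_basis.
- by move=> x; rewrite -basis_cover.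
- by rewrite size_basis addSn binS -[in RHS](bin_sub (leq_addl k m)) addnK.
Qed.

Lemma mord_submodule s a b : submodule (@mord n K s a b).
Proof.
apply/submoduleP; split; first exact: mord0.
by move=> c x y hx hy; apply: mordD => //; apply: (@mordZ _ _ 0).
Qed.

(** The coefficients in degree [k] are coordinates on [m^k A^b / m^(k+1) A^b]. *)
Lemma len_mord b k : len (@mord n K k b 1) setT (b * nmon_lt k).
Proof.
elim: k => [|k IH].
  have -> : @mord n K 0 b 1 = setT by apply/predeqP.
  have -> : (b * nmon_lt 0 = 0)%N.
    by rewrite /nmon_lt; case: n => [|m]; rewrite ?bin_small // ?muln0.
  exact/len_refl/submodule_setT.
have [s [us ms e]] := monomials k.
rewrite -e mulnDr addnC; apply: len_add IH.
- exact: mord_submodule.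
- exact: submodule_setT.
- by move=> x; apply: mord_le.
- by [].
pose t := [seq (m, j) | m <- s, j <- enum 'I_b].
pose lam (i : 'X_{1..n} * 'I_b) (x : 'cV[A]_b) : K :=
  if mdeg i.1 == k then scoef (x i.2 0) i.1 else 0.
pose ee (i : 'X_{1..n} * 'I_b) : 'cV[A]_b := ms_of_mpoly 'X_[i.1] *: delta_mx i.2 0.
have tP i : (i \in t) = (mdeg i.1 == k).
  apply/allpairsP/idP => [[[m j] [hm _ ->]]|hi]; first by rewrite -ms.
  by exists i; rewrite ms hi mem_enum; case: i {hi}.
have -> : (b * size s = size t)%N by rewrite size_allpairs size_enum_ord mulnC.
have <- : coord0 lam (@mord n K k b 1) t = @mord n K k.+1 b 1.
  apply/predeqP => x; split=> [[hx h] i j m|h].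
    rewrite ltnS leq_eqVlt => /orP [hm|]; last exact: hx.
    by have := h (m, i); rewrite tP /lam /= hm (ord1 j); apply.
  split=> [|i]; first exact: mord_le h.
  by rewrite tP /lam => hi; rewrite hi; apply: h; rewrite (eqP hi).
apply: (@len_coord0 _ _ K (@sconst n K) _ lam ee).
- by move=> c; exists (ms_of_mpoly c%:MP); rewrite sconstC.
- exact: mord_submodule.
- move=> i a x y hx hy; rewrite /lam; case: eqP => [hi|_]; last by rewrite mulr0 addr0.
  rewrite !mxE scoefD; congr (_ + _).
  have := ms_homogM (@ord_any n K a) (hx i.2 0).
  move/(congr1 (mcoeff i.1)).
  have -> : ms_homog 0 a = (sconst a)%:MP.
    apply/mpolyP => m; rewrite mcoeff_ms_homog mcoeffC mdeg_eq0.
    by case: eqP => [->|_]; rewrite ?mulr1 ?mulr0.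
  by rewrite mcoeffCM !mcoeff_ms_homog add0n hi eqxx.
- by rewrite allpairs_uniq ?enum_uniq // => -[m j] [m' j'] _ _.
- move=> i; rewrite tP => /eqP hi j l; rewrite mxE mulrC; apply: ordMl.
  by apply: ord_poly; rewrite dhomogX; apply/eqP.
- move=> i j; rewrite !tP => /eqP hi /eqP hj; rewrite /lam. rewrite hi eqxx mxE.
  rewrite mxE eqxx andbT.
  have -> : (i == j) = (i.1 == j.1) && (i.2 == j.2).
    by case: (i) (j) => [i1 i2] [j1 j2]; rewrite xpair_eqE.
  case: (i.2 == j.2); last by rewrite mulr0 andbF.
  by rewrite mulr1 andbT scoef_poly mcoeffX eq_sym.
Qed.
End SeriesLength.

(** * Minimal free resolutions and projective dimension *)

Lemma ord_empty b (i : 'I_b) : b <> 0%N.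
Proof. by move=> b0; case: i => i; rewrite b0. Qed.

Section Lifting.
Variable R : comNzRingType.

Lemma linear_col b (V : lmodType R) (f : {linear 'cV[R]_b -> V}) x :
  f x = \sum_j x j 0 *: f (delta_mx j 0).
Proof.
rewrite {1}[x]col_sum_delta linear_sum; apply: eq_bigr => j _; exact: linearZ.
Qed.

Lemma comb_linear b (V : lmodType R) (z : 'I_b -> V) :
  linear (fun x : 'cV[R]_b => \sum_j x j 0 *: z j).
Proof.
move=> a x y; rewrite scaler_sumr -big_split /=; apply: eq_bigr => j _.
by rewrite !mxE scalerDl scalerA.
Qed.

Definition comb b (V : lmodType R) (z : 'I_b -> V) : {linear 'cV[R]_b -> V} :=
  lin_fun (comb_linear z).

Lemma combE b (V : lmodType R) (z : 'I_b -> V) x : comb z x = \sum_j x j 0 *: z j.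
Proof. by []. Qed.

Lemma lift_free b (X Y : lmodType R) (f : {linear 'cV[R]_b -> Y})
    (d : {linear X -> Y}) : (forall x, exists z, f x = d z) ->
  exists g : {linear 'cV[R]_b -> X}, forall x, d (g x) = f x.
Proof.
move=> h; have /choice [z hz] := fun j => h (delta_mx j 0).
exists (comb z) => x; rewrite combE linear_sum linear_col; apply: eq_bigr => j _.
by rewrite linearZ hz.
Qed.

Lemma ker_submod (X Y : lmodType R) (d : {linear X -> Y}) :
  GRing.submod_closed [pred x | d x == 0].
Proof.
split=> [|a x y]; rewrite !inE ?linear0 // => /eqP hx /eqP hy.
by rewrite linearP hx hy scaler0 addr0.
Qed.

(** The definition of projectivity only lifts along surjections; lifting along [d]
  when [f] lands in the image of [d] is lifting along [X -> X / ker d]. *)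
Lemma lift_projective (P X Y : lmodType R) (f : {linear P -> Y})
    (d : {linear X -> Y}) : projective P -> (forall x, exists z, f x = d z) ->
  exists g : {linear P -> X}, forall x, d (g x) = f x.
Proof.
move=> pP /choice [z hz]; pose pr := qproj (ker_submod d).
have pr_eq x y : pr x = pr y <-> d x = d y.
  rewrite /pr qproj_eq inE linearB subr_eq0; by split=> /eqP.
have lpr : linear pr by move=> a x y; rewrite /pr qprojD qprojZ.
have lz : linear (fun x => pr (z x)).
  by move=> a x y; rewrite -lpr; apply/pr_eq; rewrite linearP -!hz linearP.
have [|h hh] := pP _ _ (lin_fun lpr) (lin_fun lz).
  by move=> w; exists (repr w); apply: qproj_repr.
by exists h => x; rewrite hz; apply/pr_eq; apply: hh.
Qed.

Lemma projective_col b : projective 'cV[R]_b.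
Proof.
move=> U W f g fs; apply: lift_free => x; have [u hu] := fs (g x).
by exists u.
Qed.

End Lifting.

Section Homotopy.
Variables (R : comNzRingType) (V : lmodType R) (b : nat -> nat).
Variables (D : forall i, 'M[R]_(b i, b i.+1)) (e : {linear 'cV[R]_(b 0%N) -> V}).
Variables (P : nat -> lmodType R) (d : forall i, {linear P i.+1 -> P i}).
Variable eP : {linear P 0%N -> V}.
Hypothesis res : free_resolution D e.
Hypothesis pP : forall i, projective (P i).
Hypothesis ePs : forall y, exists x, eP x = y.
Hypothesis eP0 : forall x, eP x = 0 <-> exists z, x = d 0%N z.
Hypothesis dP : forall i x, d i x = 0 <-> exists z, x = d i.+1 z.

Let dD i : {linear 'cV[R]_(b i.+1) -> 'cV[R]_(b i)} := mulmx (D i).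

(** Comparison maps in both directions, in one degree, and a map [h] to the next
  degree which on boundaries makes the composite homotopic to the identity.
  Nothing is required in lower degrees, so plain induction produces it. *)
Definition homotopy_at i :=
  exists (f : {linear 'cV[R]_(b i) -> P i}) (g : {linear P i -> 'cV[R]_(b i)})
         (h : {linear 'cV[R]_(b i) -> 'cV[R]_(b i.+1)}),
  [/\ forall z, exists w, f (D i *m z) = d i w,
      forall w, exists z, g (d i w) = D i *m z
    & forall x, g (f (D i *m x)) = D i *m x + D i *m h (D i *m x)].

Lemma homotopy0 : homotopy_at 0.
Proof.
have [es e0 De] := res.
have [f hf] : exists f : {linear 'cV_(b 0) -> P 0%N}, forall x, eP (f x) = e x.
  by apply: lift_free => x; have [z <-] := ePs (e x); exists z.
have [g hg] : exists g : {linear P 0%N -> 'cV_(b 0)}, forall x, e (g x) = eP x.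
  by apply: lift_projective => // x; have [z <-] := es (eP x); exists z.
have lu : linear (fun x => g (f x) - x).
  by move=> a x y; rewrite !linearP scalerDr addrACA.
have [h hh] : exists h : {linear 'cV_(b 0) -> 'cV_(b 1)},
    forall x, dD 0 (h x) = lin_fun lu x.
  apply: lift_free => x; have [z hz] : exists z, lin_fun lu x = D 0%N *m z.
    by apply/e0; rewrite /lin_fun linearB hg hf subrr.
  by exists z; apply: hz.
exists f, g, h; split=> [z|w|x].
- by apply/eP0; rewrite hf; apply/e0; exists z.
- by apply/e0; rewrite hg; apply/eP0; exists w.
- by have := hh (D 0%N *m x); rewrite /lin_fun /dD => ->; rewrite addrC subrK.
Qed.

Lemma homotopyS i : homotopy_at i ->
  exists (f : {linear 'cV[R]_(b i.+1) -> P i.+1})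
         (g : {linear P i.+1 -> 'cV[R]_(b i.+1)})
         (h : {linear 'cV[R]_(b i) -> 'cV[R]_(b i.+1)})
         (h' : {linear 'cV[R]_(b i.+1) -> 'cV[R]_(b i.+2)}),
  [/\ forall z, exists w, f (D i.+1 *m z) = d i.+1 w,
      forall w, exists z, g (d i.+1 w) = D i.+1 *m z
    & forall x, g (f x) = x + h (D i *m x) + D i.+1 *m h' x].
Proof.
have [es e0 De] := res.
have DD j (z : 'cV_(b j.+2)) : D j *m (D j.+1 *m z) = 0 by apply: (De j _).2; exists z.
have dd j z : d j (d j.+1 z) = 0 by apply: (dP _).2; exists z.
move=> [f [g [h [hf hg hh]]]].
have [f' hf'] : exists f' : {linear 'cV_(b i.+1) -> P i.+1},
    forall x, d i (f' x) = (f \o dD i) x.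
  by apply: lift_free => x; have [w hw] := hf x; exists w.
have [g' hg'] : exists g' : {linear P i.+1 -> 'cV_(b i.+1)},
    forall x, dD i (g' x) = (g \o d i) x.
  by apply: lift_projective => // x; have [w hw] := hg x; exists w.
have lu : linear (fun x => g' (f' x) - x - h (D i *m x)).
  move=> a x y; rewrite mulmxDr -scalemxAr !linearP !scalerDr.
  by rewrite /= [X in X + _ = _]addrACA [LHS]addrACA.
have [h' hh'] : exists h' : {linear 'cV_(b i.+1) -> 'cV_(b i.+2)},
    forall x, dD i.+1 (h' x) = lin_fun lu x.
  apply: lift_free => x; have [z hz] : exists z, lin_fun lu x = D i.+1 *m z.
    apply/De; rewrite /lin_fun !mulmxBr.
    have := hg' (f' x); rewrite /dD /= => ->; rewrite hf' /= hh.
    by rewrite -addrA -opprD subrr.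
  by exists z; apply: hz.
exists f', g', h, h'; split=> [z|w|x].
- by apply/dP; rewrite hf' /= DD linear0.
- by apply/De; have := hg' (d i.+1 w); rewrite /dD /= => ->; rewrite dd linear0.
- have := hh' x; rewrite /dD /lin_fun => ->.
  by rewrite -[g' (f' x) - x - _]addrA -opprD [RHS]addrC subrK.
Qed.

Lemma homotopy_ex i : homotopy_at i.
Proof.
elim: i => [|i /homotopyS [f [g [h [h' [hf hg hh]]]]]]; first exact: homotopy0.
exists f, g, h'; split=> // x; rewrite hh.
have [_ _ De] := res.
have -> : D i *m (D i.+1 *m x) = 0 by apply/De; exists x.
by rewrite linear0 addr0.
Qed.

(** In a degree where the projective resolution vanishes, the homotopy writes the
  identity as [h D + D h'], which is zero over the residue ring. *)
Lemma minimal_resolution_vanish (S : nzRingType) (ev : {rmorphism R -> S}) q :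
  (forall i (x : P i), (q < i)%N -> x = 0) ->
  (forall i k l, ev (D i k l) = 0) ->
  forall i, (q < i)%N -> b i = 0%N.
Proof.
move=> P0 D0 [//|i] qi.
have [f [g [h [h' [_ _ hh]]]]] := homotopyS (homotopy_ex i).
case: (posnP (b i.+1)) => // bi; exfalso.
pose k : 'I_(b i.+1) := Ordinal bi.
pose x : 'cV[R]_(b i.+1) := delta_mx k 0.
have := hh x; rewrite [f x]P0 // linear0 => /colP /(_ k) /(congr1 ev).
rewrite !mxE eqxx /= rmorph0 !rmorphD rmorph1 linear_col summxE !rmorph_sum.
rewrite !big1 => [|j _|j _]; first by rewrite !addr0 => /esym/eqP; rewrite oner_eq0.
- by rewrite rmorphM D0 mul0r.
- rewrite !mxE rmorphM rmorph_sum big1 ?mul0r // => l _.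
  by rewrite rmorphM D0 mul0r.
Qed.

End Homotopy.

Lemma free_has_projective_resolution (R : comNzRingType) (V : lmodType R)
    (b : nat -> nat) (D : forall i, 'M[R]_(b i, b i.+1))
    (e : {linear 'cV[R]_(b 0%N) -> V}) q :
  free_resolution D e -> (forall i, (q < i)%N -> b i = 0%N) ->
  has_projective_resolution V q.
Proof.
move=> [es e0 De] b0.
exists (fun i => 'cV[R]_(b i)), (fun i => mulmx (D i)), e; split=> //.
- by move=> i; apply: projective_col.
- by move=> i x qi; apply/colP => k; case: (ord_empty k (b0 _ qi)).
Qed.

Lemma minimal_length (R : comNzRingType) (V : lmodType R)
    (b : nat -> nat) (D : forall i, 'M[R]_(b i, b i.+1))
    (e : {linear 'cV[R]_(b 0%N) -> V}) (S : nzRingType) (ev : {rmorphism R -> S}) q :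
  free_resolution D e -> (forall i k l, ev (D i k l) = 0) ->
  has_projective_resolution V q -> forall i, (q < i)%N -> b i = 0%N.
Proof.
move=> res D0 [P [d [eP [pP P0 ePs eP0 dP]]]].
exact: (minimal_resolution_vanish res pP ePs eP0 dP P0 D0).
Qed.

(** The differential into a term whose own differential is zero is onto, while its
  entries lie in a proper ideal. *)
Lemma minimal_vanish (R : comNzRingType) (V : lmodType R)
    (b : nat -> nat) (D : forall i, 'M[R]_(b i, b i.+1))
    (e : {linear 'cV[R]_(b 0%N) -> V}) (S : nzRingType) (ev : {rmorphism R -> S}) i :
  free_resolution D e -> (forall i k l, ev (D i k l) = 0) ->
  b i = 0%N -> forall j, (i <= j)%N -> b j = 0%N.
Proof.
move=> [_ _ De] D0 bi j /subnK <-; elim: (j - i)%N => // k IH.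
rewrite addSn; move: IH; move: (k + i)%N => l bl.
case: (posnP (b l.+1)) => // hl.
pose x : 'cV[R]_(b l.+1) := delta_mx (Ordinal hl) 0.
have /De [z] : D l *m x = 0.
  by apply/colP => s; case: (ord_empty s bl).
move=> /colP /(_ (Ordinal hl)) /(congr1 ev); rewrite !mxE !eqxx rmorph1 rmorph_sum.
rewrite big1 => [/eqP|s _]; first by rewrite oner_eq0.
by rewrite rmorphM D0 mul0r.
Qed.

(** A zero term would cut the resolution short, below the projective dimension; at
  index 0 it would make the module zero. *)
Lemma minimal_nonzero (R : comNzRingType) (V : lmodType R)
    (b : nat -> nat) (D : forall i, 'M[R]_(b i, b i.+1))
    (e : {linear 'cV[R]_(b 0%N) -> V}) (S : nzRingType) (ev : {rmorphism R -> S}) p :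
  free_resolution D e -> (forall i k l, ev (D i k l) = 0) ->
  projdim V p -> (exists x : V, x <> 0) -> forall i, (i <= p)%N -> (0 < b i)%N.
Proof.
move=> res D0 [_ pmin] [x x0] i ip; rewrite lt0n; apply/eqP => bi.
case: i ip bi => [_ b0|i ip bi].
  have [es _ _] := res; have [z e_z] := es x.
  apply: x0; rewrite -e_z (_ : z = 0) ?linear0 //.
  by apply/colP => s; case: (ord_empty s b0).
have : (p <= i)%N; last by rewrite leqNgt ip.
apply: pmin; apply: (free_has_projective_resolution res).
exact: (minimal_vanish res D0 bi).
Qed.

(** A shorter projective resolution would be homotopic to the minimal one, and so
  would make its last term vanish. *)
Lemma minimal_projdim (R : comNzRingType) (V : lmodType R)
    (b : nat -> nat) (D : forall i, 'M[R]_(b i, b i.+1))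
    (e : {linear 'cV[R]_(b 0%N) -> V}) (S : nzRingType) (ev : {rmorphism R -> S}) p :
  free_resolution D e -> (forall i k l, ev (D i k l) = 0) ->
  (0 < b p)%N -> (forall i, (p < i)%N -> b i = 0%N) -> projdim V p.
Proof.
move=> res D0 bp b0; split; first exact: free_has_projective_resolution res b0.
move=> q hq; rewrite leqNgt; apply/negP => qp.
by move: bp; rewrite (minimal_length res D0 hq qp).
Qed.

(** * Hilbert's syzygy theorem, and the bound on the depth *)

Section Syzygies.
Variables (n : nat) (K : fieldType).
Local Notation A := {mseries K[n]}.

(** The ideal generated by the variables of index less than [k]. *)
Definition idealX (k : nat) (f : A) :=
  forall m : 'X_{1..n}, (forall j : 'I_n, (j < k)%N -> m j = 0%N) -> scoef f m = 0.

Lemma idealXD k f g : idealX k f -> idealX k g -> idealX k (f + g).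
Proof. by move=> hf hg m hm; rewrite scoefD hf // hg // addr0. Qed.
Lemma idealXN k f : idealX k f -> idealX k (- f).
Proof. by move=> hf m hm; rewrite scoefN hf // oppr0. Qed.
Lemma idealX0 k : idealX k 0. Proof. by []. Qed.
Lemma idealX_sum k I (r : seq I) (P : pred I) (F : I -> A) :
  (forall i, P i -> idealX k (F i)) -> idealX k (\sum_(i <- r | P i) F i).
Proof. by move=> h m hm; rewrite scoef_sum big1 // => i /h ->. Qed.
Lemma idealXM k f g : idealX k g -> idealX k (f * g).
Proof.
move=> hg m hm; rewrite scoefM big1 // => l /eqP.
move: (val l.1) (val l.2) => a b e; rewrite (hg b) ?mulr0 // => j /hm.
by rewrite e mnmDE => /eqP; rewrite addn_eq0 => /andP [_ /eqP].
Qed.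
Lemma idealXS k f : idealX k f -> idealX k.+1 f.
Proof. by move=> hf m hm; apply: hf => j hj; apply: hm; apply: ltnW. Qed.

Lemma idealX_regular (k : 'I_n) f : idealX k (ms_of_mpoly 'X_k * f) -> idealX k f.
Proof.
move=> h m hm; have := h (m + U_(k))%MM; rewrite scoef_mulX mnmDE mnm1E eqxx addn1 /=.
rewrite addmK; apply=> j hj; rewrite mnmDE mnm1E hm //.
by case: eqP hj => // ->; rewrite ltnn.
Qed.

Lemma idealX_divX (k : 'I_n) f : idealX k.+1 f ->
  exists y, idealX k (f - ms_of_mpoly 'X_k * y).
Proof.
move=> h; exists (MSeries (fun m => scoef f (m + U_(k))%MM)) => m hm.
rewrite scoefB scoef_mulX /=; case: (posnP (m k)) => hk.
  rewrite subr0; apply: h => j; rewrite ltnS leq_eqVlt => /orP [/eqP e|]; last exact: hm.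
  by rewrite (_ : j = k) //; apply: val_inj.
rewrite submK ?subrr //; apply/mnm_lepP => j; rewrite mnm1E.
by case: eqP => // <-.
Qed.

Lemma idealX_X (k : 'I_n) f : idealX k.+1 (ms_of_mpoly 'X_k * f).
Proof. by move=> m hm; rewrite scoef_mulX hm. Qed.

Definition exact_seq (R : pzRingType) (b : nat -> nat)
    (D : forall i, 'M[R]_(b i, b i.+1)) :=
  forall i (x : 'cV_(b i.+1)), D i *m x = 0 <-> exists z, x = D i.+1 *m z.

Definition minimal_seq (b : nat -> nat) (D : forall i, 'M[A]_(b i, b i.+1)) :=
  forall i k l, sconst (D i k l) = 0.

Let vI k b (x : 'cV[A]_b) := forall i, idealX k (x i 0).

Let vID k b (x y : 'cV_b) : vI k x -> vI k y -> vI k (x + y).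
Proof. by move=> hx hy i; rewrite mxE; apply: idealXD. Qed.
Let vIM k a b (X : 'M_(a, b)) (y : 'cV_b) : vI k y -> vI k (X *m y).
Proof. by move=> hy i; rewrite mxE; apply: idealX_sum => j _; apply: idealXM. Qed.
Let vIN k b (x : 'cV_b) : vI k x -> vI k (- x).
Proof. by move=> hx i; rewrite mxE; apply: idealXN. Qed.
Let vIZ k b a (x : 'cV_b) : vI k x -> vI k (a *: x).
Proof. by move=> hx i; rewrite mxE; apply: idealXM. Qed.

Section Bound.
Variables (b : nat -> nat) (D : forall i, 'M[A]_(b i, b i.+1)).
Hypothesis De : exact_seq D.

(** Reducing modulo one more variable costs exactness in one more degree, because
  the variables form a regular sequence on the free modules. *)
Lemma exact_mod_variables k : (k <= n)%N -> forall i (x : 'cV[A]_(b i.+1)),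
  (k <= i)%N -> vI k (D i *m x) -> exists z w, x = D i.+1 *m z + w /\ vI k w.
Proof.
elim: k => [_ i x _ h|k IH kn [//|i] x ki h].
  have /De [z ->] : D i *m x = 0.
    by apply/colP => j; rewrite [RHS]mxE; apply: mseriesP => m; apply: h.
  by exists z, 0; rewrite addr0; split=> // j; rewrite mxE; apply: idealX0.
pose X : A := ms_of_mpoly 'X_(Ordinal kn).
have [y hy] : exists y : 'cV_(b i.+1), vI k (D i.+1 *m x - X *: y).
  have /choice [y hy] := fun j => idealX_divX (k := Ordinal kn) (h j).
  by exists (\col_j y j) => j; move: (hy j); rewrite !mxE.
have DD : D i *m (D i.+1 *m x) = 0 by apply: (De _).2; exists x.
have {DD} hy1 : vI k (D i *m y).
  move=> j; apply: (@idealX_regular (Ordinal kn)).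
  have := vIN (vIM (D i) hy); rewrite mulmxBr DD sub0r opprK -scalemxAr => /(_ j).
  by rewrite mxE.
have [z [v [ey hv]]] := IH (ltnW kn) i y ki hy1.
have hx : vI k (D i.+1 *m (x - X *: z)).
  rewrite mulmxBr -scalemxAr (_ : _ - _ = (D i.+1 *m x - X *: y) + X *: v).
    by apply: vID => //; apply: vIZ.
  by rewrite ey scalerDr opprD addrA addrNK.
have [z' [w [ex hw]]] := IH (ltnW kn) i.+1 _ (leqW ki) hx.
exists z', (w + X *: z); split; first by rewrite addrA -ex subrK.
move=> j; rewrite mxE; apply: idealXD; first by apply: idealXS.
by rewrite mxE; apply: (@idealX_X (Ordinal kn)).
Qed.

(** Modulo all the variables the differentials vanish, so exactness in a degree
  leaves no room for a nonzero module there. *)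
Lemma syzygy_bound : minimal_seq D -> forall j, (n < j)%N -> b j = 0%N.
Proof.
move=> Dm [//|i] ni; case: (posnP (b i.+1)) => // hb; exfalso.
pose k := Ordinal hb; pose x : 'cV[A]_(b i.+1) := delta_mx k 0.
have hx : vI n (D i *m x).
  move=> j m hm; have -> : m = 0%MM by apply/mnmP => l; rewrite hm // mnm0E.
  rewrite -/(sconst _) mxE rmorph_sum big1 // => l _.
  by rewrite rmorphM /= Dm mul0r.
have [z [w [ex hw]]] := exact_mod_variables (leqnn n) ni hx.
have := congr1 (fun y : 'cV[A]_(b i.+1) => sconst (y k 0)) ex.
rewrite /= !mxE !eqxx rmorphD rmorph_sum rmorph1 big1 => [|l _]; last first.
  by rewrite rmorphM /= Dm mul0r.
rewrite /=; have -> : sconst (w k 0) = 0 by apply: hw => j _; rewrite mnm0E.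
by rewrite addr0 => /eqP; rewrite oner_eq0.
Qed.

End Bound.

Section Cone.
Variables (b : nat -> nat) (D : forall i, 'M[A]_(b i, b i.+1)) (a : A).

Definition cone_rank (i : nat) : nat :=
  if i is j.+1 then (b j.+1 + b j)%N else b 0%N.

Definition cone (i : nat) : 'M[A]_(cone_rank i, cone_rank i.+1) :=
  match i with
  | 0%N => row_mx (D 0%N) a%:M
  | j.+1 => block_mx (D j.+1) a%:M 0 (- D j)
  end.

Lemma cone_minimal : minimal_seq D -> sconst a = 0 -> minimal_seq cone.
Proof.
move=> Dm a0.
have sc c (k l : 'I_c) : sconst ((a%:M : 'M_c) k l) = 0.
  by rewrite mxE; case: eqP => _; rewrite ?mulr1n ?mulr0n ?rmorph0.
move=> [|i] k l /=.
  by rewrite mxE; case: split => j; [apply: Dm | apply: sc].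
rewrite mxE; case: split => j; rewrite mxE; case: split => j'.
- exact: Dm.
- exact: sc.
- by rewrite mxE rmorph0.
- by rewrite mxE rmorphN /= Dm oppr0.
Qed.

(** The mapping cone of multiplication by [a]: it resolves the cokernel modulo [a]
  when [a] is regular on the cokernel of [D 0]. *)
Lemma cone_exact : exact_seq D ->
  (forall v : 'cV_(b 0%N), (exists z, a *: v = D 0%N *m z) -> exists z, v = D 0%N *m z) ->
  exact_seq cone.
Proof.
move=> De areg.
have DD j (z : 'cV_(b j.+2)) : D j *m (D j.+1 *m z) = 0.
  by apply: (De j _).2; exists z.
have key i (u : 'cV_(b i.+1)) (v : 'cV_(b i)) :
    D i *m u + a *: v = 0 -> (exists z, v = D i *m z) ->
    exists z, col_mx u v = block_mx (D i.+1) a%:M 0 (- D i) *m z.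
  move=> h [z ev]; have /De [w ew] : D i *m (u + a *: z) = 0.
    by rewrite mulmxDr -scalemxAr -ev.
  exists (col_mx w (- z)); rewrite mul_block_col mul_scalar_mx mul0mx add0r.
  by rewrite mulNmx mulmxN opprK -ev -ew scalerN addrK.
move=> [|i] x.
  rewrite -[x]vsubmxK /=; move: (usubmx _) (dsubmx _) => u v.
  rewrite mul_row_col mul_scalar_mx; split=> [h|[z ez]].
    apply: key => //; apply: areg; exists (- u).
    by rewrite mulmxN; apply/eqP; rewrite -addr_eq0 addrC h.
  move: ez; rewrite -[z]vsubmxK; move: (usubmx _) (dsubmx _) => z1 z2.
  rewrite mul_block_col mul_scalar_mx mul0mx add0r => /eq_col_mx [-> ->].
  by rewrite mulmxDr DD add0r -scalemxAr mulNmx scalerN subrr.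
rewrite -[x]vsubmxK /=; move: (usubmx _) (dsubmx _) => u v.
rewrite mul_block_col mul_scalar_mx mul0mx add0r.
split=> [h|[z ez]].
  have [h1 h2] : D i.+1 *m u + a *: v = 0 /\ - D i *m v = 0.
    by apply: eq_col_mx; rewrite h col_mx0.
  apply: key => //; apply/De.
  by apply/eqP; rewrite -oppr_eq0 -mulNmx h2.
move: ez; rewrite -[z]vsubmxK; move: (usubmx _) (dsubmx _) => z1 z2.
rewrite mul_block_col mul_scalar_mx mul0mx add0r => /eq_col_mx [-> ->].
rewrite mulmxDr DD add0r -scalemxAr !mulNmx scalerN subrr mulmxN DD oppr0 oppr0.
by rewrite col_mx0.
Qed.

End Cone.

End Syzygies.

Section RegularSequences.
Variables (R : comNzRingType) (V : lmodType R) (x : nat -> R).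

Lemma ideal_mul_submodule (I : set R) : submodule (ideal_mul I V).
Proof.
apply/submoduleP; split; first exact: span0.
by move=> a y z hy hz; apply: spanD => //; apply: spanZ.
Qed.

Lemma seq_mul0 y : seq_mul V x 0 y <-> y = 0.
Proof.
split=> [|->]; last exact: span0.
move=> [k [c [s [hs ->]]]]; rewrite big1 // => i _.
have [a [z [ha ->]]] := hs i.
suff -> : a = 0 by rewrite scale0r scaler0.
by have [l [d [t [ht ->]]]] := ha; rewrite big1 // => j _; have [[]] := ht j.
Qed.

Lemma seq_mulS r y : seq_mul V x r.+1 y <->
  exists y1 y2, seq_mul V x r y1 /\ y = y1 + x r *: y2.
Proof.
split.
  apply: (@span_min _ _ _ [set y | exists y1 y2, seq_mul V x r y1 /\ y = y1 + x r *: y2])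
    => [|u v [u1 [u2 [hu ->]]] [v1 [v2 [hv ->]]]|c u [u1 [u2 [hu ->]]]|] /=.
  - by exists 0, 0; rewrite scaler0 addr0; split=> //; apply: span0.
  - exists (u1 + v1), (u2 + v2); split; first exact: spanD.
    by rewrite scalerDr addrACA.
  - exists (c *: u1), (c *: u2); split; first exact: spanZ.
    by rewrite scalerDr !scalerA mulrC.
  move=> _ [a [z [ha ->]]]; move: ha.
  apply: (@span_min _ R^o _ [set a | exists y1 y2, seq_mul V x r y1 /\ a *: z = y1 + x r *: y2])
    => [|u v [u1 [u2 [hu eu]]] [v1 [v2 [hv ev]]]|c u [u1 [u2 [hu eu]]]|_ [j hj ->]] /=.
  - by exists 0, 0; rewrite scaler0 addr0 scale0r; split=> //; apply: span0.
  - exists (u1 + v1), (u2 + v2); split; first exact: spanD.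
    by rewrite scalerDl eu ev scalerDr addrACA.
  - exists (c *: u1), (c *: u2); split; first exact: spanZ.
    by rewrite -[(c *: u) *: z]scalerA eu scalerDr !scalerA mulrC.
  - move: hj; rewrite ltnS leq_eqVlt => /orP [/eqP ->|hj].
      by exists 0, z; rewrite add0r; split=> //; apply: span0.
    exists (x j *: z), 0; rewrite scaler0 addr0; split=> //.
    apply: span_sub; exists (x j), z; split=> //.
    by apply: (@span_sub _ R^o); exists j.
move=> [y1 [y2 [h ->]]]; apply: spanD.
  case: h => [k [c [s [hs ->]]]]; exists k, c, s; split=> // i.
  have [a [z [ha ->]]] := hs i; exists a, z; split=> //.
  case: ha => [l [d [t [ht ->]]]]; exists l, d, t; split=> // j.
  by have [w hw ->] := ht j; exists w => //; apply: ltnW.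
apply: span_sub; exists (x r), y2; split=> //.
by apply: (@span_sub _ R^o); exists r.
Qed.

End RegularSequences.

Section DepthBound.
Variables (n : nat) (K : fieldType) (M : lmodType {mseries K[n]}).
Local Notation A := {mseries K[n]}.
Variables (b : nat -> nat) (D : forall i, 'M[A]_(b i, b i.+1)).
Variable e : {linear 'cV[A]_(b 0%N) -> M}.
Hypothesis res : free_resolution D e.
Hypothesis Dm : minimal_seq D.

(** Iterating the mapping cone resolves the quotients of [M] by the initial segments
  of a regular sequence. *)
Lemma regular_resolution p x d : regular_seq M (@ms_max n K) x d -> (0 < b p)%N ->
  forall r, (r <= d)%N ->
  exists (b' : nat -> nat) (D' : forall i, 'M[A]_(b' i, b' i.+1))
         (e' : {linear 'cV[A]_(b' 0%N) -> M}),
  [/\ forall y, exists z, e' z = y,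
      forall v, seq_mul M x r (e' v) <-> exists z, v = D' 0%N *m z,
      exact_seq D', minimal_seq D' & (0 < b' (p + r))%N].
Proof.
move=> [xm xreg _] bp; elim=> [_|r IH rd].
  have [es e0 De] := res; exists b, D, e; split=> //; last by rewrite addn0.
  by move=> v; rewrite seq_mul0.
have [b' [D' [e' [es e0 De Dm' bp']]]] := IH (ltnW rd).
exists (cone_rank b'), (cone D' (x r)), e'; split.
- exact: es.
- move=> v; rewrite seq_mulS; split=> [[y1 [y2 [hy e1]]]|[z ->]].
    have [z2 ez2] := es y2.
    have /e0 [z1 ez1] : seq_mul M x r (e' (v - x r *: z2)).
      by rewrite linearB linearZ ez2 e1 addrK.
    exists (col_mx z1 z2) => /=.
    by rewrite mul_row_col mul_scalar_mx -ez1 subrK.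
  move: z => /= z; rewrite -[z]vsubmxK; move: (usubmx _) (dsubmx _) => z1 z2.
  exists (e' (D' 0%N *m z1)), (e' z2); split; first by apply/e0; exists z1.
  by rewrite mul_row_col mul_scalar_mx linearD linearZ.
- apply: cone_exact => // v [z ez]; apply/e0; apply: (xreg r rd).
  by rewrite -linearZ ez; apply/e0; exists z.
- apply: cone_minimal => //; apply/ord1_sconst; rewrite -ms_max_ord; exact: xm.
- rewrite addnS /=; exact: ltn_addl.
Qed.

(** The easy half of the Auslander-Buchsbaum formula: each element of a regular
  sequence lengthens the minimal resolution by one, up to at most [n]. *)
Lemma projdim_depth p d : depth (@ms_max n K) M d -> (0 < b p)%N -> (p + d <= n)%N.
Proof.
move=> [[x hx] _] bp.
have [b' [D' [e' [_ _ De Dm' bp']]]] := regular_resolution hx bp (leqnn d).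
rewrite leqNgt; apply/negP => h.
by move: bp'; rewrite (syzygy_bound De Dm' h).
Qed.

End DepthBound.

(** * Krull dimension and the growth of lengths *)

Section Primes.
Variable R : comNzRingType.
Local Open Scope classical_set_scope.
Implicit Types I P S : set R.

Lemma idealP I : @submodule _ R^o I <->
  I 0 /\ forall a u v, I u -> I v -> I (a * u + v).
Proof. exact: submoduleP. Qed.

Lemma prime_idealP P : prime_ideal P <->
  [/\ @submodule _ R^o P, ~ P 1 & forall u v, P (u * v) -> P u \/ P v].
Proof.
split.
  move=> [[P0 P1 Pl] Pp]; split.
  - by split=> // a u v hu hv; apply: Pl.
  - by move=> h; move/negP: P1; apply; apply: mem_set.
  - move=> u v huv; have /orP := Pp u v (mem_set huv).
    by case=> /set_mem; [left|right].
move=> [[P0 Pl] P1 Pp]; split; first split => //.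
  by apply/negP => /set_mem.
move=> u v /set_mem /Pp [h|h]; apply/orP; [left|right]; exact: mem_set.
Qed.

(** An ideal maximal among those that contain [I] and avoid [S] is prime: two
  elements outside it would give two elements of [S], whose product lies in it. *)
Lemma prime_avoiding I S : @submodule _ R^o I -> S 1 ->
  (forall u v, S u -> S v -> S (u * v)) -> (forall a, I a -> ~ S a) ->
  exists P, [/\ prime_ideal P, I `<=` P & forall a, P a -> ~ S a].
Proof.
move=> sI S1 SM IS.
pose good X := [/\ @submodule _ R^o X, I `<=` X & forall a, X a -> ~ S a].
(* The union of the empty chain is empty, so the empty set is allowed as well. *)
have [P [hP Pmax]] : exists P, (P = set0 \/ good P) /\
    forall B, P `<` B -> ~ (B = set0 \/ good B).
  apply: Zorn_bigcup => F FG Ftot.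
  case: (pselect (exists2 X, F X & X !=set0)) => [[X0 FX0 [x0 X0x]]|h]; last first.
    left; apply/seteqP; split=> // a [X FX Xa]; apply: h; exists X => //.
    by exists a.
  have hg X a : F X -> X a -> good X.
    by move=> /FG [->|].
  have [sX0 IX0 _] := hg _ _ FX0 X0x; right; split.
  - apply/idealP; split; first by exists X0 => //; apply: sub_0 sX0.
    move=> a u v [X FX Xu] [Y FY Yv].
    have [sX _ _] := hg _ _ FX Xu; have [sY _ _] := hg _ _ FY Yv.
    case: (Ftot _ _ FX FY) => h.
      by exists Y => //; apply: (sub_lin sY) => //; apply: h.
    by exists X => //; apply: (sub_lin sX) => //; apply: h.
  - by move=> a /IX0 ha; exists X0.
  - by move=> a [X FX Xa]; have [_ _] := hg _ _ FX Xa; apply.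
have I0 : I 0 by apply: (sub_0 sI).
have [sP IP PS] : good P.
  case: hP => // P0; have [] := Pmax I; last by right; split.
  by split; rewrite P0 // => /(_ _ I0).
exists P; split=> //; apply/prime_idealP; split=> //; first by move=> /PS.
move=> u v Puv; apply: contrapT => huv.
have key w : ~ P w -> exists p a, P p /\ S (p + a * w).
  move=> Pw; apply: contrapT => hn.
  pose Q : set R := @addset _ R^o P [set a * w | a in setT].
  have sW : @submodule _ R^o [set a * w | a in setT].
    apply/idealP; split; first by exists 0; rewrite ?mul0r.
    move=> a _ _ [b _ <-] [c _ <-]; exists (a * b + c) => //.
    by rewrite mulrDl mulrA.
  have PQ : P `<=` Q by exact: (@addset_l _ R^o _ _ sW).
  have := Pmax Q; case.
    split=> // QP; apply: Pw; apply: QP; exists 0, w; split; last by rewrite add0r.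
      exact: sub_0 sP.
    by exists 1; rewrite ?mul1r.
  right; split; first exact: submodule_add.
    exact: subset_trans IP PQ.
  by move=> _ [p [_ [Pp [a _ <-] ->]]] hS; apply: hn; exists p, a.
have [p [a [Pp Sa]]] : exists p a, P p /\ S (p + a * u).
  by apply: key => h; apply: huv; left.
have [q [b [Pq Sb]]] : exists q b, P q /\ S (q + b * v).
  by apply: key => h; apply: huv; right.
apply: (PS _ _ (SM _ _ Sa Sb)).
have -> : (p + a * u) * (q + b * v) = (q + b * v) * p + ((a * u) * q + (a * b) * (u * v)).
  rewrite mulrDl [p * _]mulrC; congr (_ + _); rewrite mulrDr; congr (_ + _).
  by rewrite mulrACA.
apply: (sub_lin sP) => //; apply: (sub_lin sP) => //; exact: (sub_Z sP).
Qed.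

End Primes.

Section KrullStep.
Variables (R : comNzRingType) (V : lmodType R).
Local Open Scope classical_set_scope.
Implicit Types N : set V.

(** The annihilator of [V / N]. *)
Definition annq N : set R := [set a | forall y, N (a *: y)].

Lemma annq_submodule N : submodule N -> @submodule _ R^o (annq N).
Proof.
move=> sN; apply/idealP; split; first by move=> y; rewrite scale0r; apply: sub_0.
move=> a u v hu hv y; rewrite scalerDl -scalerA.
by apply: (sub_lin sN).
Qed.

Definition pchain N l := exists c : nat -> set R,
  (forall i, (i <= l)%N -> prime_ideal (c i) /\ annq N `<=` c i) /\
  (forall i, (i < l)%N -> c i `<` c i.+1).

(** For [x] regular on [V / N], the multiplicative set of the [s * x ^ k] with [s]
  outside a prime [P] that contains [x] and [annq N] avoids [annq N]; so there is
  a strictly smaller prime above [annq N]. *)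
Lemma pchain_regular N N' x l : submodule N ->
  (forall y, N (x *: y) -> N y) -> N `<=` N' -> (forall y, N' (x *: y)) ->
  pchain N' l -> pchain N l.+1.
Proof.
move=> sN xreg NN' N'x [c [h1 h2]].
have [/prime_idealP [sP P1 Pp] hP] := h1 0%N isT.
pose S := [set a | exists s k, ~ c 0%N s /\ a = s * x ^+ k].
have [] := @prime_avoiding _ (annq N) S (annq_submodule sN).
- by exists 1, 0%N; rewrite expr0 mulr1.
- move=> _ _ [s [k [hs ->]]] [t [m [ht ->]]]; exists (s * t), (k + m)%N.
  by rewrite exprD mulrACA; split=> // /Pp [].
- move=> a ha [s [k [hs ea]]]; apply: hs; apply: hP => y; apply: NN'.
  elim: k a ea ha => [|k IH] a -> ha.
    by have := ha y; rewrite expr0 mulr1.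
  apply: (IH _ erefl) => z; apply: xreg.
  by have := ha z; rewrite exprS mulrCA -scalerA.
move=> Q [pQ NQ QS].
exists (fun i => if i is j.+1 then c j else Q); split=> [[|i]|[|i]] //.
- rewrite ltnS => hi; have [pc hc] := h1 i hi; split=> //.
  by apply: subset_trans hc => a ha y; apply/NN'/ha.
- move=> _; split=> [a Qa|cQ].
    apply: contrapT => ca; apply: (QS _ Qa); exists a, 0%N.
    by rewrite expr0 mulr1.
  have xc : c 0%N x by apply: hP.
  by apply: (QS _ (cQ _ xc)); exists 1, 1%N; rewrite expr1 mul1r.
- by rewrite ltnS; apply: h2.
Qed.

End KrullStep.

Section Growth.
Variables (n : nat) (K : fieldType) (M : lmodType {mseries K[n]}).
Local Notation A := {mseries K[n]}.
Local Notation mm := (@ms_max n K).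
Local Open Scope classical_set_scope.

Lemma ord1_prime : prime_ideal (@ord n K 1).
Proof.
apply/prime_idealP; split.
- apply/idealP; split; first exact: ord0.
  by move=> a u v hu hv; apply: ordD => //; apply: ordMl.
- by move=> /ord1_sconst /eqP; rewrite rmorph1 oner_eq0.
- move=> u v /ord1_sconst /eqP; rewrite rmorphM mulf_eq0 => /orP [] /eqP h.
    by left; apply/ord1_sconst.
  by right; apply/ord1_sconst.
Qed.

(** By induction on [N], passing to the colon ideal [J : X_i], which lowers the
  exponent [k i] by one. *)
Lemma powers_ideal N (J : set A) (k : 'I_n -> nat) : @submodule _ A^o J ->
  (forall i, J (ms_of_mpoly 'X_i ^+ k i)) -> (\sum_i k i < N)%N -> ord N `<=` J.
Proof.
elim: N J k => // N IH J k sJ hJ kN f /ord_decomp [F [hF ->]].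
case: (pselect (exists i, k i = 0%N)) => [[i ki]|k0].
  have J1 : J 1 by have := hJ i; rewrite ki expr0.
  move: (\sum_i _) => g; rewrite -[g]mulr1; exact: (@sub_Z _ A^o _ sJ g 1 J1).
apply: (sub_sum sJ) => i _.
pose J' : set A := [set a | J (ms_of_mpoly 'X_i * a)].
have kpos j : (0 < k j)%N by rewrite lt0n; apply/eqP => kj; apply: k0; exists j.
apply: (IH J' (fun j => if j == i then (k j).-1 else k j)) => //.
- apply/idealP; split; first by rewrite /J' /= mulr0; apply: (sub_0 sJ).
  move=> a u v hu hv; rewrite /J' /= mulrDr mulrCA; exact: (sub_lin sJ).
- move=> j; case: eqP => [->|_].
    by rewrite /J' /= -exprS prednK.
  exact: (@sub_Z _ A^o _ sJ (ms_of_mpoly 'X_i) _ (hJ j)).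
- rewrite -ltnS; apply: leq_trans kN; rewrite ltnS.
  rewrite [X in (_ < X)%N](bigD1 i) //= [X in (X < _)%N](bigD1 i) //= eqxx.
  rewrite -addSn prednK // leq_add2l; apply: leq_sum => j ji.
  by rewrite (negbTE ji).
Qed.

Variables (x : nat -> A) (d : nat).
Hypothesis xreg : regular_seq M mm x d.
Hypothesis Mdim : krull_dim M d.

Let N r : set M := seq_mul M x r.

Let sN r : submodule (N r). Proof. exact: ideal_mul_submodule. Qed.

Lemma pchain_seq r l : (r <= d)%N -> pchain (N r) l -> pchain (N 0) (r + l).
Proof.
have [_ reg _] := xreg.
elim: r l => // r IH l rd h; rewrite addSnnS; apply: IH; first exact: ltnW.
apply: (pchain_regular (x := x r) (sN r) _ _ _ h).
- by move=> y; apply: reg.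
- by move=> y hy; apply/seq_mulS; exists y, 0; rewrite scaler0 addr0.
- by move=> y; apply/seq_mulS; exists 0, y; rewrite add0r; split=> //; apply: sub_0.
Qed.

(** Each regular element lowers the Krull dimension, so modulo [d] of them only the
  maximal ideal is left above the annihilator. *)
Lemma cm_finite_colength : exists s, forall f, ord s f -> forall y, N d (f *: y).
Proof.
have nopc l : pchain (N d) l.+1 -> False.
  move=> /(pchain_seq (leqnn d)) [c [h1 h2]].
  have : (d + l.+1 <= d)%N; last by rewrite addnS ltnNge leq_addr.
  apply: Mdim.2; exists c; split=> // i /h1 [pc hc]; split=> //.
  by move=> a ha; apply: hc => y; apply/seq_mul0.
have /choice [k hk] : forall i : 'I_n, exists k, annq (N d) (ms_of_mpoly 'X_i ^+ k).
  move=> i; apply: contrapT => hn.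
  have [] := @prime_avoiding _ (annq (N d)) [set a | exists k, a = ms_of_mpoly 'X_i ^+ k]
    (annq_submodule (sN d)).
  - by exists 0%N; rewrite expr0.
  - by move=> _ _ [a ->] [b ->]; exists (a + b)%N; rewrite exprD.
  - by move=> a ha [k ea]; apply: hn; exists k; rewrite -ea.
  move=> P [pP NP PX]; apply: (@nopc 0%N).
  have Pm : P `<=` ord 1.
    move=> f Pf; case: (ord1_or_unit f) => // - [g fg].
    have /prime_idealP [sP P1 _] := pP; case: P1; rewrite -fg mulrC.
    exact: (@sub_Z _ A^o _ sP g f Pf).
  exists (fun i => if i is 0%N then P else ord 1); split.
    move=> [|j] _; split=> //; first exact: ord1_prime.
    exact: subset_trans NP Pm.
  move=> [|//] _; split=> // mP.
  apply: (PX (ms_of_mpoly 'X_i)); last by exists 1%N; rewrite expr1.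
  apply: mP; apply: ord_poly; rewrite dhomogX; apply/eqP; exact: mdeg1.
exists (\sum_i k i).+1 => f hf.
exact: (powers_ideal (annq_submodule (sN d)) hk (ltnSn _) hf).
Qed.

Lemma mfilt_submodule s : submodule (@mfilt n K M s).
Proof. exact: ideal_mul_submodule. Qed.

Lemma mfiltE s y : @mfilt n K M s y <->
  Defs.span [set z : M | exists (a : A) w, ord s a /\ z = a *: w] y.
Proof. by rewrite /mfilt /ideal_mul ideal_pow_ord. Qed.

Lemma mfilt_min s (X : set M) : submodule X ->
  (forall f y, ord s f -> X (f *: y)) -> mfilt s `<=` X.
Proof.
move=> sX h y /mfiltE [k [c [g [hg ->]]]]; apply: (sub_sum sX) => i _.
by apply: (sub_Z sX); have [a [w [ha ->]]] := hg i; apply: h.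
Qed.

Lemma mfilt_in s f y : ord s f -> @mfilt n K M s (f *: y).
Proof. by move=> hf; apply/mfiltE; apply: span_sub; exists f, y. Qed.

Lemma mfiltT : @mfilt n K M 0 = setT.
Proof.
apply/seteqP; split=> // y _; rewrite -[y]scale1r.
by apply: mfilt_in; apply: ord_any.
Qed.

Lemma mfilt_mul s f y : ord 1 f -> @mfilt n K M s y -> mfilt s.+1 (f *: y).
Proof. by rewrite -ms_max_ord -add1n => hf; apply: ideal_mul_pow; rewrite ideal_pow_ord -ms_max_ord. Qed.

Variables (b : nat) (e : {linear 'cV[A]_b -> M}).
Hypothesis es : forall y, exists v, e v = y.

Lemma lenle_mfilt s : lenle (mfilt s) [set: M] (b * nmon_lt n s).
Proof.
have -> : setT = addset (@mfilt n K M s) (range e).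
  apply/seteqP; split=> // y _; apply: (addset_r (mfilt_submodule s)).
  by have [v <-] := es y; exists v.
apply: lenle_preimage; first exact: mfilt_submodule.
apply: (lenle_mono _ (leqnn _) (len_mord n K b s).2).
by move=> v hv; apply/(mfilt_surj es); exists v.
Qed.

(** Multiplication by [x r] maps [V / (N r + m^s V)] onto the kernel of
  [V / (N r + m^(s+1) V) -> V / (N (r+1) + m^(s+1) V)]; hence one more element
  of the sequence lowers the degree of the growth by at most one. *)
Lemma growth_step r c j : (r < d)%N ->
  (forall s, lenle (addset (N r.+1) (mfilt s)) setT (c * s ^ j)) ->
  forall s, lenle (addset (N r) (mfilt s)) setT (c * s ^ j.+1).
Proof.
move=> rd h; have [xm _ _] := xreg.
have sNf q s : submodule (addset (N q) (mfilt s)).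
  exact: submodule_add (mfilt_submodule s).
elim=> [|s IH].
  rewrite mfiltT (_ : addset _ _ = setT); last first.
    by apply/seteqP; split=> // y _; apply: (addset_r (sN r)).
  have [_ h0] := len_refl (@submodule_setT _ M).
  exact: lenle_mono h0.
pose mid := addset (N r.+1) (mfilt s.+1).
have NS : N r `<=` N r.+1.
  by move=> y hy; apply/seq_mulS; exists y, 0; rewrite scaler0 addr0.
have sub : addset (N r) (mfilt s.+1) `<=` mid.
  by move=> _ [y [z [/NS hy hz ->]]]; exists y, z.
have lx : linear (fun y : M => x r *: y).
  by move=> a y z; rewrite scalerDr !scalerA mulrC.
have h1 : lenle (addset (N r) (mfilt s.+1)) mid (c * s ^ j.+1).
  have -> : mid = addset (addset (N r) (mfilt s.+1)) (range (lin_fun lx)).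
    apply/seteqP; split.
      move=> _ [y [z [/seq_mulS [y1 [y2 [hy1 ->]]] hz ->]]].
      exists (y1 + z), (x r *: y2); rewrite addrAC; split=> //.
      by exists y1, z.
    move=> _ [_ [_ [[y [z [hy hz ->]]] [w _ <-] ->]]].
    exists (y + x r *: w), z; rewrite addrAC; split=> //.
    by apply/seq_mulS; exists y, w.
  apply: lenle_preimage; first exact: sNf.
  apply: (lenle_mono _ (leqnn _) IH) => _ [y [z [hy hz ->]]].
  rewrite /preimage /= /lin_fun scalerDr; exists (x r *: y), (x r *: z); split=> //.
    exact: (sub_Z (sN r)).
  by apply: mfilt_mul => //; rewrite -ms_max_ord; apply: xm.
have := lenle_add (sNf _ _) (@submodule_setT _ M) sub (@subsetT _ _) h1 (h s.+1).
apply: lenle_mono => //.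
have sj : (s ^ j <= s.+1 ^ j)%N by elim: (j) => // m hm; rewrite !expnS leq_mul.
by rewrite -mulnDr leq_mul // expnSr [X in (_ <= X)%N]expnSr mulnS addnC leq_add2l leq_mul.
Qed.

Lemma cm_growth : exists c, forall s, lenle (@mfilt n K M s) setT (c * s ^ d).
Proof.
have [t ht] := cm_finite_colength.
pose c := (b * nmon_lt n t)%N; exists c.
have key j : (j <= d)%N ->
    forall s, lenle (addset (N (d - j)) (mfilt s)) setT (c * s ^ j).
  elim: j => [_ s|j IH jd].
    rewrite subn0 expn0 muln1; apply: (lenle_mono _ (leqnn _) (@lenle_mfilt t)).
    apply: (subset_trans _ (addset_l (mfilt_submodule s))).
    by apply: mfilt_min => [|f y hf]; [exact: sN | exact: ht].
  apply: growth_step; first by rewrite subnSK // leq_subr.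
  by rewrite subnSK //; apply: IH; apply: ltnW.
move=> s; have := key d (leqnn d) s; rewrite subnn; apply: lenle_mono => //.
apply: addset_min; [exact: mfilt_submodule| |by []].
by move=> y /seq_mul0 ->; apply: sub_0 (mfilt_submodule s).
Qed.

End Growth.

(** * The associated graded module as a cokernel *)

Section GrMap.
Variables (n : nat) (K : fieldType) (M : lmodType {mseries K[n]}).
Local Notation A := {mseries K[n]}.
Local Notation R := {mpoly K[n]}.
Variables (b : nat) (e : {linear 'cV[A]_b -> M}).



Lemma mpih_big a c (X : 'M[R]_(a, c)) : exists N, forall s, (N <= s)%N -> mpih s X = 0.
Proof.
exists (\max_(i : 'I_a) \max_(j : 'I_c) msize (X i j)) => s hs.
apply/matrixP => i j; rewrite !mxE pihomog_big //; apply: leq_trans hs.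
by apply: (leq_trans _ (leq_bigmax i)); apply: (leq_bigmax j).
Qed.

Lemma gr_lift_subproof (x : 'cV[R]_b) :
  TSeq (fun i => e (mser (mpih i x))) \in @rees_closed n K M.
Proof.
apply/asboolP; split=> [i|] /=; first exact/mfilt_image/mord_ser/mpihP.
have [N hN] := mpih_big x; exists N => s /hN ->.
by rewrite mser0 linear0.
Qed.

Definition gr_lift x : rees M := Rees (gr_lift_subproof x).

(** A form of degree [j] in [K[X]] acts through its image in the power series, so
  the action on the degree [i] part is the convolution of homogeneous parts. *)
Lemma gr_lift_linear : linear gr_lift.
Proof.
move=> f x y; apply: val_inj; apply: tseqP => i /=.
have -> : mpih i (f *: x + y) =
    \sum_(j < i.+1) pihomog mdeg j f *: mpih (i - j) x + mpih i y.
  apply/matrixP => k l; rewrite !mxE summxE raddfD /= pihomogM; congr (_ + _).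
  by apply: eq_bigr => j _; rewrite !mxE.
have -> : mser (\sum_(j < i.+1) pihomog mdeg j f *: mpih (i - j) x + mpih i y) =
    \sum_(j < i.+1) ms_of_mpoly (pihomog mdeg j f) *: mser (mpih (i - j) x) + mser (mpih i y).
  apply/matrixP => k l; rewrite !mxE !summxE rmorphD rmorph_sum /=; congr (_ + _).
  by apply: eq_bigr => j _; rewrite !mxE rmorphM.
rewrite linearD linear_sum; congr (_ + _); apply: eq_bigr => j _.
by rewrite linearZ.
Qed.

Lemma gr_map_linear : linear (fun x => gr_class (gr_lift x)).
Proof. by move=> f x y; rewrite gr_lift_linear gr_classD gr_classZ. Qed.

(** The map of associated graded modules induced by [e], on the graded module of
  the free module [A^b]. *)
Definition gr_map : {linear 'cV[R]_b -> gr M} := lin_fun gr_map_linear.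

Lemma gr_map_eq0 x : gr_map x = 0 <->
  forall s, @mfilt n K M s.+1 (e (mser (mpih s x))).
Proof. exact: gr_class_eq0. Qed.

Lemma gr_map_homog s x : mdhomog s x -> gr_comp s%:Z (gr_map x).
Proof.
move=> hx; exists (gr_lift x); split=> // j; rewrite eqz_nat => js /=.
by rewrite (mpih_ne hx js) mser0 linear0.
Qed.

Hypothesis es : forall y, exists v, e v = y.

Lemma gr_map_surj y : exists x, gr_map x = y.
Proof.
have [z ->] := gr_class_surj y.
have [N hN] : exists N, forall i, (N <= i)%N -> tcoef (rees_val z) i = 0.
  by case: (z) => z' /= /asboolP [].
have /choice [v hv] : forall i, exists v : 'cV[A]_b, mord i v /\ tcoef (rees_val z) i = e v.
  by move=> i; have [v hv ev] := (mfilt_surj es _ _).1 (rees_valP z i); exists v.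
exists (\sum_(i < N) mhom i (v i)).
apply/eqP; rewrite -subr_eq0 /gr_map /lin_fun -gr_classB; apply/eqP/gr_class_eq0 => i /=.
have hp : mpih i (\sum_(i0 < N) mhom i0 (v i0)) = if (i < N)%N then mhom i (v i) else 0.
  apply/matrixP => k l; rewrite !mxE summxE raddf_sum /=.
  under eq_bigr => j _ do rewrite mxE.
  have h0 j : j != i -> pihomog mdeg i (ms_homog j (v j k l)) = 0.
    by move=> ji; apply: (@pihomog_ne0 _ _ _ j) => //; apply: ms_homogP.
  case: ltnP => hi.
    rewrite (bigD1 (Ordinal hi)) //= pihomog_dE ?ms_homogP // mxE.
    rewrite big1 ?addr0 // => j nj; apply: h0; apply: contra nj => /eqP e1.
    by apply/eqP/val_inj.
  rewrite big1 ?mxE // => j _; apply: h0.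
  by rewrite neq_ltn (leq_trans (ltn_ord j) hi).
rewrite hp; case: ltnP => hi; last by rewrite mser0 linear0 hN // subrr; apply: span0.
have [vi ->] := hv i; rewrite -linearB; apply: mfilt_image.
by rewrite -opprB; apply: mordN; apply: mord_lead.
Qed.

(** Converts relations in the associated graded module into leading forms of
  elements of the kernel of [e]. *)
Lemma gr_map_ker s x : mdhomog s x ->
  gr_map x = 0 <-> exists2 a, mord s.+1 a & e (mser x - a) = 0.
Proof.
move=> hx; rewrite gr_map_eq0; split=> [/(_ s)|[a ha h] t].
  rewrite mpihK // => /(mfilt_surj es) [a ha ea]; exists a => //.
  by rewrite linearB ea subrr.
case: (eqVneq t s) => [->|ts]; last first.
  rewrite (mpih_ne hx ts) mser0 linear0; exact: span0.
rewrite mpihK //; apply/(mfilt_surj es); exists a => //.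
by apply/eqP; rewrite -subr_eq0 -linearB h.
Qed.

End GrMap.

Section PolyMax.
Variables (n : nat) (K : fieldType).
Local Notation R := {mpoly K[n]}.

Lemma mpoly_maxP (p : R) : mpoly_max p <-> p@_0%MM = 0.
Proof.
split=> [[k [c [g [hg ->]]]]|p0].
  rewrite raddf_sum big1 // => i _; have [j ->] := hg i.
  by rewrite /= (rmorphM (mcoeff 0%MM)) /= mcoeffX mnm1_eq0 mulr0.
rewrite (mpolyE p) big_seq; apply: (@span_sum _ R^o) => m hm.
rewrite -mul_mpolyC; apply: (@spanZ _ R^o).
have [i hi] : exists i, (0 < m i)%N.
  apply: contrapT => h; move: hm; rewrite mcoeff_msupp (_ : m = 0%MM) ?p0 ?eqxx //.
  apply/mnmP => i; rewrite mnm0E; apply/eqP; rewrite -leqn0 leqNgt.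
  by apply/negP => hi; apply: h; exists i.
have -> : 'X_[m] = 'X_[m - U_(i)] * 'X_i :> R.
  rewrite -mpolyXD submK //; apply/mnm_lepP => j; rewrite mnm1E.
  by case: eqP => // <-.
apply: (@spanZ _ R^o); apply: (@span_sub _ R^o).
by exists i.
Qed.

End PolyMax.

Section FromInitialComplex.
Variables (n : nat) (K : fieldType) (M : lmodType {mseries K[n]}).
Local Notation A := {mseries K[n]}.
Local Notation R := {mpoly K[n]}.
Variables (beta : nat -> nat).
Variable phi : forall i, 'M[A]_(beta i, beta i.+1).
Variable eps : {linear 'cV[A]_(beta 0%N) -> M}.
Hypothesis res : free_resolution phi eps.
Hypothesis acyc : acyclic (in_complex phi).
Local Notation v i := (mx_order (phi i)).

Lemma phi_phi i (z : 'cV_(beta i.+2)) : phi i *m (phi i.+1 *m z) = 0.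
Proof. by have [_ _ h] := res; apply/h; exists z. Qed.

Lemma phi_lead i : mord (v i).+1 (phi i - mser (mx_in (phi i))).
Proof. exact/mord_lead/mx_orderP. Qed.

Lemma in_mul i t (w : 'cV_(beta i.+1)) : mord t w ->
  mhom (v i + t) (phi i *m w) = mx_in (phi i) *m mhom t w.
Proof. by move=> hw; rewrite (mhom_mul (mx_orderP (phi i)) hw). Qed.

(** The differentials are strict for the filtrations shifted by the [d_i]: the
  leading form of [u] is a cycle, hence a boundary, of the complex of leading
  forms, so [u] can be corrected by a boundary to have larger order. *)
Lemma strictness i t (u : 'cV_(beta i.+1)) : mord (v i + t) (phi i *m u) ->
  exists z w, u = phi i.+1 *m z + w /\ mord t w.
Proof.
elim: t => [_|t IH hu]; first by exists 0, u; rewrite mulmx0 add0r.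
have [|z [w [eu hw]]] := IH; first by apply: mord_le hu; rewrite leq_add2l.
have ephi : phi i *m u = phi i *m w by rewrite eu mulmxDr phi_phi add0r.
have hin : mx_in (phi i) *m mhom t w = 0.
  by rewrite -in_mul // -ephi; move: hu; rewrite addnS => /mordS [].
have [h1 h2] := exact_homogE (mx_in_homog (phi i)) (mx_in_homog (phi i.+1))
  (@acyc i) (mhomog_homog t w) hin.
case: (ltnP t (v i.+1)) => ht.
  by exists z, w; split=> //; apply/mordS; split=> //; apply: h1.
have [y hy ey] := h2 ht.
exists (z + mser y), (w - phi i.+1 *m mser y); split.
  by rewrite mulmxDr -addrA [_ *m mser y + _]addrC subrK.
have hord : mord (t - v i.+1) (mser y) by apply: mord_ser.
apply/mordS; split.
  apply: mordB => //; rewrite -(subnKC ht); apply: mord_mul => //.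
  exact: mx_orderP.
by rewrite mhomB -{2}(subnKC ht) in_mul // mhomK // ey subrr.
Qed.

(** A relation among the generators of the associated graded module is the leading
  form of some [phi 0 *m u]; by strictness [u] may be taken of the expected order,
  and then the leading form is the image of that of [u]. *)
Lemma in_coker (x : 'cV[R]_(beta 0%N)) :
  gr_map eps x = 0 <-> exists z, x = mx_in (phi 0%N) *m z.
Proof.
have [es e0 _] := res; split=> [hx|[z ->]].
  have {}hx s : exists z, mpih s x = mx_in (phi 0%N) *m z.
    have : gr_map eps (mpih s x) = 0.
      apply/gr_map_eq0 => t; case: (eqVneq t s) => [->|ts].
        by rewrite (mpihK (mpihP s x)); apply: (gr_map_eq0 eps x).1.
      rewrite (mpih_ne (mpihP s x) ts) mser0 linear0; exact: span0.
    move: (mpihP s x); move: (mpih s x) => y hy /(gr_map_ker es hy) [a ha].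
    move=> /e0 [u eu].
    have hys : mhom s (phi 0%N *m u) = y.
      rewrite -eu -[RHS](mhomK hy); apply: mhom_eq.
      by rewrite addrAC subrr sub0r; apply: mordN.
    have hu : mord s (phi 0%N *m u).
      by rewrite -eu; apply: mordB; [apply: mord_ser | apply: mord_le ha].
    case: (ltnP s (v 0%N)) => hs.
      exists 0; rewrite mulmx0 -hys.
      have : mord s.+1 (phi 0%N *m u) by apply: (mord_le hs); rewrite -[v _]addn0; apply: mord_mul (mx_orderP _) (mord_any u).
      by move/mordS => [].
    have [|z [w [ez hw]]] := @strictness 0%N (s - v 0%N) u; first by rewrite subnKC.
    exists (mhom (s - v 0%N) w).
    by rewrite -in_mul // subnKC // -hys ez mulmxDr phi_phi add0r.
  have [N ->] := mpih_sum x; elim: N => [|N [z IH]].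
    by exists 0; rewrite big_ord0 mulmx0.
  have [y hy] := hx N; exists (z + y).
  by rewrite big_ord_recr /= IH hy mulmxDr.
apply/gr_map_eq0 => s.
case: (ltnP s (v 0%N)) => hs.
  rewrite (mpih_mul_lt _ (mx_in_homog _) hs) mser0 linear0; exact: span0.
rewrite -(subnKC hs) (mpih_mul _ _ (mx_in_homog _)) mserM.
move: (s - v 0%N)%N (mpihP (s - v 0%N) z) => t; move: (mpih t z) => y hy.
have -> : eps (mser (mx_in (phi 0%N)) *m mser y) =
          eps ((mser (mx_in (phi 0%N)) - phi 0%N) *m mser y).
  rewrite mulmxBl linearB; have -> : eps (phi 0%N *m mser y) = 0.
    by apply/e0; exists (mser y).
  by rewrite subr0.
apply: mfilt_image; rewrite -addSn; apply: mord_mul; last exact: mord_ser.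
by rewrite -opprB; apply: mordN; apply: phi_lead.
Qed.

Hypothesis minim : minimal_seq phi.

Lemma mx_in_min i k l : mcoeff 0%MM (mx_in (phi i) k l) = 0.
Proof.
by rewrite mxE mcoeff_ms_homog; case: eqP => // _; apply: minim.
Qed.

Lemma in_resolution : free_resolution (fun i => mx_in (phi i)) (gr_map eps).
Proof.
have [es _ _] := res.
by split; [exact: gr_map_surj | exact: in_coker | exact: acyc].
Qed.

Lemma in_pure p : (0 < beta p)%N -> (forall i, (p < i)%N -> beta i = 0%N) ->
  has_pure_resolution (assoc_graded M).
Proof.
move=> bp b0; exists p, (fun i => (in_deg phi i)%:Z); split.
  exact: (minimal_projdim (ev := mcoeff 0%MM) in_resolution mx_in_min bp b0).
exists (in_complex phi); split=> //.
exists (gr_map eps); split.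
- move=> d w hw; have e0 : in_deg phi 0 = 0%N by rewrite /in_deg big_ord0.
  have {}hw k : homogz d (w k 0) by have := hw k; rewrite /= e0 subr0.
  case: d hw => s hw.
    by apply: gr_map_homog => i j; rewrite (ord1 j); apply: hw.
  rewrite (_ : w = 0) ?linear0; last by apply/colP => k; rewrite mxE; apply: hw.
  exact: gr_comp0.
- exact: in_resolution.
- by move=> i k l; apply/mpoly_maxP/mx_in_min.
Qed.

End FromInitialComplex.

(** * Lifting a pure resolution of the associated graded module *)

Section Invertible.
Variables (n : nat) (K : fieldType).
Local Notation A := {mseries K[n]}.
Local Notation R := {mpoly K[n]}.

Definition cst_mx a b (X : 'M[K]_(a, b)) : 'M[A]_(a, b) :=
  map_mx (fun c => ms_of_mpoly c%:MP) X.

Lemma cst_mxK a b (X : 'M_(a, b)) : map_mx (@sconst n K) (cst_mx X) = X.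
Proof. by apply/matrixP => i j; rewrite !mxE sconstC. Qed.

Lemma mord1_sconst a b (X : 'M[A]_(a, b)) : mord 1 X <-> map_mx (@sconst n K) X = 0.
Proof.
split=> [h|h i j]; first by apply/matrixP => i j; rewrite !mxE; apply/ord1_sconst.
by apply/ord1_sconst; move/matrixP/(_ i j): h; rewrite !mxE.
Qed.

Lemma square_inverse b (T : 'M[A]_b) : map_mx (@sconst n K) T = 1%:M ->
  exists T', T *m T' = 1%:M /\ T' *m T = 1%:M.
Proof.
move=> hT; have [|g hg] := @series_unit n K (\det T).
  by rewrite -det_map_mx hT det1 oner_neq0.
exists (g *: \adj T); split.
  by rewrite -scalemxAr mul_mx_adj scale_scalar_mx mulrC hg.
by rewrite -scalemxAl mul_adj_mx scale_scalar_mx mulrC hg.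
Qed.

(** The two hypotheses make the constant part of [W] invertible; for [V] its inverse,
  the determinants of [W V] and [V W] have constant term 1, hence are units. *)
Lemma series_inverse a b (W : 'M[A]_(a, b)) :
  (forall x : 'cV_a, exists y, mord 1 (x - W *m y)) ->
  (forall c : 'cV[K]_b, mord 1 (W *m cst_mx c) -> c = 0) ->
  exists W', W *m W' = 1%:M /\ W' *m W = 1%:M.
Proof.
move=> surj inj; pose U := map_mx (@sconst n K) W.
have /choice [y hy] := fun j : 'I_a => surj (delta_mx j 0).
pose V : 'M[K]_(b, a) := \matrix_(k, j) sconst (y j k 0).
have UV : U *m V = 1%:M.
  apply/matrixP => i j; have /mord1_sconst := hy j.
  rewrite map_mxB map_mxM => /colP /(_ i); rewrite !mxE => /eqP.
  rewrite subr_eq0 eqxx andbT => /eqP.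
  move=> h; transitivity (sconst ((i == j)%:R : A)); last first.
    by case: (i == j); rewrite ?rmorph1 ?rmorph0.
  by rewrite [RHS]h; apply: eq_bigr => k _; rewrite !mxE.
have VU : V *m U = 1%:M.
  apply/eqP; rewrite -subr_eq0; apply/eqP/matrixP => i j; rewrite [RHS]mxE.
  have -> : (V *m U - 1%:M) i j = (col j (V *m U - 1%:M)) i 0 by rewrite [RHS]mxE.
  rewrite (inj (col j (V *m U - 1%:M))) ?mxE //; apply/mord1_sconst.
  rewrite map_mxM cst_mxK -/U colE mulmxA mulmxBr mulmxA UV mul1mx mulmx1 subrr.
  by rewrite mul0mx.
have [|T1 [h1 _]] := @square_inverse _ (W *m cst_mx V).
  by rewrite map_mxM cst_mxK.
have [|T2 [_ h2]] := @square_inverse _ (cst_mx V *m W).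
  by rewrite map_mxM cst_mxK.
have e1 : W *m (cst_mx V *m T1) = 1%:M by rewrite mulmxA.
have e2 : (T2 *m cst_mx V) *m W = 1%:M by rewrite -mulmxA.
exists (cst_mx V *m T1); split=> //.
have <- : T2 *m cst_mx V = cst_mx V *m T1.
  by rewrite -[LHS]mulmx1 -e1 mulmxA e2 mul1mx.
exact: e2.
Qed.

Lemma mhom0_1 a : mhom 0 (1%:M : 'M[A]_a) = 1%:M.
Proof.
have <- : mser (1%:M : 'M[R]_a) = 1%:M by apply: map_mx1.
by apply: mhomK => i j; rewrite mxE; case: eqP; rewrite ?dhomog1 ?dhomog0.
Qed.

Lemma mhom0_mul1 a b (X : 'M[A]_(a, b)) Y : X *m Y = 1%:M ->
  mhom 0 X *m mhom 0 Y = 1%:M.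
Proof.
by move=> h; rewrite -(mhom_mul (mord_any X) (mord_any Y)) h mhom0_1.
Qed.

(** The successive corrections sum to a power series, because each coefficient of the
  sum receives contributions from finitely many of them. *)
Lemma successive_approximation w a b (T : 'M[A]_(a, b)) (P : 'cV[A]_a -> Prop) :
  mord w T -> (forall z v, P z -> P (z - T *m v)) ->
  (forall k z, P z -> mord k z -> exists y : 'cV[R]_b,
     [/\ mdhomog (k - w) y, (k < w)%N -> y = 0 & mord k.+1 (z - T *m mser y)]) ->
  forall k z, P z -> mord k z -> exists2 v, mord (k - w) v & z = T *m v.
Proof.
move=> hT PT step k z Pz hz.
(* Outside of the scope of the hypothesis the choice function returns 0. *)
have /choice [f hf] : forall kz : nat * 'cV[A]_a, exists y : 'cV[R]_b,
    P kz.2 -> mord kz.1 kz.2 ->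
    [/\ mdhomog (kz.1 - w) y, (kz.1 < w)%N -> y = 0 & mord kz.1.+1 (kz.2 - T *m mser y)].
  move=> [k' z']; case: (pselect (P z' /\ mord k' z')) => [[h1 h2]|h].
    by have [y hy] := step k' z' h1 h2; exists y.
  by exists 0 => h1 h2; case: h.
pose zs := fix zs j := if j is i.+1 then zs i - T *m mser (f ((k + i)%N, zs i)) else z.
(* The correction made at step [j], a form of degree [k + j - w]. *)
pose y j := f ((k + j)%N, zs j).
have hzs j : P (zs j) /\ mord (k + j) (zs j).
  elim: j => [|j [h1 h2]] /=; first by rewrite addn0.
  split; first exact: PT.
  by have [_ _] := hf ((k + j)%N, zs j) h1 h2; rewrite addnS.
have hy j : mdhomog (k + j - w) (y j) /\ ((k + j < w)%N -> y j = 0).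
  by have [h1 h2] := hzs j; have [] := hf ((k + j)%N, zs j) h1 h2.
have zsE j : zs j = z - T *m \sum_(i < j) mser (y i).
  elim: j => [|j IH] /=; first by rewrite big_ord0 mulmx0 subr0.
  by rewrite big_ord_recr /= mulmxDr opprD addrA -IH.
pose v : 'cV[A]_b := \col_l MSeries (fun m => \sum_(j < (mdeg m + w).+1) (y j l 0)@_m).
have ycoef j l m : (mdeg m + w < j)%N -> (y j l 0)@_m = 0.
  move=> hj; have [h1 h2] := hy j.
  apply: (dhomog_coef (h1 l 0)); rewrite neq_ltn; apply/orP; left.
  rewrite ltn_subRL addnC; apply: (leq_trans hj); exact: leq_addl.
have vE N : mord (N - w) (v - \sum_(j < N) mser (y j)).
  move=> l j m; rewrite (ord1 j) ltn_subRL addnC => hm.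
  rewrite !mxE scoefB summxE scoef_sum /=.
  rewrite (big_ord_widen N (fun j => (y j l 0)@_m)) //.
  rewrite [X in _ - X](bigID (fun j : 'I_N => (j < (mdeg m + w).+1)%N)) /=.
  rewrite opprD addrA [X in X - _](_ : _ = 0); last first.
    apply/eqP; rewrite subr_eq0; apply/eqP; apply: eq_bigr => i _.
    by rewrite mxE scoef_poly.
  rewrite big1 ?subrr // => i; rewrite -leqNgt mxE scoef_poly => hi.
  exact: ycoef.
exists v.
  move=> l j m hm; rewrite (ord1 j) mxE /= big1 // => i _.
  have [h1 _] := hy i; apply: (dhomog_coef (h1 l 0)); rewrite neq_ltn.
  by rewrite (leq_trans hm) // leq_sub2r // leq_addr.
apply/eqP; rewrite -subr_eq0; apply/eqP/mord_eq0 => N.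
have -> : z - T *m v = zs N - T *m (v - \sum_(j < N) mser (y j)).
  by rewrite zsE mulmxBr opprB addrA subrK.
apply: mordB; first by apply: mord_le (hzs N).2; apply: leq_addl.
apply: mord_le (mord_mul hT (vE N)); by rewrite -leq_subLR.
Qed.

End Invertible.

Section LiftResolution.
Variables (n : nat) (K : fieldType) (M : lmodType {mseries K[n]}).
Local Notation A := {mseries K[n]}.
Local Notation R := {mpoly K[n]}.
Variables (beta : nat -> nat).
Variable phi : forall i, 'M[A]_(beta i, beta i.+1).
Variable eps : {linear 'cV[A]_(beta 0%N) -> M}.
Hypothesis res : free_resolution phi eps.
Hypothesis minim : minimal_seq phi.
Variables (b : nat -> nat) (D : forall i, 'M[R]_(b i, b i.+1)) (w : nat -> nat).
Hypothesis Dhom : forall i, mdhomog (w i) (D i).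
Hypothesis De : forall i (x : 'cV_(b i.+1)), D i *m x = 0 <-> exists z, x = D i.+1 *m z.
Hypothesis Dmin : forall i k l, (D i k l)@_0%MM = 0.

Lemma mord1_phi i (u : 'cV_(beta i.+1)) : mord 1 (phi i *m u).
Proof.
by apply: mord_mull => k l; apply/ord1_sconst/minim.
Qed.

Lemma D_cst i (c : 'cV[K]_(b i)) z : map_mx (@mpolyC n K) c = D i *m z -> c = 0.
Proof.
move=> h; apply/colP => k; move/colP/(_ k)/(congr1 (mcoeff 0%MM)): h.
rewrite !mxE mcoeffC eqxx mulr1 => ->; rewrite raddf_sum big1 // => l _.
by rewrite /= (rmorphM (mcoeff 0%MM)) /= Dmin mul0r.
Qed.

Lemma cst_mser a (c : 'cV[K]_a) : cst_mx n c = mser (map_mx (@mpolyC n K) c).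
Proof. by apply/matrixP => k l; rewrite !mxE. Qed.

Lemma cst_homog a (c : 'cV[K]_a) : mdhomog 0 (map_mx (@mpolyC n K) c).
Proof. by move=> k l; rewrite mxE -[_%:MP]mulr1 mul_mpolyC; apply/dhomogZ/dhomog1. Qed.

(** The change of basis [W] carries the leading forms of the syzygies, the image of
  [phi i], to the image of [D i]. *)
Definition matched i (W : 'M[A]_(beta i, b i)) (W' : 'M[A]_(b i, beta i)) :=
  [/\ W *m W' = 1%:M, W' *m W = 1%:M &
    forall s (h : 'cV[R]_(b i)), mdhomog s h ->
      (exists z, h = D i *m z) <->
      exists2 a, mord s.+1 a & exists u, W *m (mser h - a) = phi i *m u].

Section Step.
Variables (i : nat) (W : 'M[A]_(beta i, b i)) (W' : 'M[A]_(b i, beta i)).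
Hypothesis WW : matched W W'.

Let psi := W' *m phi i.

Let psi_phi (u : 'cV_(beta i.+1)) : W *m (psi *m u) = phi i *m u.
Proof. by have [h _ _] := WW; rewrite !mulmxA h mul1mx. Qed.

Let psi_eq0 (u : 'cV_(beta i.+1)) : psi *m u = 0 -> exists z, u = phi i.+1 *m z.
Proof.
have [_ _ ex] := res; move=> h; apply: (ex i u).1.
by rewrite -psi_phi h mulmx0.
Qed.

(** The columns of [D i] are leading forms of syzygies; [Y] collects preimages of
  these syzygies under [phi i]. *)
Lemma matched_lift : exists Y : 'M[A]_(beta i.+1, b i.+1),
  mord (w i).+1 (psi *m Y - mser (D i)).
Proof.
have [_ W'W h] := WW.
have /choice [u hu] : forall j : 'I_(b i.+1), exists u : 'cV[A]_(beta i.+1),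
    mord (w i).+1 (psi *m u - mser (col j (D i))).
  move=> j; have hc : mdhomog (w i) (col j (D i)).
    by move=> k l; rewrite mxE; apply: Dhom.
  have [a ha [u hu]] := (h _ _ hc).1 (ex_intro _ (delta_mx j 0) (colE _ _)).
  exists u; rewrite /psi -mulmxA -hu mulmxA W'W mul1mx addrAC subrr sub0r.
  exact: mordN.
exists (\matrix_(k, j) u j k 0) => k j; have := hu j k 0.
rewrite !mxE (eq_bigr (fun l => psi k l * (\matrix_(k, j) u j k 0) l j)) //.
by move=> l _; rewrite !mxE.
Qed.

Variables (Y : 'M[A]_(beta i.+1, b i.+1)).
Hypothesis hY : mord (w i).+1 (psi *m Y - mser (D i)).

Let T := psi *m Y.

Let T_ord : mord (w i) T.
Proof.
rewrite -[T](subrK (mser (D i))); apply: mordD; first exact: mord_le hY.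
exact: mord_ser.
Qed.

Let T_lead : mhom (w i) T = D i.
Proof. by rewrite -[RHS](mhomK (@Dhom i)); apply: mhom_eq. Qed.

Let T_mul s (v : 'cV_(b i.+1)) : mord s v -> mhom (w i + s) (T *m v) = D i *m mhom s v.
Proof. by move=> hv; rewrite (mhom_mul T_ord hv) T_lead. Qed.

(** The lifted columns generate the image of [phi i], and an element of order [k]
  only needs coefficients of order [k - w i]. *)
Lemma psi_lift k (u : 'cV_(beta i.+1)) : mord k (psi *m u) ->
  exists2 v, mord (k - w i) v & psi *m u = T *m v.
Proof.
have [_ _ h] := WW.
apply: (@successive_approximation _ _ _ _ _ T (fun z => exists u, z = psi *m u) T_ord).
- by move=> _ v [u' ->]; exists (u' - Y *m v); rewrite mulmxBr mulmxA.
- move=> {u}k _ [u ->] hk.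
  have hh : mdhomog k (mhom k (psi *m u)) by apply: mhomog_homog.
  have [z ez] : exists z, mhom k (psi *m u) = D i *m z.
    apply/(h _ _ hh); exists (mser (mhom k (psi *m u)) - psi *m u).
      by rewrite -opprB; apply: mordN; apply: mord_lead.
    by exists u; rewrite opprB addrC subrK psi_phi.
  case: (ltnP k (w i)) => kw.
    exists 0; split=> //; first exact: mdhomog0.
    rewrite mser0 mulmx0 subr0; apply/mordS; split=> //.
    by rewrite -(mpihK hh) ez (mpih_mul_lt _ (@Dhom i)).
  exists (mpih (k - w i) z); split; [exact: mpihP | by [] |].
  have hy : mord (k - w i) (mser (mpih (k - w i) z)) by apply/mord_ser/mpihP.
  apply/mordS; split.
    by apply: mordB => //; rewrite -[k](subnKC kw) addKn; apply: mord_mul.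
  rewrite mhomB -[X in mhom X (T *m _)](subnKC kw) T_mul // mhomK; last exact: mpihP.
  by rewrite -(mpih_mul _ _ (@Dhom i)) subnKC // -ez mpihK // subrr.
- by exists u.
Qed.

Let psi_ord : mord (w i) psi.
Proof.
move=> k l; have [v _] := psi_lift (mord_any (psi *m delta_mx l 0)).
rewrite -colE => /colP /(_ k); rewrite mxE => ->.
exact: (mord_mull v T_ord).
Qed.

(** [Y] is invertible modulo the maximal ideal: onto because the lifted columns
  generate and [phi] is minimal, injective because a constant relation among the
  columns of [D i] would be a boundary of the minimal resolution [D]. *)
Lemma matched_next : exists Y' : 'M[A]_(b i.+1, beta i.+1), matched Y Y'.
Proof.
have [Y' [h1 h2]] : exists Y', Y *m Y' = 1%:M /\ Y' *m Y = 1%:M.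
  apply: series_inverse => [x|c hc].
    have [a _ ea] := psi_lift (mord_any (psi *m x)).
    have [z ez] : exists z, x - Y *m a = phi i.+1 *m z.
      by apply: psi_eq0; rewrite mulmxBr mulmxA ea subrr.
    by exists a; rewrite ez; apply: mord1_phi.
  have [a ha ea] : exists2 a, mord 1 a & psi *m (Y *m cst_mx n c) = T *m a.
    have := mord_mul psi_ord hc; move/psi_lift => [a ha ea].
    by exists a => //; move: ha; rewrite addKn.
  have e0 : T *m (cst_mx n c - a) = 0 by rewrite mulmxBr /T -mulmxA ea subrr.
  have := T_mul (mord_any (cst_mx n c - a)); rewrite e0 mhom0 mhomB.
  have [_ ->] := (mordS _ _).1 ha.
  rewrite subr0 cst_mser mhomK; last exact: cst_homog.
  by move=> /esym /De [z]; apply: D_cst.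
exists Y'; split=> // s h hh; split=> [[z ez]|[a ha [u hu]]].
  have Dh : D i *m h = 0 by apply/De; exists z.
  have hs := mord_ser hh.
  have : mord (w i + s).+1 (psi *m (Y *m mser h)).
    apply/mordS; rewrite mulmxA; split; first exact: mord_mul.
    by rewrite T_mul // mhomK.
  move=> /psi_lift [a ha ea]; exists a; first by move: ha; rewrite -addnS addKn.
  by apply: psi_eq0; rewrite mulmxBr mulmxBr ea mulmxA subrr.
apply/De; have hs : mord s (mser h - a).
  by apply: mordB; [apply: mord_ser | apply: mord_le ha].
have := T_mul hs; rewrite /T -mulmxA hu /psi -mulmxA.
have [_ _ ex] := res; have -> : phi i *m (phi i.+1 *m u) = 0 by apply/ex; exists u.
rewrite mulmx0 mhom0 mhomB mhomK //.
by have [_ ->] := (mordS _ _).1 ha; rewrite subr0.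
Qed.

(** If [D i] vanishes, then minimality forces both free modules of index [i.+1] to
  vanish; otherwise the order of [phi i] is the degree of [D i]. *)
Lemma matched_lead Y' : matched Y Y' ->
  mx_in (phi i) = mhom 0 W *m D i *m mhom 0 Y'.
Proof.
move=> [YY' Y'Y _]; have [WW' W'W _] := WW.
case: (posnP (b i.+1)) => hb.
  have hbeta : beta i.+1 = 0%N.
    case: (posnP (beta i.+1)) => // h0; exfalso.
    have := congr1 (fun X : 'M[A]_(beta i.+1) => X (Ordinal h0) (Ordinal h0)) YY'.
    rewrite !mxE eqxx big1 => [/esym/eqP|j _]; first by rewrite oner_eq0.
    by case: (ord_empty j hb).
  by apply/matrixP => k l; case: (ord_empty l hbeta).
have ephi : phi i = W *m T *m Y'.
  by rewrite /T /psi !mulmxA WW' mul1mx -mulmxA YY' mulmx1.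
have hphi : mord (w i) (phi i).
  by rewrite ephi; apply/mord_mull/mord_mulr.
have D0 : D i <> 0.
  move=> D0; pose c : 'cV[K]_(b i.+1) := delta_mx (Ordinal hb) 0.
  have [z] : exists z, map_mx (@mpolyC n K) c = D i.+1 *m z.
    by apply/De; rewrite D0 mul0mx.
  move=> /D_cst /colP /(_ (Ordinal hb)); rewrite !mxE !eqxx => /eqP.
  by rewrite oner_eq0.
have ein : mx_order (phi i) = w i.
  apply: mx_orderE => // h; apply: D0; rewrite -T_lead.
  have : mord (w i).+1 T.
    by apply/mord_mull/mord_mulr.
  by move/mordS => [].
rewrite /mx_in ein -/(mhom (w i) (phi i)) ephi.
rewrite -{1}[w i]addn0 (mhom_mul _ (mord_any Y')).
  by rewrite -{1}[w i]add0n (mhom_mul (mord_any W) T_ord) T_lead.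
exact: mord_mulr.
Qed.

End Step.

Lemma matched_step i W W' : @matched i W W' ->
  exists Y Y', @matched i.+1 Y Y' /\
    mx_in (phi i) = mhom 0 W *m D i *m mhom 0 Y'.
Proof.
move=> h; have [Y hY] := matched_lift h.
have [Y' hY'] := matched_next h hY.
by exists Y, Y'; split=> //; apply: matched_lead hY _ hY'.
Qed.

Lemma matched_acyclic W W' : @matched 0 W W' -> acyclic (in_complex phi).
Proof.
move=> h0.
have {h0 W W'} h : forall i, exists W W', @matched i W W'.
  elim=> [|i [W0 [W0' /matched_step [Y [Y' [hY _]]]]]]; first by exists W, W'.
  by exists Y, Y'.
move=> i x /=; have [W [W' hW]] := h i.
have [Y [Y' [hY ->]]] := matched_step hW.
have [Z [Z' [hZ ->]]] := matched_step hY.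
have [/mhom0_mul1 w1 /mhom0_mul1 w2 _] := hW.
have [/mhom0_mul1 y1 /mhom0_mul1 y2 _] := hY.
have [/mhom0_mul1 z1 /mhom0_mul1 z2 _] := hZ.
split=> [e|[z ->]].
  have /De [z ez] : D i *m (mhom 0 Y' *m x) = 0.
    rewrite -[LHS]mul1mx -w2 -mulmxA; move: e; rewrite -!mulmxA => ->.
    by rewrite mulmx0.
  exists (mhom 0 Z *m z); rewrite -!mulmxA [mhom 0 Z' *m _]mulmxA z2 mul1mx -ez.
  by rewrite mulmxA y1 mul1mx.
rewrite -!mulmxA [mhom 0 Y' *m _]mulmxA y2 mul1mx.
have -> : D i *m (D i.+1 *m (mhom 0 Z' *m z)) = 0 by apply/De; eexists.
by rewrite mulmx0.
Qed.

(** * The augmentation *)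

Variable epsC : {linear 'cV[R]_(b 0%N) -> gr M}.
Hypothesis epsC_surj : forall y, exists x, epsC x = y.
Hypothesis epsC_ker : forall x, epsC x = 0 <-> exists z, x = D 0%N *m z.
Hypothesis epsC_homog : forall k, gr_comp 0 (epsC (delta_mx k 0)).

(** Lifts of the images of the basis elements to [M], and then to the free module,
  are the columns of the first change of basis. *)
Lemma matched_start : exists W W', @matched 0 W W'.
Proof.
have [es e0 _] := res.
have /choice [u hu] : forall k : 'I_(b 0%N), exists u : 'cV[A]_(beta 0%N),
    exists y : rees M, [/\ epsC (delta_mx k 0) = gr_class y,
      forall j, j != 0%N -> tcoef (rees_val y) j = 0 & tcoef (rees_val y) 0 = eps u].
  move=> k; have [y [ey hy]] := epsC_homog k.
  by have [u hu] := es (tcoef (rees_val y) 0); exists u, y; split.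
pose W : 'M[A]_(beta 0%N, b 0%N) := \matrix_(k, j) u j k 0.
pose eW : {linear 'cV[A]_(b 0%N) -> M} := (eps \o mulmx W)%FUN.
have dh k : mdhomog 0 (delta_mx k 0 : 'cV[R]_(b 0%N)) by apply: mdhomog_delta.
have eC x : epsC x = gr_map eW x.
  rewrite linear_col [RHS]linear_col; apply: eq_bigr => k _; congr (_ *: _).
  have [y [-> hy0 hy]] := hu k; apply/eqP; rewrite -subr_eq0.
  apply/eqP; rewrite /gr_map /lin_fun -gr_classB; apply/gr_class_eq0 => i /=.
  case: (eqVneq i 0%N) => [->|i0]; last first.
    rewrite hy0 // (mpih_ne (dh k) i0) mser0 mulmx0 linear0 subrr; exact: span0.
  rewrite hy (mpihK (dh k)) (_ : mser _ = delta_mx k 0); last exact: map_delta_mx.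
  rewrite -colE (_ : col k W = u k) ?subrr; first exact: span0.
  by apply/colP => l; rewrite !mxE.
have [W' [WW' W'W]] : exists W', W *m W' = 1%:M /\ W' *m W = 1%:M.
  apply: series_inverse => [x|c hc].
    have [y hy] := epsC_surj (gr_map eps (mhom 0 x)).
    exists (mser (mpih 0 y)).
    have : @mfilt n K M 1 (eps (W *m mser (mpih 0 y) - mser (mhom 0 x))).
      have : gr_map eW y - gr_map eps (mhom 0 x) = 0 by rewrite -eC hy subrr.
      rewrite /gr_map /lin_fun -gr_classB => /gr_class_eq0 /(_ 0%N) /=.
      by rewrite -linearB (mpihK (mhomog_homog 0 x)).
    move=> /(mfilt_surj es) [a ha ea].
    have /e0 [z ez] : eps (W *m mser (mpih 0 y) - mser (mhom 0 x) - a) = 0.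
      by rewrite linearB ea subrr.
    have -> : x - W *m mser (mpih 0 y) =
        (x - mser (mhom 0 x)) - a - (W *m mser (mpih 0 y) - mser (mhom 0 x) - a).
      by rewrite opprB addrA subrK opprB addrA subrK.
    rewrite ez; apply: mordB; last exact: mord1_phi.
    by apply: mordB => //; apply: mord_lead.
  have /epsC_ker [z] : epsC (map_mx (@mpolyC n K) c) = 0; last exact: D_cst.
  rewrite eC; apply/gr_map_eq0 => s; case: (eqVneq s 0%N) => [->|s0].
    rewrite (mpihK (@cst_homog _ c)) -cst_mser; exact: (mfilt_image eps hc).
  rewrite (mpih_ne (@cst_homog _ c) s0) mser0 linear0; exact: span0.
exists W, W'; split=> // s h hh.
have eWs y : exists x, eW x = y.
  by have [x <-] := es y; exists (W' *m x); rewrite /eW /= mulmxA WW' mul1mx.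
rewrite -epsC_ker eC (gr_map_ker eWs hh); split=> [[a ha /e0 [z ez]]|[a ha [z ez]]].
  by exists a => //; exists z.
by exists a => //; apply/e0; exists z.
Qed.

Lemma pure_acyclic : acyclic (in_complex phi).
Proof. by have [W [W' h]] := matched_start; apply: matched_acyclic h. Qed.

End LiftResolution.

Lemma free_comp_delta n (K : fieldType) b (g : 'I_b -> int) j :
  @free_comp n K b g (g j) (delta_mx j 0).
Proof.
suff h k : homogz (g j - g k) ((delta_mx j 0 : 'cV[{mpoly K[n]}]_b) k 0) by exact: h.
rewrite mxE; case: (eqVneq k j) => [->|_]; last exact: homogz0.
by rewrite subrr; apply: dhomog1.
Qed.

Section FromPureResolution.
Variables (n : nat) (K : fieldType) (M : lmodType {mseries K[n]}).
Local Notation A := {mseries K[n]}.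
Local Notation R := {mpoly K[n]}.
Variables (beta : nat -> nat).
Variable phi : forall i, 'M[A]_(beta i, beta i.+1).
Variable eps : {linear 'cV[A]_(beta 0%N) -> M}.
Hypothesis res : free_resolution phi eps.
Hypothesis minim : minimal_seq phi.
Hypothesis beta0 : (0 < beta 0)%N.

(** Nakayama's lemma, read off the minimal resolution. *)
Lemma gr_not_max : ~ @mfilt n K M 1 (eps (delta_mx (Ordinal beta0) 0)).
Proof.
have [es e0 _] := res; move=> /(mfilt_surj es) [a ha ea].
have /e0 [u eu] : eps (delta_mx (Ordinal beta0) 0 - a) = 0.
  by rewrite linearB ea subrr.
have : mord 1 (delta_mx (Ordinal beta0) 0 : 'cV[A]_(beta 0%N)).
  by rewrite -[delta_mx _ _](subrK a) eu; apply: mordD => //; apply: mord1_phi.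
move=> /mord1_sconst /colP /(_ (Ordinal beta0)); rewrite !mxE !eqxx => /eqP.
by rewrite rmorph1 oner_eq0.
Qed.

Lemma gr_deg0_ne0 x (z : rees M) :
  gr_map eps (delta_mx (Ordinal beta0) 0) = x -> x = gr_class z ->
  tcoef (rees_val z) 0 <> 0.
Proof.
move=> <- h z0; apply: gr_not_max.
have : gr_class (gr_lift eps (delta_mx (Ordinal beta0) 0) - z) = 0.
  by rewrite gr_classB -h subrr.
move=> /gr_class_eq0 /(_ 0%N) /=; rewrite z0 subr0.
have hd : mdhomog 0 (delta_mx (Ordinal beta0) 0 : 'cV[R]_(beta 0%N)).
  exact: mdhomog_delta.
by rewrite (mpihK hd) (_ : mser _ = delta_mx (Ordinal beta0) 0) //; apply: map_delta_mx.
Qed.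

Variables (C : gradedFreeSeq n K) (q : nat) (deg : nat -> int).
Hypothesis Cq : forall i, (q < i)%N -> grank C i = 0%N.
Hypothesis Cdeg : forall i, (i <= q)%N -> forall k, @gdeg n K C i k = deg i.

Lemma gdiff_pure i : exists w, mdhomog w (gdiff C i).
Proof.
case: (ltnP i q) => iq; last first.
  by exists 0%N => k l; case: (ord_empty l (Cq _)).
have h k l : homogz (deg i.+1 - deg i) (gdiff C i k l).
  have hd : @free_comp n K _ (@gdeg n K C i.+1) (deg i.+1) (delta_mx l 0).
    by rewrite -(Cdeg iq l); apply: free_comp_delta.
  have : homogz (deg i.+1 - @gdeg n K C i k) ((gdiff C i *m (delta_mx l 0 : 'cV_(grank C i.+1))) k 0).
    exact: (gdiff_homog hd).
  rewrite (Cdeg (ltnW iq)).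
  by rewrite -colE mxE.
case: (deg i.+1 - deg i) h => w h; exists w => // k l.
by rewrite h dhomog0.
Qed.

Variable epsC : {linear 'cV[R]_(grank C 0) -> assoc_graded M}.
Hypothesis epsC_surj : forall y, exists x, epsC x = y.
Hypothesis epsC_homog :
  forall d v, free_comp (@gdeg n K C 0) d v -> gcomp d (epsC v).

(** The generators sit in degree 0, since the associated graded module vanishes in
  negative degrees and has a nonzero component in degree 0. *)
Lemma pure_generators k : gr_comp 0 (epsC (delta_mx k 0)).
Proof.
have hk j : gr_comp (deg 0%N) (epsC (delta_mx j 0)).
  by apply: epsC_homog; rewrite -(Cdeg (leq0n q) j); apply: free_comp_delta.
suff -> : 0 = deg 0%N by apply: hk.
have [x ex] := epsC_surj (gr_map eps (delta_mx (Ordinal beta0) 0)).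
apply/eqP; rewrite eq_sym; apply: contrapT => /negP d0.
have [z [ez z0]] : exists z : rees M, epsC x = gr_class z /\ tcoef (rees_val z) 0 = 0.
  rewrite linear_col.
  have /choice [y hy] : forall j, exists y : rees M,
      x j 0 *: epsC (delta_mx j 0) = gr_class y /\ tcoef (rees_val y) 0 = 0.
    move=> j; have [y [-> hy]] := hk j; exists (x j 0 *: y); split.
      by rewrite -gr_classZ.
    by rewrite /= big_ord1 hy ?scaler0 // eq_sym.
  exists (\sum_j y j); split.
    by rewrite gr_class_sum; apply: eq_bigr => j _; case: (hy j).
  by rewrite tcoef_rees_sum big1 // => j _; case: (hy j).
exact: (gr_deg0_ne0 (esym ex) ez).
Qed.

End FromPureResolution.

Lemma pure_resolution_acyclic (n : nat) (K : fieldType) (M : lmodType {mseries K[n]})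
    (beta : nat -> nat) (phi : forall i, 'M[{mseries K[n]}]_(beta i, beta i.+1))
    (eps : {linear 'cV[{mseries K[n]}]_(beta 0%N) -> M}) :
  free_resolution phi eps -> minimal_seq phi -> (0 < beta 0)%N ->
  has_pure_resolution (assoc_graded M) -> acyclic (in_complex phi).
Proof.
move=> res minim beta0 [q [deg [_ [C [[epsC [eh [es e0 De] Cm]] Cq Cdeg]]]]].
have /choice [w hw] := gdiff_pure Cq Cdeg.
have Dmin i k l : (gdiff C i k l)@_0%MM = 0 by apply/mpoly_maxP/Cm.
apply: (pure_acyclic res minim hw De Dmin es e0).
exact: (pure_generators res minim beta0 Cdeg es eh).
Qed.

(** * Lengths along the resolution *)

Section ResolutionLength.
Variables (n : nat) (K : fieldType) (M : lmodType {mseries K[n]}).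
Local Notation A := {mseries K[n]}.
Variables (beta : nat -> nat).
Variable phi : forall i, 'M[A]_(beta i, beta i.+1).
Variable eps : {linear 'cV[A]_(beta 0%N) -> M}.
Hypothesis res : free_resolution phi eps.
Hypothesis acyc : acyclic (in_complex phi).
Local Open Scope classical_set_scope.
Local Notation v i := (mx_order (phi i)).

Let dphi i : {linear 'cV[A]_(beta i.+1) -> 'cV[A]_(beta i)} := mulmx (phi i).
Local Notation bot i k := (addset (@mord n K k (beta i) 1) (range (dphi i))).

Lemma len_exists (R : comNzRingType) (V : lmodType R) (N X : set V) l :
  submodule X -> N `<=` X -> lenle N X l -> exists l', len N X l'.
Proof.
move=> sX NX; elim: l => [|l IH] h.
  by exists 0%N; split=> //; apply: chain0.
case: (pselect (chain N X l.+1)) => c; first by exists l.+1.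
apply: IH => k ck; have := h k ck; rewrite leq_eqVlt => /orP [/eqP e|//].
by case: c; rewrite -e.
Qed.

Lemma dphi_preimage i k :
  dphi i @^-1` (@mord n K k (beta i) 1) = bot i.+1 (k - v i)%N.
Proof.
apply/seteqP; split=> [u hu|_ [w [_ [hw [z _ <-] ->]]]].
  case: (leqP (v i) k) => vk; last first.
    exists u, 0; rewrite addr0; split=> //; last by exists 0 => //; exact: linear0.
    have -> : (k - v i)%N = 0%N by apply/eqP; rewrite subn_eq0 ltnW.
    exact: mord_any.
  have [|z [w [-> hw]]] := @strictness _ _ _ _ _ _ res acyc i (k - v i)%N u.
    by rewrite subnKC.
  by exists w, (phi i.+1 *m z); split=> //; rewrite addrC.
rewrite /preimage /= /dphi /= mulmxDr (phi_phi res) addr0.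
apply: mord_le (mord_mul (mx_orderP (phi i)) hw); by rewrite -leq_subLR.
Qed.

(** The additivity of the length in
  [0 -> F_(i+1) / (Z_(i+1) + m^(k - v_i) F_(i+1)) -> F_i / m^k F_i
     -> F_i / (Z_i + m^k F_i) -> 0],
  with [Z_i] the image of [phi i]; exactness on the left is strictness. *)
Lemma len_cokernel m i : (forall j, (i + m <= j)%N -> beta j = 0%N) ->
  forall k, exists l, len (bot i k) setT l /\
    l%:R = \sum_(j < m) (-1) ^+ j *
      (beta (i + j) * nmon_lt n (k - \sum_(h < j) v (i + h)))%:R :> rat.
Proof.
elim: m i => [|m IH] i hb k.
  have bi : beta i = 0%N by apply: hb; rewrite addn0.
  exists 0%N; rewrite big_ord0; split=> //.
  rewrite (_ : bot i k = setT); first exact/len_refl/submodule_setT.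
  apply/seteqP; split=> // x _; rewrite (_ : x = 0).
    by exists 0, 0; rewrite addr0; split; [exact: mord0|by exists 0 => //; apply: linear0|].
  by apply/colP => j; case: (ord_empty j bi).
have [|l' [hl' el']] := IH i.+1 _ (k - v i)%N.
  by move=> j hj; apply: hb; rewrite addnS -addSn.
have sk : submodule (@mord n K k (beta i) 1) by apply: mord_submodule.
have sb : submodule (bot i k) by apply: submodule_add => //; apply: submodule_range.
have h1 : len (@mord n K k (beta i) 1) (bot i k) l'.
  by apply/len_preimage => //; rewrite dphi_preimage.
have h2 := len_mord n K (beta i) k.
have sub : @mord n K k (beta i) 1 `<=` bot i k by apply/addset_l/submodule_range.
have [l hl] : exists l, len (bot i k) setT l.
  apply: (len_exists (submodule_setT _) (@subsetT _ _)).
  exact: (lenle_mono sub (leqnn _) h2.2).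
exists l; split=> //.
have e := len_uniq h2 (len_add sb (submodule_setT _) sub (@subsetT _ _) h1 hl).
have -> : l%:R = (beta i * nmon_lt n k)%:R - l'%:R :> rat.
  by rewrite e natrD addrAC subrr add0r.
rewrite el' big_ord_recl big_ord0 subn0 addn0 expr0 mul1r; congr (_ + _).
rewrite -sumrN; apply: eq_bigr => j _; rewrite -mulNr exprS mulN1r.
rewrite lift0 addSnnS; congr (_ * (_ * nmon_lt n _)%:R).
rewrite big_ord_recl addn0 subnDA; congr (_ - _ - _)%N.
by apply: eq_bigr => h _; rewrite lift0 addSnnS.
Qed.

Lemma len_module p : (forall j, (p < j)%N -> beta j = 0%N) ->
  forall k, exists l, length_quot (@mfilt n K M k) l /\
    l%:R = \sum_(j < p.+1) (-1) ^+ j *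
      (beta j * nmon_lt n (k - in_deg phi j))%:R :> rat.
Proof.
move=> hb k; have [es e0 _] := res.
have [|l [hl el]] := @len_cokernel p.+1 0 _ k; first by move=> j; apply: hb.
exists l; split=> //; apply/length_quotE.
rewrite (_ : setT = addset (@mfilt n K M k) (range eps)); last first.
  apply/seteqP; split=> // y _. have sM : submodule (@mfilt n K M k) by exact: mfilt_submodule.
  apply: (addset_r sM).
  by have [x <-] := es y; exists x.
apply/len_preimage; first exact: mfilt_submodule.
rewrite (_ : eps @^-1` mfilt k = bot 0 k) //.
apply/seteqP; split=> [u /(mfilt_surj es) [a ha ea]|_ [w [_ [hw [z _ <-] ->]]]].
  have /e0 [z ez] : eps (u - a) = 0 by rewrite linearB ea subrr.
  by exists a, (u - a); split=> //; [exists z | rewrite addrC subrK].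
rewrite /preimage /= linearD (_ : eps (dphi 0 z) = 0) ?addr0.
  exact: mfilt_image.
by apply/e0; exists z.
Qed.

End ResolutionLength.

(** * The Herzog-Kuhl equations *)


Section Binomial.

(** The polynomial [binomial (X + n) n]. *)
Fixpoint binpoly (n : nat) : {poly rat} :=
  if n is m.+1 then (m.+1%:R)^-1 *: (binpoly m * ('X + (m.+1%:R)%:P)) else 1.

Lemma binpolyE n t : (binpoly n).[t%:R] = 'C(t + n, n)%:R.
Proof.
elim: n => [|n IH] /=; first by rewrite addn0 bin0 hornerC.
rewrite hornerZ hornerM IH hornerD hornerX hornerC -natrD -natrM.
have := mul_bin_diag (t + n).+1 n; rewrite /= addnS => h.
by rewrite mulnC h natrM mulKf // pnatr_eq0.
Qed.

Lemma binpoly_lead n : size (binpoly n) = n.+1 /\ (binpoly n)`_n = (n`!%:R)^-1.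
Proof.
elim: n => [|n [IH1 IH2]] /=; first by rewrite size_polyC oner_eq0 coefC invr1.
have nz : (n.+1%:R)^-1 != 0 :> rat by rewrite invr_eq0 pnatr_eq0.
have b0 : binpoly n != 0 by rewrite -size_poly_eq0 IH1.
have sX : size ('X + (n.+1%:R)%:P : {poly rat}) = 2 by rewrite size_XaddC.
have X0 : ('X + (n.+1%:R)%:P : {poly rat}) != 0 by rewrite -size_poly_eq0 sX.
split; first by rewrite size_scale // size_mul // IH1 sX addn2.
rewrite coefZ mulrDr coefD coefMX /= mulrC coefMC IH2.
rewrite (nth_default 0 (s := binpoly n)) ?IH1 // mul0r addr0.
by rewrite factS natrM invfM mulrC.
Qed.

Lemma poly_growth (P : {poly rat}) (c d s0 : nat) :
  (forall s, (s0 <= s)%N -> `|P.[s%:R]| <= (c * s ^ d)%:R) -> (size P <= d.+1)%N.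
Proof.
move=> h; rewrite leqNgt; apply/negP => hd.
have [D eD] : exists D, size P = D.+2.
  by exists (size P).-2; case: (size P) hd => [|[|]].
have a0 : 0 < `|P`_D.+1|.
  rewrite normr_gt0; have : lead_coef P != 0 by rewrite lead_coef_eq0 -size_poly_eq0 eD.
  by rewrite /lead_coef eD.
pose L : rat := c%:R + \sum_(i < D.+1) `|P`_i|.
have L0 : 0 <= L by rewrite addr_ge0 ?ler0n // sumr_ge0.
pose s := maxn (maxn s0 1) (Num.bound (L / `|P`_D.+1|)).
have s1 : (1 <= s)%N by rewrite /s !leq_max orbT.
have ss0 : (s0 <= s)%N by rewrite /s !leq_max leqnn.
have sR : 1 <= s%:R :> rat by rewrite ler1n.
have := h s ss0; apply/negP; rewrite -ltNge.
have hs : L < `|P`_D.+1| * s%:R.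
  rewrite mulrC -ltr_pdivrMr //; apply: lt_le_trans (archi_boundP _) _.
    by rewrite divr_ge0.
  by rewrite ler_nat /s leq_maxr.
have pow i : (i <= D)%N -> s%:R ^+ i <= s%:R ^+ D :> rat.
  by move=> iD; apply: ler_weXn2l.
have e : P.[s%:R] = P`_D.+1 * s%:R ^+ D.+1 + \sum_(i < D.+1) P`_i * s%:R ^+ i.
  by rewrite horner_coef eD big_ord_recr /= addrC.
have hlow : `|\sum_(i < D.+1) P`_i * s%:R ^+ i| <= (\sum_(i < D.+1) `|P`_i|) * s%:R ^+ D.
  rewrite mulr_suml; apply: le_trans (ler_norm_sum _ _ _) _.
  apply: ler_sum => i _; rewrite normrM normrX normr_nat.
  by apply: ler_wpM2l => //; apply: pow; rewrite -ltnS.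
have hc : (c * s ^ d)%:R <= c%:R * s%:R ^+ D :> rat.
  by rewrite natrM natrX; apply: ler_wpM2l; rewrite ?ler0n //; apply: pow; move: hd; rewrite eD.
apply: (le_lt_trans hc).
have hD : 0 < s%:R ^+ D :> rat by rewrite exprn_gt0 // (lt_le_trans ltr01).
have h2 : L * s%:R ^+ D < `|P`_D.+1 * s%:R ^+ D.+1|.
  by rewrite normrM normrX normr_nat exprS mulrA ltr_pM2r.
have h3 : `|P`_D.+1 * s%:R ^+ D.+1| - `|\sum_(i < D.+1) P`_i * s%:R ^+ i| <= `|P.[s%:R]|.
  by rewrite e -[X in _ - X]normrN; apply: le_trans (lerB_dist _ _) _; rewrite opprK.
apply: lt_le_trans h3; rewrite ltrBrDr.
apply: le_lt_trans h2; rewrite mulrDl lerD2l //.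
Qed.

End Binomial.

Section HerzogKuhl.
Variables (n p : nat) (beta dg : nat -> nat).
Hypothesis dg0 : dg 0 = 0%N.
Hypothesis dg_inc : forall j, (j < p)%N -> (dg j < dg j.+1)%N.
Hypothesis beta0 : (0 < beta 0)%N.

Let dgR j : rat := (dg j)%:R.

Definition alt (f : {poly rat}) : rat :=
  \sum_(j < p.+1) (-1) ^+ j * (beta j)%:R * f.[dgR j].

Definition moment (k : nat) : rat := alt 'X^k.

Lemma alt_coef (f : {poly rat}) m : (size f <= m)%N -> alt f = \sum_(k < m) f`_k * moment k.
Proof.
move=> hm; rewrite /moment /alt.
under [RHS]eq_bigr => k _ do rewrite mulr_sumr.
rewrite exchange_big /=; apply: eq_bigr => j _.
rewrite (horner_coef_wide _ hm) mulr_sumr; apply: eq_bigr => k _.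
by rewrite hornerXn mulrCA.
Qed.

(** The Hilbert-Samuel polynomial, expanded by Taylor's formula: the sum of the
  [(-1)^j beta_j binomial (X - d_j + n) n]. *)
Definition hs_poly : {poly rat} :=
  \sum_(k < n.+1) ((-1) ^+ k * moment k) *: (binpoly n)^`N(k).

Lemma hs_polyE s : (forall j, (j <= p)%N -> (dg j <= s)%N) ->
  hs_poly.[s%:R] = \sum_(j < p.+1) (-1) ^+ j * (beta j * 'C(s - dg j + n, n))%:R.
Proof.
move=> hs; rewrite /hs_poly horner_sum.
under eq_bigr => k _ do rewrite hornerZ /moment /alt mulr_sumr mulr_suml.
rewrite exchange_big /=; apply: eq_bigr => j _.
have -> : (-1) ^+ j * (beta j * 'C(s - dg j + n, n))%:R =
    (-1) ^+ j * (beta j)%:R * (binpoly n).[s%:R + - dgR j].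
  have -> : s%:R + - dgR j = (s - dg j)%:R by rewrite natrB // hs // -ltnS.
  by rewrite binpolyE natrM mulrA.
rewrite (nderiv_taylor _ (mulrC _ _)) (binpoly_lead n).1 mulr_sumr.
apply: eq_bigr => k _; rewrite hornerXn [(- dgR j) ^+ k]exprNn.
move: (_ ^+ k) (_ ^+ j) (_ ^+ k) (_.[_]) => a b c e; ring.
Qed.

(** The Taylor terms of index above [k] have degree below [n - k], and those of
  index below [k] vanish with their moments. *)
Lemma hs_coef k : (k <= n)%N -> (forall h, (h < k)%N -> moment h = 0) ->
  hs_poly`_(n - k) = (-1) ^+ k * moment k * ('C(n, k)%:R / n`!%:R).
Proof.
move=> kn h0; have hk : (k < n.+1)%N by rewrite ltnS.
have [sB lB] := binpoly_lead n.
rewrite /hs_poly coef_sum (bigD1 (Ordinal hk)) //= big1 ?addr0 => [|h hh].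
  rewrite coefZ coef_nderivn subnKC // lB; congr (_ * _).
  by rewrite -[LHS]mulr_natr mulrC.
rewrite coefZ coef_nderivn; case: (ltngtP h k) => hk'.
- by rewrite h0 // mulr0 mul0r.
- rewrite (nth_default 0 (s := binpoly n)) ?mul0rn ?mulr0 // sB.
  by rewrite addnBA // ltn_subRL ltn_add2r.
- by case/eqP: hh; apply: val_inj.
Qed.

Variables (d : nat).
Hypothesis pdn : (p + d <= n)%N.
Hypothesis hs_size : (size hs_poly <= d.+1)%N.

(** The coefficients of the Hilbert-Samuel polynomial above the degree [d] vanish;
  read from the top, each one kills the next moment. *)
Lemma moment0 k : (k + d < n)%N -> moment k = 0.
Proof.
elim/ltn_ind: k => k IH kd.
have kn : (k <= n)%N by rewrite (leq_trans _ (ltnW kd)) // leq_addr.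
have := hs_coef kn (fun h hk => IH h hk (leq_ltn_trans (leq_add (ltnW hk) (leqnn d)) kd)).
rewrite nth_default; last first.
  by apply: (leq_trans hs_size); rewrite ltn_subRL.
move/esym/eqP; rewrite !mulf_eq0 signr_eq0 /= invr_eq0 !pnatr_eq0.
by rewrite [X in _ || (X || _)]eqn0Ngt bin_gt0 kn eqn0Ngt fact_gt0 !orbF => /eqP.
Qed.

Lemma alt_low (f : {poly rat}) : (size f <= p)%N -> alt f = 0.
Proof.
move=> hf; rewrite (alt_coef hf) big1 // => k _; rewrite moment0 ?mulr0 //.
by apply: leq_trans pdn; rewrite ltn_add2r.
Qed.

Lemma dg_mono i j : (i < j)%N -> (j <= p)%N -> (dg i < dg j)%N.
Proof.
elim: j => // j IH; rewrite ltnS leq_eqVlt => /orP [/eqP ->|ij] jp; first exact: dg_inc.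
by apply: ltn_trans (dg_inc jp); apply: IH => //; apply: ltnW.
Qed.

Lemma dgR_inj i j : (i <= p)%N -> (j <= p)%N -> dgR i = dgR j -> i = j.
Proof.
move=> ip jp /eqP; rewrite eqr_nat => /eqP h; apply/eqP.
case: (ltngtP i j) => // hij.
  by have := dg_mono hij jp; rewrite h ltnn.
by have := dg_mono hij ip; rewrite h ltnn.
Qed.

Let lag (P : pred nat) : {poly rat} := \prod_(1 <= j < p.+1 | P j) ((dgR j)%:P - 'X).

Let lagE (P : pred nat) x : (lag P).[x] = \prod_(1 <= j < p.+1 | P j) (dgR j - x).
Proof. by rewrite horner_prod; apply: eq_bigr => j _; rewrite !hornerE. Qed.

Let lag_root (P : pred nat) j : (1 <= j <= p)%N -> P j -> (lag P).[dgR j] = 0.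
Proof.
move=> hj Pj; apply/eqP; rewrite lagE prodf_seq_eq0; apply/hasP; exists j.
  by rewrite mem_index_iota ltnS.
by rewrite Pj subrr eqxx.
Qed.

Let mon : {poly rat} := \prod_(1 <= j < p.+1) ('X - (dgR j)%:P).

Let mon_size : size mon = p.+1.
Proof. by rewrite /mon size_prod_XsubC size_iota subSS subn0. Qed.

Let mon_monic : mon \is monic. Proof. exact: monic_prod_XsubC. Qed.

Let lag_mon : lag predT = (-1) ^+ p *: mon.
Proof.
rewrite /lag /mon !big_add1 !big_mkord /= -mul_polyC rmorphXn rmorphN1.
rewrite (eq_bigr (fun j : 'I_p => - ('X - (dgR j.+1)%:P))) => [|j _]; last by rewrite opprB.
by rewrite prodrN card_ord.
Qed.

Let alt_lag (P : pred nat) : alt (lag P) = (beta 0)%:R * \prod_(1 <= j < p.+1 | P j) dgR j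
  + \sum_(1 <= j < p.+1 | ~~ P j) (-1) ^+ j * (beta j)%:R * (lag P).[dgR j].
Proof.
rewrite /alt -(big_mkord predT (fun j => (-1) ^+ j * (beta j)%:R * (lag P).[dgR j])).
rewrite big_ltn //; congr (_ + _).
  rewrite expr0 mul1r lagE; congr (_ * _); apply: eq_bigr => j _.
  by rewrite /dgR dg0 subr0.
rewrite [RHS]big_mkcond big_nat [RHS]big_nat; apply: eq_bigr => j hj.
by case: ifPn => // /negbNE Pj; rewrite lag_root ?mulr0 // -ltnS.
Qed.

(** Interpolating at all the positive shifts isolates the term of [beta 0]. *)
Lemma moment_top : (-1) ^+ p * moment p = (beta 0)%:R * \prod_(1 <= j < p.+1) dgR j.
Proof.
have := alt_lag predT; rewrite [X in _ + X]big_pred0 ?addr0 // => <-.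
rewrite lag_mon (@alt_coef _ p.+1); last by rewrite size_scale ?signr_eq0 ?mon_size.
rewrite big_ord_recr /= big1 ?add0r => [|k _]; last first.
  by rewrite moment0 ?mulr0 // (leq_trans _ pdn) // ltn_add2r.
rewrite coefZ; have := mon_monic; rewrite monicE /lead_coef mon_size /= => /eqP ->.
by rewrite mulr1.
Qed.

Lemma dgR_neq0 j : (1 <= j <= p)%N -> dgR j != 0.
Proof.
move=> /andP [j1 jp]; rewrite pnatr_eq0 -lt0n -dg0.
exact: dg_mono.
Qed.

(** The moment of order [p] is nonzero, so [p] is not among the orders for which the
  degree bound makes the moment vanish. *)
Lemma herzog_kuhl_dim : (p + d = n)%N.
Proof.
apply/eqP; rewrite eqn_leq pdn leqNgt; apply/negP => /moment0 h.
have := moment_top; rewrite h mulr0 => /esym/eqP; rewrite mulf_eq0 pnatr_eq0.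
rewrite eqn0Ngt beta0 /= prodf_seq_eq0 => /hasP [j].
by rewrite mem_index_iota => /andP [j1 jp] /=; apply/negP/dgR_neq0; rewrite j1 -ltnS.
Qed.

Lemma herzog_kuhl_multiplicity :
  d`!%:R * hs_poly`_d = (beta 0)%:R / p`!%:R * \prod_(1 <= j < p.+1) dgR j.
Proof.
have pn : (p <= n)%N by rewrite -herzog_kuhl_dim leq_addr.
have ed : d = (n - p)%N by rewrite -herzog_kuhl_dim addKn.
rewrite ed hs_coef // => [|h hp]; last first.
  by apply: moment0; rewrite -herzog_kuhl_dim ltn_add2r.
rewrite moment_top -(bin_fact pn) !natrM.
have f0 m : (m`!%:R : rat) != 0 by rewrite pnatr_eq0 -lt0n fact_gt0.
have b0 : ('C(n, p)%:R : rat) != 0 by rewrite pnatr_eq0 -lt0n bin_gt0.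
set x := \prod_(_ <= _ < _) _.
move: (f0 p) (f0 (n - p)%N) b0; move: (p`!%:R) ((n - p)`!%:R) ('C(n, p)%:R) => a b c.
by move=> a0 b0 c0; field; rewrite a0 b0 c0.
Qed.

(** Interpolating at all the positive shifts but [d_i] leaves the terms of index [0]
  and [i]; the interpolating polynomial has degree [p - 1]. *)
Lemma herzog_kuhl_betti i : (1 <= i <= p)%N ->
  (beta i)%:R = (-1) ^+ i.+1 * (beta 0)%:R *
    \prod_(1 <= j < p.+1 | j != i) (dgR j / (dgR j - dgR i)).
Proof.
move=> hi; pose P : pred nat := [pred j | j != i].
have iin : i \in index_iota 1 p.+1 by rewrite mem_index_iota ltnS.
have sz : (size (lag P) <= p)%N.
  have e : lag predT = ((dgR i)%:P - 'X) * lag P.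
    by rewrite /lag (bigD1_seq i) ?iota_uniq.
  have nzm : lag predT != 0.
    by rewrite lag_mon scaler_eq0 signr_eq0 /= -size_poly_eq0 mon_size.
  have : size (lag predT) = p.+1 by rewrite lag_mon size_scale ?signr_eq0 ?mon_size.
  move: nzm; rewrite e mulf_eq0 negb_or => /andP [h1 h2].
  by rewrite size_mul // -opprB size_opp size_XsubC add2n /= => - [->].
have := alt_low sz; rewrite alt_lag.
rewrite [X in _ + X](_ : _ = (-1) ^+ i * (beta i)%:R * (lag P).[dgR i]); last first.
  rewrite big_mkcond (bigD1_seq i) ?iota_uniq //= {1}/P /= eqxx /= big1 ?addr0 // => j ji.
  by rewrite /P /= ji.
rewrite lagE prodf_div; set Q := \prod_(_ <= _ < _ | _) (_ - _).
set Z := \prod_(_ <= _ < _ | _) _ => h.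
have Q0 : Q != 0.
  rewrite prodf_seq_neq0; apply/allP => j; rewrite mem_index_iota => /andP [j1 jp].
  apply/implyP => ji; rewrite subr_eq0; apply: contra ji => /eqP /dgR_inj -> //.
  by case/andP: hi.
apply: (mulIf Q0); rewrite -[RHS]mulrA divfK // -[LHS](signrMK i) exprS.
move/eqP: h; rewrite addrC addr_eq0 -mulrA => /eqP ->.
by rewrite mulN1r !mulNr mulrN mulrA.
Qed.

End HerzogKuhl.

(** * The equivalence *)

Section HilbertSamuel.
Variables (n : nat) (K : fieldType) (M : lmodType {mseries K[n]}).
Local Notation A := {mseries K[n]}.
Variables (p : nat) (beta : nat -> nat).
Variable phi : forall i, 'M[A]_(beta i, beta i.+1).
Variable eps : {linear 'cV[A]_(beta 0%N) -> M}.
Hypothesis res : free_resolution phi eps.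
Hypothesis minim : minimal_seq phi.
Hypothesis beta_pos : forall i, (i <= p)%N -> (0 < beta i)%N.
Hypothesis beta_zero : forall i, (p < i)%N -> beta i = 0%N.

Lemma in_deg_inc j : (j < p)%N -> (in_deg phi j < in_deg phi j.+1)%N.
Proof.
move=> jp; rewrite /in_deg big_ord_recr /= -addn1 leq_add2l.
have hm : mord 1 (phi j) by move=> k l; apply/ord1_sconst/minim.
have b1 := beta_pos jp.
have nz : phi j <> 0.
  move=> z; have [_ _ ex] := res.
  have /ex [u eu] : phi j *m (delta_mx (Ordinal b1) 0 : 'cV_(beta j.+1)) = 0.
    by rewrite z mul0mx.
  have := @mord1_phi _ _ _ _ minim j.+1 u; rewrite -eu => /mord1_sconst.
  move=> /colP /(_ (Ordinal b1)); rewrite !mxE !eqxx rmorph1 => /eqP.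
  by rewrite oner_eq0.
by rewrite lt0n; apply/eqP => e; have := mx_orderNS nz; rewrite e.
Qed.

Lemma in_deg_le j : (j <= p)%N -> (in_deg phi j <= in_deg phi p)%N.
Proof.
move=> /subnKC <-; elim: (p - j)%N => [|m IH]; first by rewrite addn0.
by rewrite addnS {2}/in_deg big_ord_recr /= (leq_trans IH) // leq_addr.
Qed.

(** The dimension is determined by the module, and two polynomials that agree at all
  large integers are equal. *)
Lemma multiplicity_unique x y : is_multiplicity M x -> is_multiplicity M y -> x = y.
Proof.
move=> [d [P [[hd hdm] [s0 hP] ->]]] [d' [P' [[hd' hdm'] [s0' hP'] ->]]].
have -> : d' = d.
  by apply/eqP; rewrite eqn_leq (hdm _ hd') (hdm' _ hd).
have e s : (maxn s0 s0' <= s)%N -> (P - P').[s%:R] = 0.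
  rewrite geq_max => /andP [h1 h2]; have [l [[hl hlm] el]] := hP s h1.
  have [l' [[hl' hlm'] el']] := hP' s h2; rewrite hornerD hornerN -el -el'.
  rewrite (_ : l = l') ?subrr //.
  by apply/eqP; rewrite eqn_leq (hlm' _ hl) (hlm _ hl').
have hs : (size (P - P')%R <= 1)%N.
  by apply: (@poly_growth _ 0 0 (maxn s0 s0')) => s /e ->; rewrite normr0 mul0n.
have := e _ (leqnn _); rewrite (size1_polyC hs) hornerC => h0.
suff -> : P = P' by [].
by apply/eqP; rewrite -subr_eq0 (size1_polyC hs) h0.
Qed.

Hypothesis acyc : acyclic (in_complex phi).
Variable d : nat.
Hypothesis Mdim : krull_dim M d.
Hypothesis Mdepth : depth (@ms_max n K) M d.

Let P := hs_poly n p beta (in_deg phi).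

Lemma hs_polyP s : (in_deg phi p <= s)%N ->
  exists l, length_quot (@mfilt n K M s.+1) l /\ l%:R = P.[s%:R].
Proof.
move=> hs; have [l [hl el]] := len_module res acyc beta_zero s.+1.
have hj j : (j <= p)%N -> (in_deg phi j <= s)%N.
  by move=> /in_deg_le h; apply: leq_trans hs.
exists l; split=> //; rewrite el /P hs_polyE //; apply: eq_bigr => j _.
by rewrite subSn ?nmon_ltS // hj // -ltnS.
Qed.

(** A regular sequence as long as the dimension bounds the growth of the values. *)
Lemma hs_poly_size : (size P <= d.+1)%N.
Proof.
have [es _ _] := res; have [[x hx] _] := Mdepth.
have [c hc] := cm_growth hx Mdim es.
apply: (@poly_growth _ (c * 2 ^ d) d (maxn 1 (in_deg phi p))) => s.
rewrite geq_max => /andP [s1 /hs_polyP [l [/length_quotE [cl _] <-]]].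
rewrite normr_nat ler_nat; apply: (leq_trans (hc _ _ cl)).
rewrite -mulnA leq_mul2l -expnMn; apply/orP; right.
have h : (s.+1 <= 2 * s)%N by rewrite mul2n -addnn -addn1 leq_add2l.
by elim: (d) => // m hm; rewrite !expnS leq_mul.
Qed.

Let pd : (p + d <= n)%N.
Proof. exact: (projdim_depth res minim Mdepth (beta_pos (leqnn p))). Qed.

Let deg0 : in_deg phi 0 = 0%N. Proof. by rewrite /in_deg big_ord0. Qed.

Lemma multiplicity_formula :
  multiplicity M = (beta 0%N)%:R / p`!%:R * \prod_(1 <= i < p.+1) (in_deg phi i)%:R.
Proof.
rewrite -(herzog_kuhl_multiplicity deg0 in_deg_inc (beta_pos (leq0n p)) pd hs_poly_size).
have hM : is_multiplicity M (d`!%:R * P`_d).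
  exists d, P; split=> //; exists (in_deg phi p) => s hs; exact: hs_polyP.
by apply: xget_unique => // y hy; apply: multiplicity_unique hy hM.
Qed.

Lemma betti_formula i : (1 <= i <= p)%N ->
  (beta i)%:R = (-1) ^+ i.+1 * (beta 0%N)%:R *
    \prod_(1 <= j < p.+1 | j != i)
       ((in_deg phi j)%:R / ((in_deg phi j)%:R - (in_deg phi i)%:R)) :> rat.
Proof. exact: (herzog_kuhl_betti deg0 in_deg_inc pd hs_poly_size). Qed.

End HilbertSamuel.

Theorem theorem1p4 (K : fieldType) (n : nat) (M : lmodType {mseries K[n]})
    (p : nat) (beta : nat -> nat)
    (phi : forall i, 'M[{mseries K[n]}]_(beta i, beta i.+1))
    (eps : {linear 'cV[{mseries K[n]}]_(beta 0%N) -> M})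
    (M_fg : finitely_generated M)
    (M_CM : cohen_macaulay (@ms_max n K) M)
    (M_pd : projdim M p)
    (F_min : minimal_free_resolution p phi eps) :
  has_pure_resolution (assoc_graded M) <->
  [/\ acyclic (in_complex phi),
      forall i : nat, (1 <= i <= p)%N ->
        (beta i)%:R = (-1) ^+ i.+1 * (beta 0%N)%:R *
          \prod_(1 <= j < p.+1 | j != i)
             ((in_deg phi j)%:R / ((in_deg phi j)%:R - (in_deg phi i)%:R)) :> rat
    & multiplicity M =
        (beta 0%N)%:R / p`!%:R * \prod_(1 <= i < p.+1) (in_deg phi i)%:R].
Proof.
have [res phi_max beta_zero] := F_min.
have [M0 [d [Mdim Mdepth]]] := M_CM.
have minim : minimal_seq phi.
  by move=> i k l; apply/ord1_sconst; rewrite -ms_max_ord.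
have beta_pos i : (i <= p)%N -> (0 < beta i)%N.
  exact: (minimal_nonzero (ev := @sconst n K) res minim M_pd M0).
split=> [pure|[acyc _ _]].
  have acyc := pure_resolution_acyclic res minim (beta_pos _ (leq0n p)) pure.
  split=> //.
    exact: (betti_formula res minim beta_pos beta_zero acyc Mdim Mdepth).
  exact: (multiplicity_formula res minim beta_pos beta_zero acyc Mdim Mdepth).
exact: (in_pure res acyc minim (beta_pos _ (leqnn p)) beta_zero).
Qed.
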